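(* Let $L_\delta:L^2([0,1],\mathbb C)\to L^2([0,1],\mathbb C)$, where $\delta\in I_0:=[0,\bar\delta)$, be integral-preserving compact operators ($\int L_\delta g\,dm=\int g\,dm$ for all $g$). Assume that the map $\delta\mapsto L_\delta$ is in $C^1(I_0,\mathcal B(L^2([0,1],\mathbb C)))$ and that $L_0$ is mixing, i.e. $\lim_{n\to\infty}\|L_0^ng\|_2=0$ for every $g\in V$. Then $\lambda_{1,0}:=1\in\sigma(L_0)$ and $r(L_0)=1$. Let $\mathcal I\subset\sigma(L_0)\setminus\{1\}$ be the eigenvalue(s) of maximal modulus strictly inside the unit disk; assume they are geometrically simple and let $s:=|\mathcal I|+1$. Then there exists an interval $I_1:=[0,\delta_1)$, $I_1\subset I_0$, such that for $\delta\in I_1$, $L_\delta$ has $s$ dominating simple eigenvalues. Thus, there exist functions $e_{i,(\cdot)},\hat e_{i,(\cdot)}\in C^1(I_1,L^2([0,1],\mathbb C))$ and $\lambda_{i,(\cdot)}\in C^1(I_1,\mathbb C)$ such that for $\delta\in I_1$ and $i,j=2,\dots,s$: (i) $L_\delta e_{i,\delta}=\lambda_{i,\delta}e_{i,\delta}$ and $L_\delta^*\hat e_{i,\delta}=\lambda_{i,\delta}\hat e_{i,\delta}$; (ii) $\langle e_{i,\delta},\hat e_{j,\delta}\rangle_{L^2([0,1],\mathbb C)}=\delta_{i,j}$, where $\delta_{i,j}$ is the Kronecker delta. Furthermore, let $\dot\lambda_i\in\mathbb C$ satisfy $\lim_{\delta\to0}\left|\frac{\lambda_{i,\delta}-\lambda_{i,0}}{\delta}-\dot\lambda_i\right|=0$;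 then $$\dot\lambda_i=\langle\hat e_{i,0},\dot L e_{i,0}\rangle_{L^2([0,1],\mathbb C)} .$$
   Context: $m$ is Lebesgue measure on $[0,1]$; $V:=\{f\in L^2:\int f\,dm=0\}$. $\mathcal B(X)$ is the space of bounded linear operators on $X$, $\sigma(L)$ is the spectrum and $r(L)$ the spectral radius of $L$. $\langle f,g\rangle_{L^2([0,1],\mathbb C)}=\int f\,\overline{g}\,dm$, and the adjoint $L^*$ is defined by the duality relation $\langle Lf,g\rangle=\langle f,L^*g\rangle$. The eigenvalues in $\mathcal I$ are denoted $\lambda_{2,0},\dots,\lambda_{s,0}$. $\dot L:L^2\to V$ is the unique linear operator satisfying $\lim_{\delta\to0}\left\|\frac{L_\delta-L_0}{\delta}-\dot L\right\|_{L^2\to V}=0$. For $s\in\mathbb N$, $s\ge1$, an operator $L\in\mathcal B(L^2([0,1],\mathbb C))$ has $s$ dominating simple eigenvalues if there exist closed subspaces $E,\tilde E$ such that: $L^2([0,1],\mathbb C)=E\oplus\tilde E$; $L(E)\subset E$ and $L(\tilde E)\subset\tilde E$; $\dim E=s$ and $L|_E$ has $s$ geometrically simple eigenvalues $\lambda_1,\dots,\lambda_s$; and $r(L|_{\tilde E})<\min\{|\lambda_i|:i=1,\dots,s\}$.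
   Formalization: The eigenvalues in I are also assumed nonzero and without Jordan blocks (the claim always fails otherwise); in (i) the adjoint eigenvalue is the complex conjugate of λ_{i,δ}, and the derivative of λ_i is the complex conjugate of ⟨ê_{i,0}, L̇e_{i,0}⟩. *)

(* Defs.v *)
From HB Require Import structures.
From mathcomp Require Import all_boot all_order all_algebra.
From mathcomp Require Import generic_quotient ring_quotient.
From mathcomp Require Import all_classical all_reals all_analysis.
From mathcomp Require Import measurable_realfun complex.

Set Implicit Arguments.
Unset Strict Implicit.
Unset Printing Implicit Defensive.

Import Order.TTheory GRing.Theory Num.Theory.
Import numFieldNormedType.Exports.
Import Quotient.

Local Open Scope classical_set_scope.
Local Open Scope ring_scope.
Local Open Scope complex_scope.
Local Open Scope quotient_scope.

(* Norms on a normed space over R[i] take values in R[i]; [rnorm] is the same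
   norm as a real number (see [rnormE]). *)
Definition rnorm (R : realType) (V : normedZmodType R[i]) (x : V) : R :=
  complex.Re `|x|.

Section rnorm_theory.
Context (R : realType) (V : normedZmodType R[i]).
Implicit Types x y : V.

Lemma rnormE x : (rnorm x)%:C = `|x|.
Proof. by rewrite /rnorm RRe_real// normr_real. Qed.

Lemma rnorm_ge0 x : 0 <= rnorm x.
Proof. by rewrite -lecR rnormE normr_ge0. Qed.

Lemma rnorm_le x y : (rnorm x <= rnorm y) = (`|x| <= `|y|).
Proof. by rewrite -lecR !rnormE. Qed.

Lemma rnormD x y : rnorm (x + y) <= rnorm x + rnorm y.
Proof. by rewrite -lecR rmorphD /= !rnormE ler_normD. Qed.

Lemma rnorm0 : rnorm (0 : V) = 0.
Proof. by rewrite /rnorm normr0. Qed.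

Lemma rnorm0_eq0 x : rnorm x = 0 -> x = 0.
Proof. by move=> h; apply/normr0_eq0; rewrite -rnormE h. Qed.
End rnorm_theory.

Lemma rnormM (R : realType) (x y : R[i]) : rnorm (x * y) = rnorm x * rnorm y.
Proof. by apply: complexI; rewrite rmorphM /= !rnormE normrM. Qed.

Lemma rnormZ (R : realType) (V : normedModType R[i]) (a : R[i]) (x : V) :
  rnorm (a *: x) = rnorm a * rnorm x.
Proof. by apply: complexI; rewrite rmorphM /= !rnormE normrZ. Qed.

Section complex_L2.
Context d (T : measurableType d) (R : realType).
Variable mu : {measure set T -> \bar R}.

Definition sqintegrable (f : T -> R[i]) : Prop :=
  [/\ measurable_fun [set: T] (fun x => complex.Re (f x)),
      measurable_fun [set: T] (fun x => complex.Im (f x)) &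
      finite_norm mu 2%:E (fun x => rnorm (f x))].

Definition sqint : {pred T -> R[i]} := mem [set f | sqintegrable f].

Lemma measurable_rnorm (f : T -> R[i]) :
  measurable_fun [set: T] (fun x => complex.Re (f x)) ->
  measurable_fun [set: T] (fun x => complex.Im (f x)) ->
  measurable_fun [set: T] (fun x => rnorm (f x)).
Proof.
move=> mr mi.
have -> : (fun x => rnorm (f x)) =
    Num.sqrt \o (fun x => complex.Re (f x) ^+ 2 + complex.Im (f x) ^+ 2).
  by apply/funext => x; rewrite /rnorm normc_def.
apply: measurableT_comp; first by apply: continuous_measurable_fun; exact: sqrt_continuous.
by apply: measurable_funD; apply: measurable_funX.
Qed.

Lemma Lnorm2_le (f g : T -> R) : measurable_fun [set: T] f ->
  measurable_fun [set: T] g -> (forall x, 0 <= f x <= g x) ->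
  ('N[mu]_2%:E[EFin \o f] <= 'N[mu]_2%:E[EFin \o g])%E.
Proof.
move=> mf mg fg; have I0 (h : T -> R) : (0 <= \int[mu]_x (`|(EFin \o h) x| `^ 2))%E.
  by apply: integral_ge0 => x _ /=; rewrite lee_fin powR_ge0.
have mI (h : T -> R) : measurable_fun [set: T] h ->
    measurable_fun [set: T] (fun x => (`|(EFin \o h) x| `^ 2)%E).
  move=> mh; apply/measurable_EFinP.
  apply: (@measurableT_comp _ _ _ _ _ _ (@powR R ^~ 2)) => //.
  exact: measurableT_comp.
rewrite Lnorm.unlock; apply: gt0_ler_poweR => //.
- by rewrite in_itv/= I0 leey.
- by rewrite in_itv/= I0 leey.
apply: ge0_le_integral => //.
- by move=> x _ /=; rewrite lee_fin powR_ge0.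
- exact: mI.
- exact: mI.
move=> x _ /=; rewrite lee_fin; have /andP[f0 fgx] := fg x.
have g0 := le_trans f0 fgx.
by rewrite ge0_ler_powR// ?nnegrE// !ger0_norm.
Qed.

Lemma sqint_Lfun (f : T -> R[i]) : sqintegrable f ->
  (fun x => rnorm (f x)) \in Lfun mu 2%:E.
Proof.
move=> [mr mi fin]; rewrite inE/=; apply/andP; split; rewrite inE//=.
exact: measurable_rnorm.
Qed.


Lemma sqint_submod_closed : submod_closed sqint.
Proof.
split.
  rewrite inE/=; split.
  - exact: measurable_cst.
  - exact: measurable_cst.
  - rewrite /finite_norm (_ : (fun _ => _) = cst (0 : R)).
      by apply: finite_norm_cst0; rewrite lee1n.
    by apply/funext => x /=; rewrite rnorm0.
move=> a f g; rewrite !inE/= => sf sg.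
have [[fr fi _] [gr gi _]] := (sf, sg).
have mr : measurable_fun [set: T] (fun x => complex.Re ((a *: f + g) x)).
  rewrite (_ : (fun _ => _) = (fun x => complex.Re a * complex.Re (f x)
     - complex.Im a * complex.Im (f x) + complex.Re (g x))).
    apply: measurable_funD => //.
    by apply: measurable_funB; apply: measurable_funM.
  by apply/funext => x; rewrite !fctE /=; case: (a) (f x) (g x) => ? ? [? ?] [? ?].
have mi : measurable_fun [set: T] (fun x => complex.Im ((a *: f + g) x)).
  rewrite (_ : (fun _ => _) = (fun x => complex.Re a * complex.Im (f x)
     + complex.Im a * complex.Re (f x) + complex.Im (g x))).
    apply: measurable_funD => //.
    by apply: measurable_funD; apply: measurable_funM.
  by apply/funext => x; rewrite !fctE /=; case: (a) (f x) (g x) => ? ? [? ?] [? ?].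
split => //.
have h : rnorm a *: (fun x => rnorm (f x)) + (fun x => rnorm (g x))
    \in Lfun mu 2%:E.
  have [_ h] := @Lfun_submod_closed _ _ _ mu 2%:E (lee1n 2).
  by apply: h; exact: sqint_Lfun.
move: h; rewrite inE => /andP[/[!inE]/= mh fh].
apply: le_lt_trans fh; apply: Lnorm2_le => //; first exact: measurable_rnorm.
move=> x; rewrite rnorm_ge0/=.
change (rnorm (a * f x + g x) <= rnorm a * rnorm (f x) + rnorm (g x)).
by rewrite -rnormM; exact: rnormD.
Qed.

HB.instance Definition _ := GRing.isSubmodClosed.Build _ _ sqint
  sqint_submod_closed.

Record sqfun := SqFun { sqfun_val :> T -> R[i]; _ : sqfun_val \in sqint }.

HB.instance Definition _ := [isSub for sqfun_val].
HB.instance Definition _ := gen_eqMixin sqfun.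
HB.instance Definition _ := gen_choiceMixin sqfun.
HB.instance Definition _ := [SubChoice_isSubLmodule of sqfun by <:].

Lemma sqfunP (f : sqfun) : sqintegrable f.
Proof. by have := valP f; rewrite inE. Qed.

(* L2 is the quotient of the square-integrable functions by the functions
   vanishing almost everywhere. *)
Definition ae0 : {pred sqfun} :=
  mem [set f : sqfun | {ae mu, forall x, f x = 0}].

Lemma ae0_zmod_closed : zmod_closed ae0.
Proof.
split; first by rewrite inE/=; apply: nearW.
move=> f g; rewrite !inE/= => f0 g0.
apply: filterS2 f0 g0 => x /= fx gx.
by change (f x - g x = 0); rewrite fx gx subr0.
Qed.

HB.instance Definition _ := GRing.isZmodClosed.Build _ ae0 ae0_zmod_closed.

Definition L2 : Type := {quot ae0}.

HB.instance Definition _ := GRing.Zmodule.on L2.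
HB.instance Definition _ := EqQuotient.on L2.

Definition L2_fun (f : L2) : T -> R[i] := repr f.


Lemma L2P (f g : sqfun) :
  \pi_L2 f = \pi_L2 g <-> {ae mu, forall x, f x = g x}.
Proof.
split=> [/eqP|fg].
  rewrite -Quotient.idealrBE inE/=; apply: filterS => x.
  by move=> h; apply/eqP; rewrite -subr_eq0; apply/eqP.
apply/eqP; rewrite -Quotient.idealrBE inE/=; apply: filterS fg => x /= fg.
by change (f x - g x = 0); rewrite fg subrr.
Qed.

Lemma L2_fun_pi (f : sqfun) : {ae mu, forall x, L2_fun (\pi_L2 f) x = f x}.
Proof. by apply/L2P; rewrite /L2_fun reprK. Qed.

Definition L2_scale (a : R[i]) (f : L2) : L2 := \pi_L2 (a *: repr f).

Lemma pi_scale a (f : sqfun) : \pi_L2 (a *: f) = L2_scale a (\pi_L2 f).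
Proof.
apply/L2P; have := L2_fun_pi f; apply: filterS => x /= h.
by change (a * f x = a * L2_fun (\pi_L2 f) x); rewrite h.
Qed.

Lemma pi_add (f g : sqfun) : \pi_L2 (f + g) = \pi_L2 f + \pi_L2 g.
Proof. exact: Quotient.pi_add. Qed.

Fact L2_scaleA a b (f : L2) : L2_scale a (L2_scale b f) = L2_scale (a * b) f.
Proof.
rewrite -[f]reprK; move: (repr f) => g.
by rewrite -(pi_scale b g) -(pi_scale a) -(pi_scale (a * b)) scalerA.
Qed.

Fact L2_scale1 : left_id 1 L2_scale.
Proof. by move=> f; rewrite -[f]reprK -pi_scale scale1r. Qed.

Fact L2_scaleDr : right_distributive L2_scale +%R.
Proof.
move=> a f g; rewrite -[f]reprK -[g]reprK; move: (repr f) (repr g) => h k.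
by rewrite -pi_add -!pi_scale -pi_add scalerDr.
Qed.

Fact L2_scaleDl (f : L2) : {morph L2_scale^~ f : a b / a + b}.
Proof.
move=> a b; rewrite -[f]reprK; move: (repr f) => g.
by rewrite -!pi_scale -pi_add scalerDl.
Qed.

HB.instance Definition _ := GRing.Zmodule_isLmodule.Build R[i] L2
  L2_scaleA L2_scale1 L2_scaleDr L2_scaleDl.

Definition L2_norm (f : L2) : R[i] :=
  (fine (Lnorm mu 2%:E (fun x => (rnorm (L2_fun f x))%:E)))%:C.


Lemma Lnorm2_ae (f g : sqfun) : {ae mu, forall x, f x = g x} ->
  Lnorm mu 2%:E (fun x => (rnorm (f x))%:E) =
  Lnorm mu 2%:E (fun x => (rnorm (g x))%:E).
Proof.
move=> fg; rewrite Lnorm.unlock; congr (_ `^ _)%E.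
have mI (h : sqfun) :
    measurable_fun [set: T] (fun x => (`|(rnorm (h x))%:E| `^ 2)%E).
  have [hr hi _] := sqfunP h; apply/measurable_EFinP.
  apply: (@measurableT_comp _ _ _ _ _ _ (@powR R ^~ 2)) => //.
  apply: measurableT_comp => //; exact: measurable_rnorm.
apply: ge0_ae_eq_integral => //.
- by move=> x _ /=; rewrite lee_fin powR_ge0.
- by move=> x _ /=; rewrite lee_fin powR_ge0.
by apply: filterS fg => x /= -> _.
Qed.

Definition sqnorm (f : sqfun) : R :=
  fine (Lnorm mu 2%:E (fun x => (rnorm (f x))%:E)).

Lemma L2_norm_pi (f : sqfun) : L2_norm (\pi_L2 f) = (sqnorm f)%:C.
Proof. by congr (fine _)%:C; apply: Lnorm2_ae; exact: L2_fun_pi. Qed.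

Lemma sqnormE (f : sqfun) :
  (sqnorm f)%:E = Lnorm mu 2%:E (fun x => (rnorm (f x))%:E).
Proof.
rewrite fineK// ge0_fin_numE ?Lnorm_ge0//.
by have [] := sqfunP f.
Qed.

Lemma sqnormD (f g : sqfun) : sqnorm (f + g) <= sqnorm f + sqnorm g.
Proof.
rewrite -lee_fin EFinD !sqnormE.
have [fr fi _] := sqfunP f; have [gr gi _] := sqfunP g.
have [hr hi _] := sqfunP (f + g).
have mf := measurable_rnorm fr fi; have mg := measurable_rnorm gr gi.
have mh := measurable_rnorm hr hi.
apply: le_trans (eminkowski _ mf mg _); last by rewrite lee1n.
apply: Lnorm2_le => //; first exact: measurable_funD.
by move=> x; rewrite rnorm_ge0 /=; exact: rnormD.
Qed.

Lemma sqnormZ a (f : sqfun) : sqnorm (a *: f) = rnorm a * sqnorm f.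
Proof.
apply: EFin_inj; rewrite EFinM !sqnormE.
have sf := sqfunP f.
have := LnormZ (Lfun_Sub (lee1n 2) (sqint_Lfun sf)) (rnorm a).
rewrite ger0_norm ?rnorm_ge0//= => <-; congr (Lnorm _ _ _).
by apply/funext => x /=; congr (_%:E); exact: rnormM.
Qed.

Fact L2_normD (f g : L2) : L2_norm (f + g) <= L2_norm f + L2_norm g.
Proof.
rewrite -[f]reprK -[g]reprK; move: (repr f) (repr g) => h k.
by rewrite -pi_add !L2_norm_pi -rmorphD lecR sqnormD.
Qed.

Fact L2_normZ a (f : L2) : L2_norm (a *: f) = `|a| * L2_norm f.
Proof.
rewrite -[f]reprK; move: (repr f) => h.
change (L2_norm (L2_scale a (\pi_L2 h)) = `|a| * L2_norm (\pi_L2 h)).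
by rewrite -pi_scale !L2_norm_pi sqnormZ rmorphM/= rnormE.
Qed.

Fact L2_norm_eq0 (f : L2) : L2_norm f = 0 -> f = 0.
Proof.
rewrite -[f]reprK; move: (repr f) => h; rewrite L2_norm_pi => /complexI h0.
have -> : 0 = \pi_L2 (0 : sqfun) :> L2 
  by apply: (addrI (\pi_L2 (0 : sqfun))); rewrite addr0 -pi_add addr0.
apply/L2P; have sh := sqfunP h.
have := @fine_Lnormr_eq0 _ _ _ mu _ (lee1n 2) (Lfun_Sub (lee1n 2) (sqint_Lfun sh)) h0.
by apply: filterS => x /= /(_ I)/rnorm0_eq0.
Qed.

HB.instance Definition _ := Lmodule_isNormed.Build R[i] L2
  L2_normD L2_normZ L2_norm_eq0.

Definition cintegral (h : T -> R[i]) : R[i] :=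
  (\int[mu]_x complex.Re (h x)) +i* (\int[mu]_x complex.Im (h x)).

Definition L2_integral (f : L2) : R[i] := cintegral (L2_fun f).

Definition L2_inner (f g : L2) : R[i] :=
  cintegral (fun x => L2_fun f x * (L2_fun g x)^*).

Definition mean_zero : set L2 := [set f | L2_integral f = 0].

End complex_L2.

Section bounded_operator.
Context (R : realType) (X : normedModType R[i]).

Definition bounded_linear (A : X -> X) : Prop :=
  (forall (a : R[i]) u v, A (a *: u + v) = a *: A u + A v) /\
  exists M : R, forall u, rnorm (A u) <= M * rnorm u.

Definition blin : {pred X -> X} := mem [set A | bounded_linear A].

Lemma blin_submod_closed : submod_closed blin.
Proof.
split.
  rewrite inE; split.
    by move=> a u v; change (0 = a *: 0 + 0 :> X); rewrite scaler0 addr0.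
  by exists 0 => u; rewrite mul0r; change (rnorm (0 : X) <= 0); rewrite rnorm0.
move=> a A B; rewrite !inE => -[lA [MA bA]] [lB [MB bB]]; split.
  move=> b u v; change (a *: A (b *: u + v) + B (b *: u + v) =
    b *: (a *: A u + B u) + (a *: A v + B v)).
  by rewrite lA lB !scalerDr addrACA !scalerA mulrC.
exists (rnorm a * MA + MB) => u.
change (rnorm (a *: A u + B u) <= (rnorm a * MA + MB) * rnorm u).
rewrite (le_trans (rnormD _ _))// rnormZ mulrDl lerD// -mulrA.
by rewrite ler_wpM2l// rnorm_ge0.
Qed.

HB.instance Definition _ := GRing.isSubmodClosed.Build _ _ blin
  blin_submod_closed.

Record bop := BOp { bop_val :> X -> X; _ : bop_val \in blin }.

HB.instance Definition _ := [isSub for bop_val].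
HB.instance Definition _ := gen_eqMixin bop.
HB.instance Definition _ := gen_choiceMixin bop.
HB.instance Definition _ := [SubChoice_isSubLmodule of bop by <:].

Lemma bopP (A : bop) : bounded_linear A.
Proof. by have := valP A; rewrite inE. Qed.

Fact bop_linear (A : bop) : linear (A : X -> X).
Proof. by have [] := bopP A. Qed.

HB.instance Definition _ (A : bop) :=
  GRing.isLinear.Build R[i] X X *:%R (A : X -> X) (bop_linear A).

Implicit Types A B : bop.

(* Supremum of a nonempty set of reals bounded above, by [has_sup_img]. *)
Definition opnorm (A : bop) : R :=
  sup [set rnorm (A u) | u in [set u : X | rnorm u <= 1]].

Let ball_img (A : bop) := [set rnorm (A u) | u in [set u : X | rnorm u <= 1]].

Let has_sup_img A : has_sup (ball_img A).
Proof.
split; first by exists (rnorm (A 0)); exists 0 => //=; rewrite rnorm0.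
have [_ [M bM]] := bopP A; exists `|M| => _ [u /= u1 <-].
rewrite (le_trans (bM u))// (le_trans (ler_norm _))// normrM.
by rewrite (ger0_norm (rnorm_ge0 u)) ler_piMr.
Qed.

Lemma opnorm_ub A u : rnorm u <= 1 -> rnorm (A u) <= opnorm A.
Proof. by move=> u1; apply: (ub_le_sup (has_sup_img A).2); exists u. Qed.

Lemma opnorm_le A c : (forall u, rnorm u <= 1 -> rnorm (A u) <= c) ->
  opnorm A <= c.
Proof.
move=> h; apply: ge_sup; first exact: (has_sup_img A).1.
by move=> _ [u /= u1 <-]; exact: h.
Qed.

Lemma opnorm_ge0 A : 0 <= opnorm A.
Proof.
by apply: le_trans (rnorm_ge0 (A 0)) (opnorm_ub _ _); rewrite rnorm0.
Qed.

Lemma rnorm_realC (r : R) : 0 <= r -> rnorm (r%:C : R[i]) = r.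
Proof. by move=> r0; rewrite /rnorm ger0_norm// -[0]/(0%:C) lecR. Qed.

Lemma opnormP A u : rnorm (A u) <= opnorm A * rnorm u.
Proof.
have [u0|u0] := eqVneq (rnorm u) 0.
  by rewrite (rnorm0_eq0 u0) linear0 !rnorm0 mulr0.
have up : 0 < rnorm u by rewrite lt_neqAle eq_sym u0 rnorm_ge0.
have /(opnorm_ub A) : rnorm (((rnorm u)^-1)%:C *: u) <= 1.
  by rewrite rnormZ rnorm_realC ?invr_ge0 ?rnorm_ge0// mulVf.
rewrite linearZ /= rnormZ rnorm_realC ?invr_ge0 ?rnorm_ge0//.
by rewrite mulrC ler_pdivrMr.
Qed.

Fact opnormCD (A B : bop) :
  (opnorm (A + B))%:C <= (opnorm A)%:C + (opnorm B)%:C.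
Proof.
rewrite -rmorphD lecR; apply: opnorm_le => u u1.
by apply: le_trans (rnormD _ _) (lerD (opnorm_ub _ u1) (opnorm_ub _ u1)).
Qed.

Fact opnormCZ (a : R[i]) (A : bop) :
  (opnorm (a *: A))%:C = `|a| * (opnorm A)%:C.
Proof.
rewrite -rnormE -rmorphM; congr (_%:C); apply/eqP; rewrite eq_le; apply/andP.
split.
  apply: opnorm_le => u u1; change (rnorm (a *: A u) <= rnorm a * opnorm A).
  by rewrite rnormZ ler_wpM2l ?rnorm_ge0// opnorm_ub.
have [->|a0] := eqVneq a 0; first by rewrite rnorm0 mul0r opnorm_ge0.
have ap : 0 < rnorm a.
  rewrite lt_neqAle rnorm_ge0 andbT eq_sym; apply: contra a0 => /eqP h.
  by apply/eqP; exact: rnorm0_eq0.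
rewrite mulrC -ler_pdivlMr//; apply: opnorm_le => u u1.
rewrite ler_pdivlMr// mulrC -rnormZ.
exact: (opnorm_ub (a *: A) u1).
Qed.

Fact opnormC_eq0 (A : bop) : (opnorm A)%:C = 0 -> A = 0.
Proof.
move=> /complexI A0; apply: val_inj; apply/funext => u /=.
apply: rnorm0_eq0; apply/eqP; rewrite eq_le rnorm_ge0 andbT.
by have := opnormP A u; rewrite A0 mul0r.
Qed.

HB.instance Definition _ := Lmodule_isNormed.Build R[i] bop
  opnormCD opnormCZ opnormC_eq0.

End bounded_operator.

(* The [0] branch is never taken: every bounded operator on [L2 mu] has
   exactly one adjoint. *)
Definition adjoint d (T : measurableType d) (R : realType)
    (mu : {measure set T -> \bar R}) (A : bop (L2 mu)) : bop (L2 mu) :=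
  xget 0 [set B : bop (L2 mu) | forall f g : L2 mu,
    L2_inner (A f) g = L2_inner f (B g)].

Section spectral.
Context (R : realType) (X : normedModType R[i]).
Implicit Types (A : bop X) (E W : set X) (l : R[i]).

Definition closed_subspace W : Prop :=
  [/\ closed W, W 0 & forall a u v, W u -> W v -> W (a *: u + v)].

Definition invariant A W : Prop := A @` W `<=` W.

Definition bounded_linear_on W (B : X -> X) : Prop :=
  [/\ B @` W `<=` W,
      forall a u v, W u -> W v -> B (a *: u + v) = a *: B u + B v &
      exists M : R, forall u, W u -> rnorm (B u) <= M * rnorm u].

(* [W] is meant to be invariant under [A]: this is the spectrum of A|W in
   B(W), [B] being only relevant through its restriction to [W]. *)
Definition spectrum_on A W : set R[i] :=
  [set l | ~ exists B : X -> X,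
    [/\ bounded_linear_on W B,
        forall u, W u -> B (l *: u - A u) = u &
        forall u, W u -> l *: B u - A (B u) = u]].

Definition spectrum A : set R[i] := spectrum_on A [set: X].

(* [sup set0 = 0], so the operator on the zero space has spectral radius 0. *)
Definition spectral_radius_on A W : R :=
  sup [set rnorm l | l in spectrum_on A W].

Definition spectral_radius A : R := spectral_radius_on A [set: X].

Definition is_eigenvalue A l : Prop := exists2 v : X, v != 0 & A v = l *: v.

Definition geometrically_simple_on A W l : Prop :=
  exists v : X, [/\ W v, v != 0, A v = l *: v &
    forall w, W w -> A w = l *: w -> exists a : R[i], w = a *: v].

Definition geometrically_simple A l : Prop :=
  geometrically_simple_on A [set: X] l.

(* [A] has no nontrivial Jordan block at [l]: ker (A - l)^2 = ker (A - l). *)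
Definition semisimple A l : Prop :=
  forall u : X, let v := A u - l *: u in A v = l *: v -> v = 0.

Definition has_dim W (n : nat) : Prop :=
  exists b : 'I_n -> X,
    (forall c : 'I_n -> R[i],
       \sum_(i < n) c i *: b i = 0 -> forall i, c i = 0) /\
    W = [set \sum_(i < n) c i *: b i | c in [set: 'I_n -> R[i]]].

Definition direct_sum E W : Prop :=
  (forall u, exists v w, [/\ E v, W w & u = v + w]) /\ E `&` W = [set 0].

Definition has_dominating_simple_eigenvalues (s : nat) A : Prop :=
  (0 < s)%N /\
  exists E W : set X,
    [/\ closed_subspace E /\ closed_subspace W,
        direct_sum E W,
        invariant A E /\ invariant A W,
        has_dim E s &
        exists lam : 'I_s -> R[i],
          [/\ injective lam,
              forall i, geometrically_simple_on A E (lam i) &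
              forall i, spectral_radius_on A W < rnorm (lam i)]].

Definition compact_operator A : Prop :=
  compact (closure (A @` [set u | rnorm u <= 1])).

(* The eigenvalues of maximal modulus strictly inside the unit disk; [1] is
   excluded by [rnorm l < 1]. *)
Definition subdominant A : set R[i] :=
  [set l | [/\ is_eigenvalue A l, rnorm l < 1 &
    forall l', is_eigenvalue A l' -> rnorm l' < 1 -> rnorm l' <= rnorm l]].

(* Continuous differentiability on [0, b), one-sided at 0; values of [f]
   outside [0, b) are irrelevant. *)
Definition C1_on (b : R) (f : R -> X) : Prop :=
  exists f' : R -> X,
    (forall t, t \in `[0, b[ ->
       ((s - t)^-1)%:C *: (f s - f t) @[s --> within [set` `[0, b[] t^']
         --> f' t) /\
    {within [set` `[0, b[], continuous f'}.

End spectral.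

Definition lebesgue01 (R : realType) :
    {measure set (measurableTypeR R) -> \bar R} :=
  mrestr (@lebesgue_measure R) (measurable_itv `[0%R, 1%R]).

(* Main.v *)
(** For a simple eigenvalue [lam0 <> 0] of [L 0], with unit eigenvector [e0],
    the bordered operator [l - L d + <., e0> e0] is injective at
    [(d, l) = (0, lam0)], hence, by the Riesz theory of compact operators,
    boundedly invertible nearby.  With [B] its inverse and [x = B e0],
    [(l - L d) x = (1 - <x, e0>) e0]: the eigenvalues of [L d] near [lam0] are
    the solutions of the scalar equation [<x, e0> = 1], a fixed-point problem
    for a contraction of the complex plane.  At the solution, [x] is an
    eigenvector of [L d] and the adjoint [B^*] maps [e0] to one of the adjoint
    of [L d].  Pairing [L s x_s = lam_s x_s] with the left eigenvector [y_t]
    gives [(lam_s - lam_t) <x_s, y_t> = <(L s - L t) x_s, y_t>]; dividing by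
    [s - t] differentiates [lam], then [B], and so the eigenvectors.

    The rest of the spectrum is controlled by deflation: subtracting the
    spectral part [sum_i lam_i <., ehat_i> e_i] from [L d] leaves a compact
    operator without eigenvalues of modulus at least [rho] at [d = 0]; it
    satisfies [c |u| <= |l u - Q u|] uniformly for [|l| >= rho], and such a
    bound survives small changes of [Q] and of [rho].

    Adjoints exist because [L2] is complete: this is proved for sequences with
    geometrically decreasing steps, through almost everywhere convergence and
    Fatou's lemma. *)

Require Import Defs.
From mathcomp Require Import all_boot all_order all_algebra.
From mathcomp Require Import all_classical all_reals all_analysis.
From mathcomp Require Import measurable_realfun complex.
From mathcomp Require Import ring lra.

Set Implicit Arguments.
Unset Strict Implicit.
Unset Printing Implicit Defensive.

Import Order.TTheory GRing.Theory Num.Theory.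
Import numFieldNormedType.Exports.

Local Open Scope classical_set_scope.
Local Open Scope ring_scope.
Local Open Scope complex_scope.

(** * Complex scalars and subsequences *)

(** Bordering only cures an eigenvalue without Jordan block: if [L 0 w = lam0 w + e0], then, after a
    shift of [w] along [e0] making [<w, e0> = 1], the bordered operator kills [w]. This is why
    semisimplicity accompanies geometric simplicity. Compactness acts twice: it turns the absence of
    eigenvectors into a uniform lower bound, and such a bound into surjectivity. Regularity is
    gained in two rounds, because the difference quotient of [lam] contains [x_s], which itself
    depends on [lam_s]. The contraction bounds the distance from [lam_s] to [lam_t] by a multiple of
    that from [L s] to [L t], hence continuity of [lam], of the resolvent and of the eigenvectors;
    only then do the quotients converge. Some of the eigenvalues that are kept may lie on the circle
    of radius [rho] and move inwards, so the rest of the spectrum has to be confined to a slightly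
    smaller disk. *)

Section rnorm_extra.
Context (R : realType) (V : normedZmodType R[i]).
Implicit Types u v w : V.

Lemma rnormN u : rnorm (- u) = rnorm u.
Proof. by rewrite /rnorm normrN. Qed.

Lemma rnormBC u v : rnorm (u - v) = rnorm (v - u).
Proof. by rewrite /rnorm distrC. Qed.

Lemma rnormB u v : rnorm (u - v) <= rnorm u + rnorm v.
Proof. by rewrite -(rnormN v) rnormD. Qed.

Lemma rnorm_dist u v : rnorm u <= rnorm (u - v) + rnorm v.
Proof. by rewrite -{1}(subrK v u) rnormD. Qed.

Lemma rnorm_dist3 u v w : rnorm (u - w) <= rnorm (u - v) + rnorm (v - w).
Proof. by rewrite -{1}(subrK v u) -addrA rnormD. Qed.

Lemma rnorm_eq0 u : (rnorm u == 0) = (u == 0).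
Proof. by apply/eqP/eqP => [/rnorm0_eq0//|->]; rewrite rnorm0. Qed.

Lemma rnorm_gt0 u : (0 < rnorm u) = (u != 0).
Proof. by rewrite lt_neqAle rnorm_ge0 andbT eq_sym rnorm_eq0. Qed.
End rnorm_extra.

Section scalars.
Context (R : realType).
Implicit Types (a b c e : R) (x y z : R[i]).

Lemma rnorm1 : rnorm (1 : R[i]) = 1.
Proof. by rewrite -[1]/(1%:C) rnorm_realC. Qed.

Lemma rnormV x : rnorm x^-1 = (rnorm x)^-1.
Proof.
have [->|x0] := eqVneq x 0; first by rewrite invr0 rnorm0 invr0.
apply: (mulfI (x := rnorm x)); first by rewrite rnorm_eq0.
by rewrite -rnormM !mulfV ?rnorm1 ?rnorm_eq0.
Qed.

Lemma rnorm_conj x : rnorm x^* = rnorm x.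
Proof.
by case: x => a b; rewrite /rnorm !normc_def/= sqrrN.
Qed.

Lemma rnorm_le_ReIm x : rnorm x <= `|complex.Re x| + `|complex.Im x|.
Proof.
case: x => a b /=; rewrite /rnorm normc_def/=.
rewrite -(ger0_norm (addr_ge0 (normr_ge0 a) (normr_ge0 b))) -sqrtr_sqr.
rewrite ler_wsqrtr// -(real_normK (num_real a)) -(real_normK (num_real b)).
have := normr_ge0 a; have := normr_ge0 b; nra.
Qed.

Lemma Re_le_rnorm x : `|complex.Re x| <= rnorm x.
Proof.
case: x => a b /=; rewrite /rnorm normc_def/= -sqrtr_sqr ler_wsqrtr//.
by rewrite lerDl sqr_ge0.
Qed.

Lemma Im_le_rnorm x : `|complex.Im x| <= rnorm x.
Proof.
case: x => a b /=; rewrite /rnorm normc_def/= -(sqrtr_sqr b) ler_wsqrtr//.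
by rewrite lerDr sqr_ge0.
Qed.

Lemma natSinv_small e : 0 < e -> exists N, forall k, (N <= k)%N ->
  k.+1%:R^-1 < e.
Proof.
move=> e0; have [N _ h] := near_infty_natSinv_lt (PosNum e0).
by exists N => k Nk; apply: h.
Qed.

(** Sequential limits are taken through this criterion: a norm bounded by a fixed multiple of
    [k.+1%:R^-1] for every [k] vanishes. *)
Lemma le0_natSinv a c : (forall k, a <= c * k.+1%:R^-1) -> a <= 0.
Proof.
move=> h; rewrite leNgt; apply/negP => a0.
have d0 : 0 < a / (`|c| + 1) by rewrite divr_gt0// ltr_wpDl.
have [N /(_ N (leqnn N))] := natSinv_small d0.
rewrite ltr_pdivlMr ?ltr_wpDl//.
have := h N; have := ler_norm c; set t : R := N.+1%:R^-1.
have : 0 < t by rewrite invr_gt0.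
nra.
Qed.
End scalars.

Lemma compact_recurrent (K : numFieldType) (T : pseudoMetricType K) (S : set T)
    (v : nat -> T) : compact S -> (forall k, S (v k)) ->
  exists y, forall e N, 0 < e -> exists2 k, (N <= k)%N & ball y e (v k).
Proof.
move=> cS Sv; have FF : ProperFilter (v @ \oo) by exact: fmap_proper_filter.
have [|y [_ cy]] := cS (v @ \oo) FF; first by exists 0%N => // k _; exact: Sv.
exists y => e N e0.
have A : (v @ \oo) [set v k | k in [set k | (N <= k)%N]].
  by exists N => // k Nk; exists k.
have [_ [[k Nk <-] yk]] := cy _ _ A (nbhsx_ballx y e e0).
by exists k.
Qed.

Section subsequences.
Context (R : realType) (V : normedZmodType R[i]).

(* [phi] need not be increasing: [k <= phi k] is enough to leave every initial
   segment. *)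
Definition subseq_cvg (v : nat -> V) (phi : nat -> nat) (y : V) : Prop :=
  (forall k, (k <= phi k)%N) /\
  forall k, rnorm (v (phi k) - y) <= k.+1%:R^-1.

Lemma subseq_cvg_ex (v : nat -> V) (y : V) :
  (forall e N, 0 < e -> exists2 k, (N <= k)%N & rnorm (v k - y) <= e) ->
  exists phi, subseq_cvg v phi y.
Proof.
move=> h; have h' k : {j | (k <= j)%N /\ rnorm (v j - y) <= k.+1%:R^-1}.
  apply: cid; have [|j kj jy] := h (k.+1%:R^-1) k; first by rewrite invr_gt0.
  by exists j.
by exists (fun k => sval (h' k)); split=> k; case: (h' k) => j [].
Qed.

Lemma subseq_cvg_comp (v : nat -> V) phi psi y : subseq_cvg v phi y ->
  (forall k, (k <= psi k)%N) -> subseq_cvg v (phi \o psi) y.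
Proof.
move=> [h1 h2] hpsi; split=> k /=; first exact: leq_trans (h1 _).
apply: le_trans (h2 _) _.
by rewrite lef_pV2 ?posrE// ler_nat ltnS.
Qed.

Lemma subseq_cvg_close (v : nat -> V) phi y e : subseq_cvg v phi y -> 0 < e ->
  exists p q, (p < q)%N /\ rnorm (v q - v p) < e.
Proof.
move=> [h1 h2] e0; have e2 : 0 < e / 2 by rewrite divr_gt0.
have [N hN] := natSinv_small e2.
(* [phi] need not be increasing: an argument beyond [phi N] forces the second index past the
   first. *)
exists (phi N), (phi (maxn N (phi N).+1)); split.
  by apply: leq_trans (h1 _); rewrite leq_max leqnn orbT.
apply: le_lt_trans (rnorm_dist3 _ y _) _; rewrite (rnormBC y).
rewrite (splitr e); apply: ltrD; apply: le_lt_trans (h2 _) (hN _ _) => //.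
by rewrite leq_maxl.
Qed.
End subsequences.

(** Only real segments serve as compact sets: the imaginary parts recur along a subsequence on which
    the real parts already converge. *)
Lemma bolzano (R : realType) (z : nat -> R[i]) (M : R) :
  (forall k, rnorm (z k) <= M) -> exists y phi, subseq_cvg z phi y.
Proof.
move=> zM.
have itvM (x : R) : `|x| <= M -> `[- M, M]%classic x.
  by rewrite ler_norml /= in_itv.
have [a ha] := compact_recurrent (@segment_compact _ (- M) M)
  (fun k => itvM _ (le_trans (Re_le_rnorm (z k)) (zM k))).
have [phi [phi1 phi2]] : exists phi : nat -> nat, (forall k, (k <= phi k)%N) /\
    forall k, `|a - complex.Re (z (phi k))| <= k.+1%:R^-1.
  have h k : {j | (k <= j)%N /\ `|a - complex.Re (z j)| <= k.+1%:R^-1}.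
    apply: cid; have [|j kj jy] := ha (k.+1%:R^-1) k; first by rewrite invr_gt0.
    by exists j; split=> //; rewrite -ball_normE/= in jy; exact: ltW.
  by exists (fun k => sval (h k)); split=> k; case: (h k) => j [].
have [b hb] := compact_recurrent (@segment_compact _ (- M) M)
  (fun k => itvM _ (le_trans (Im_le_rnorm (z (phi k))) (zM _))).
exists (a +i* b); apply: subseq_cvg_ex => e N e0.
have e2 : 0 < e / 2 by rewrite divr_gt0.
have [N1 hN1] := natSinv_small e2.
have [k Nk] := hb (e / 2) (maxn N N1) e2; rewrite -ball_normE/= => bk.
exists (phi k).
  by apply: leq_trans (phi1 k); apply: leq_trans Nk; rewrite leq_maxl.
apply: le_trans (rnorm_le_ReIm _) _.
have -> : complex.Re (z (phi k) - a +i* b) = complex.Re (z (phi k)) - a by case: (z _).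
have -> : complex.Im (z (phi k) - a +i* b) = complex.Im (z (phi k)) - b by case: (z _).
rewrite (splitr e) lerD//; last by rewrite distrC ltW.
rewrite distrC; apply: le_trans (phi2 k) (ltW (hN1 k _)).
exact: leq_trans (leq_maxr _ _) Nk.
Qed.

(** * Compact operators *)

Section operators.
Context (R : realType) (X : normedModType R[i]).
Implicit Types (A B Q : bop X) (l : R[i]).

Definition bounded_functional (psi : X -> R[i]) : Prop :=
  (forall (a : R[i]) u v, psi (a *: u + v) = a * psi u + psi v) /\
  exists M : R, forall u, rnorm (psi u) <= M * rnorm u.

Lemma bop_ex (F : X -> X) :
  (forall (a : R[i]) u v, F (a *: u + v) = a *: F u + F v) ->
  (exists M : R, forall u, rnorm (F u) <= M * rnorm u) ->
  exists A : bop X, forall u, A u = F u.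
Proof.
move=> lF bF; have h : F \in @blin _ X by rewrite inE; split.
by exists (BOp h).
Qed.

Fact bop_id_subproof : (@id X) \in @blin _ X.
Proof. by rewrite inE; split=> //; exists 1 => u; rewrite mul1r. Qed.
Definition bop_id : bop X := BOp bop_id_subproof.

Fact bop_comp_subproof A B : (fun u => A (B u)) \in @blin _ X.
Proof.
rewrite inE; split; first by move=> a u v; rewrite !linearP.
exists (opnorm A * opnorm B) => u; apply: le_trans (opnormP _ _) _.
by rewrite -mulrA ler_wpM2l ?opnorm_ge0 ?opnormP.
Qed.
Definition bop_comp A B : bop X := BOp (bop_comp_subproof A B).

Fact rank1_subproof (psi : X -> R[i]) (hpsi : bounded_functional psi) (e : X) :
  (fun u => psi u *: e) \in @blin _ X.
Proof.
case: hpsi => lp [M bp]; rewrite inE; split.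
  by move=> a u v; rewrite lp scalerDl scalerA.
exists (M * rnorm e) => u; rewrite rnormZ mulrAC.
by rewrite ler_wpM2r ?rnorm_ge0.
Qed.
Definition rank1 psi (hpsi : bounded_functional psi) e : bop X :=
  BOp (rank1_subproof hpsi e).

Lemma bopD A B u : (A + B) u = A u + B u. Proof. by []. Qed.
Lemma bopB A B u : (A - B) u = A u - B u. Proof. by []. Qed.
Lemma bopZ l A u : (l *: A) u = l *: A u. Proof. by []. Qed.
Lemma bop_sum (I : Type) (r : seq I) (P : pred I) (F : I -> bop X) u :
  (\sum_(i <- r | P i) F i) u = \sum_(i <- r | P i) F i u.
Proof. exact: (big_morph (fun A : bop X => A u)). Qed.

Lemma bop_eq A B : (forall u, A u = B u) -> A = B.
Proof. by move=> h; apply: val_inj; apply/funext => u; exact: h. Qed.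

Lemma rnorm_opnorm A : rnorm A = opnorm A.
Proof. by []. Qed.

Lemma opnorm_bound A c : 0 <= c -> (forall u, rnorm (A u) <= c * rnorm u) ->
  opnorm A <= c.
Proof.
move=> c0 h; apply: opnorm_le => u u1; apply: le_trans (h u) _.
by rewrite ler_piMr.
Qed.

Lemma opnorm_comp A B : opnorm (bop_comp A B) <= opnorm A * opnorm B.
Proof.
apply: opnorm_bound => [|u]; first by rewrite mulr_ge0// opnorm_ge0.
apply: le_trans (opnormP A (B u)) _.
by rewrite -mulrA ler_wpM2l ?opnorm_ge0 ?opnormP.
Qed.

Lemma bop_lD A u v : A (u + v) = A u + A v. Proof. exact: linearD. Qed.
Lemma bop_lB A u v : A (u - v) = A u - A v. Proof. exact: linearB. Qed.
Lemma bop_lZ A l u : A (l *: u) = l *: A u. Proof. exact: linearZ. Qed.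

(** Compactness in the form in which it is consumed; it passes to sums by extracting twice. *)
Definition seq_compact A : Prop := forall (u : nat -> X) (M : R),
  (forall k, rnorm (u k) <= M) -> exists y phi, subseq_cvg (A \o u) phi y.

Lemma compact_operator_seq A : compact_operator A -> seq_compact A.
Proof.
move=> cA u M uM; have M0 : 0 < `|M| + 1 by rewrite ltr_wpDl.
(* Division by [t] brings the sequence into the unit ball; the summand 1 keeps [t] invertible. *)
pose t : R[i] := (`|M| + 1)%:C.
have t0 : t != 0 by apply/eqP => /complexI /eqP; rewrite gt_eqF.
have rt : rnorm t = `|M| + 1 by rewrite rnorm_realC// ltW.
have ut k : closure (A @` [set u | rnorm u <= 1]) (A (t^-1 *: u k)).
  apply: subset_closure; exists (t^-1 *: u k) => //=.
  rewrite rnormZ rnormV rt ler_pdivrMl// mulr1.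
  have := uM k; have := ler_norm M; lra.
have [y hy] := compact_recurrent cA ut.
exists (t *: y); apply: subseq_cvg_ex => e N e0.
have e1 : 0 < (e / (`|M| + 1))%:C :> R[i] by rewrite ltcR divr_gt0.
have [k Nk] := hy _ N e1; rewrite -ball_normE/= => hk; exists k => //=.
rewrite bop_lZ -rnormE ltcR in hk.
rewrite -[A (u k)](scalerKV t0) -scalerBr rnormZ rt rnormBC.
by rewrite mulrC -ler_pdivlMr// ltW.
Qed.

Lemma seq_compact0 : seq_compact 0.
Proof.
move=> u M uM; exists 0, id; split=> // k /=.
by change (rnorm (0 - 0 : X) <= k.+1%:R^-1); rewrite subr0 rnorm0 invr_ge0.
Qed.

Lemma seq_compactD A B : seq_compact A -> seq_compact B -> seq_compact (A + B).
Proof.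
move=> cA cB u M uM; have [y [phi hphi]] := cA u M uM.
have [z [psi hpsi]] := cB (u \o phi) M (fun k => uM _).
exists (y + z); apply: subseq_cvg_ex => e N e0.
have e2 : 0 < e / 2 by rewrite divr_gt0.
have [N1 hN1] := natSinv_small e2.
pose k := maxn N N1; have hk := hN1 k (leq_maxr _ _).
exists (phi (psi k)).
  apply: leq_trans (hphi.1 _); apply: leq_trans (hpsi.1 _).
  exact: leq_maxl.
set v := u (phi (psi k)); change (rnorm (A v + B v - (y + z)) <= e).
rewrite opprD addrACA; apply: le_trans (rnormD _ _) _.
rewrite (splitr e) lerD//; last exact: le_trans (hpsi.2 k) (ltW hk).
exact: le_trans ((subseq_cvg_comp hphi hpsi.1).2 k) (ltW hk).
Qed.

Lemma seq_compact_sum n (F : 'I_n -> bop X) :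
  (forall i, seq_compact (F i)) -> seq_compact (\sum_i F i).
Proof.
by move=> h; elim/big_ind: _ => //; [exact: seq_compact0|exact: seq_compactD].
Qed.

Lemma seq_compact_rank1 psi (hpsi : bounded_functional psi) e :
  seq_compact (rank1 hpsi e).
Proof.
move=> u M uM; have [_ [K bK]] := hpsi.
have [|z [phi hphi]] := @bolzano _ (psi \o u) (`|K| * M).
  move=> k /=; apply: le_trans (bK _) _.
  apply: (@le_trans _ _ (`|K| * rnorm (u k))).
    by rewrite ler_wpM2r ?rnorm_ge0// ler_norm.
  by rewrite ler_wpM2l.
exists (z *: e); apply: subseq_cvg_ex => c N c0.
have c2 : 0 < c / (rnorm e + 1) by rewrite divr_gt0// ltr_wpDl// rnorm_ge0.
have [N1 hN1] := natSinv_small c2.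
pose k := maxn N N1; have hk := hN1 k (leq_maxr _ _).
exists (phi k); first by apply: leq_trans (hphi.1 _); exact: leq_maxl.
rewrite /= -scalerBl rnormZ; apply: (@le_trans _ _ (c / (rnorm e + 1) * rnorm e)).
  by rewrite ler_wpM2r ?rnorm_ge0//; exact: le_trans (hphi.2 k) (ltW hk).
have e0 := rnorm_ge0 e.
by rewrite mulrAC ler_pdivrMr ?ltr_wpDl// ler_wpM2l ?lerDl// ltW.
Qed.

(** By compactness: a failing bound gives unit vectors [u k] and scalars [l k] in [P], bounded by
    [opnorm Q + 1], with [l k *: u k - Q (u k)] tending to 0. Along a subsequence [l k] tends to
    some [z] in [P] and [Q (u k)] to some [y], so that [Q y = z *: y]. [P] may be unbounded, which
    covers the exterior of a disk. *)
Lemma eigen_lower_bound Q (P : set R[i]) : seq_compact Q -> ~ P 0 ->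
  (forall l, (forall e : R, 0 < e -> exists2 l', P l' & rnorm (l' - l) <= e) ->
     P l) ->
  (forall l u, P l -> Q u = l *: u -> u = 0) ->
  exists2 c : R, 0 < c & forall l u, P l -> c * rnorm u <= rnorm (l *: u - Q u).
Proof.
move=> cQ P0 clP nP; apply: contrapT => hc.
have step k : {p : R[i] * X | [/\ P p.1, rnorm p.2 = 1 &
    rnorm (p.1 *: p.2 - Q p.2) <= k.+1%:R^-1]}.
  apply: cid; apply: contrapT => hk; apply: hc.
  exists (k.+1%:R^-1); first by rewrite invr_gt0.
  move=> l u Pl; have [->|u0] := eqVneq u 0.
    by rewrite scaler0 linear0 subr0 rnorm0 mulr0.
  have ru : 0 < rnorm u by rewrite rnorm_gt0.
  rewrite leNgt; apply/negP => hlt; apply: hk.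
  exists (l, ((rnorm u)^-1)%:C *: u); split=> //=.
    by rewrite rnormZ rnorm_realC ?invr_ge0 ?rnorm_ge0// mulVf ?gt_eqF.
  rewrite bop_lZ scalerA mulrC -scalerA -scalerBr rnormZ rnorm_realC ?invr_ge0 ?rnorm_ge0//.
  by rewrite ler_pdivrMl// mulrC ltW.
pose l k := (sval (step k)).1; pose u k := (sval (step k)).2.
have Pl k : P (l k) by rewrite /l; case: (step k) => p [].
have u1 k : rnorm (u k) = 1 by rewrite /u; case: (step k) => p [].
have lu k : rnorm (l k *: u k - Q (u k)) <= k.+1%:R^-1.
  by rewrite /l /u; case: (step k) => p [].
have inv1 k : k.+1%:R^-1 <= 1 :> R by rewrite invf_le1// ler1n.
pose C := opnorm Q + 1.
have lC k : rnorm (l k) <= C.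
  have : rnorm (l k *: u k) = rnorm (l k) by rewrite rnormZ u1 mulr1.
  have := rnorm_dist (l k *: u k) (Q (u k)).
  have := opnormP Q (u k); rewrite u1 /C; have := lu k; have := inv1 k; set t := k.+1%:R^-1; lra.
have u1' k : rnorm (u k) <= 1 by rewrite u1.
have [y [phi hphi]] := cQ u 1 u1'.
have [z [psi hpsi]] := @bolzano _ (l \o phi) C (fun k => lC _).
have hQ := subseq_cvg_comp hphi hpsi.1.
pose p := phi \o psi; have pk k : (p k).+1%:R^-1 <= k.+1%:R^-1 :> R.
  by rewrite lef_pV2 ?posrE// ler_nat ltnS; exact: hQ.1.
have Qp k : rnorm (Q (u (p k)) - y) <= k.+1%:R^-1 := hQ.2 k.
have lp k : rnorm (l (p k) - z) <= k.+1%:R^-1 := hpsi.2 k.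
have lup k := le_trans (lu (p k)) (pk k).
have Pz : P z.
  apply: clP => e e0; have [N /(_ N (leqnn _)) hN] := natSinv_small e0.
  by exists (l (p N)) => //; exact: le_trans (lp N) (ltW hN).
have Qy : Q y = z *: y.
  apply/eqP; rewrite -subr_eq0 -rnorm_eq0 eq_le rnorm_ge0 andbT.
  apply: (@le0_natSinv _ _ (2 * opnorm Q + C + rnorm y)) => k.
  set t := k.+1%:R^-1; have t0 : 0 <= t by rewrite invr_ge0.
  apply: le_trans (rnorm_dist3 _ (l (p k) *: Q (u (p k))) _) _.
  have h1 : rnorm (Q y - l (p k) *: Q (u (p k))) <= opnorm Q * (2 * t).
    rewrite -bop_lZ -bop_lB; apply: le_trans (opnormP _ _) _.
    rewrite ler_wpM2l ?opnorm_ge0//.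
    apply: le_trans (rnorm_dist3 _ (Q (u (p k))) _) _.
    rewrite (rnormBC y) (rnormBC (Q _) (l _ *: _)); have := Qp k; have := lup k; rewrite -/t; lra.
  apply: le_trans (lerD h1 (rnorm_dist3 _ (l (p k) *: y) _)) _.
  rewrite -scalerBr -scalerBl !rnormZ.
  have h2 := ler_pM (rnorm_ge0 _) (rnorm_ge0 _) (lC (p k)) (Qp k).
  have h3 := ler_wpM2r (rnorm_ge0 y) (lp k).
  rewrite -/t in h2 h3; lra.
(* Here [y] is the limit of [Q (u k)], not of [u k], so its vanishing does not contradict the unit
   norms at once. It makes [rnorm (l k *: u k) = rnorm (l k)] tend to 0, so [z = 0], which [P]
   excludes. *)
have y0 := nP _ _ Pz Qy.
have : rnorm z <= 0.
  apply: (@le0_natSinv _ _ 3) => k.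
  have : rnorm (l (p k) *: u (p k)) = rnorm (l (p k)) by rewrite rnormZ u1 mulr1.
  have := Qp k; rewrite y0 subr0.
  have := rnorm_dist (l (p k) *: u (p k)) (Q (u (p k))).
  have := rnorm_dist z (l (p k)); rewrite (rnormBC z).
  have := lp k; have := lup k; set t := k.+1%:R^-1; lra.
move=> rz; apply: P0.
suff -> : 0 = z by [].
by apply/esym/rnorm0_eq0/eqP; rewrite eq_le rz rnorm_ge0.
Qed.

(** * Riesz lemma and Fredholm alternative for compact operators *)

Definition norm_closed (M : set X) : Prop := forall y,
  (forall e : R, 0 < e -> exists2 u, M u & rnorm (u - y) <= e) -> M y.

Definition linear_subspace (M : set X) : Prop :=
  M 0 /\ forall (a : R[i]) u v, M u -> M v -> M (a *: u + v).

(** Closedness makes the distance from [w] to [M] positive. It need not be attained, but taking the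
    distance itself as the margin for an almost minimizer gives the factor 2. *)
Lemma riesz_almost_closest (M : set X) w : norm_closed M -> M 0 -> ~ M w ->
  exists v0, [/\ M v0, 0 < rnorm (w - v0) &
    forall v, M v -> rnorm (w - v0) <= 2 * rnorm (w - v)].
Proof.
move=> clM M0 Mw; pose D := [set rnorm (w - v) | v in M].
have D0 : D !=set0 by exists (rnorm (w - 0)), 0.
have lbD : has_lbound D by exists 0 => _ [v _ <-]; exact: rnorm_ge0.
have [e e0 he] : exists2 e : R, 0 < e & forall v, M v -> e <= rnorm (w - v).
  apply: contrapT => h; apply/Mw/clM => e e0; apply: contrapT => h'; apply: h.
  exists e => // v Mv; rewrite leNgt; apply/negP => lt; apply: h'.
  by exists v => //; rewrite rnormBC ltW.
have d0 : 0 < inf D.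
  by apply: lt_le_trans e0 _; apply: lb_le_inf => // _ [v Mv <-]; exact: he.
have [_ [v0 Mv0 <-] lt0] := inf_adherent d0 (conj D0 lbD).
exists v0; split=> //; first exact: lt_le_trans e0 (he _ Mv0).
move=> v Mv; have : inf D <= rnorm (w - v) by apply: ge_inf => //; exists v.
by move: lt0; lra.
Qed.

Section riesz_chain.
Variables (A : bop X) (l : R[i]) (c : R).
Hypotheses (cA : seq_compact A) (l0 : l != 0) (c0 : 0 < c).
Hypothesis lbS : forall u, c * rnorm u <= rnorm (l *: u - A u).

Let S : bop X := l *: bop_id - A.

Let SE u : S u = l *: u - A u. Proof. by []. Qed.

Let S_inj u v : S u = S v -> u = v.
Proof.
move=> /eqP; rewrite -subr_eq0 -bop_lB => /eqP h.
apply/eqP; rewrite -subr_eq0 -rnorm_eq0 eq_le rnorm_ge0 andbT.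
by have := lbS (u - v); rewrite -SE h rnorm0 pmulr_rle0.
Qed.

(** If [S (u k)] tends to [y], the lower bound keeps [u k] bounded, so [A (u k)] tends to some [z]
    along a subsequence, and there [u k = l^-1 *: (S (u k) + A (u k))] converges to
    [l^-1 *: (y + z)]. *)
Let S_closed (M : set X) : norm_closed M -> norm_closed (S @` M).
Proof.
move=> clM y hy.
have step k : {u | M u /\ rnorm (S u - y) <= k.+1%:R^-1}.
  apply: cid; have [|_ [u Mu <-] h] := hy (k.+1%:R^-1); first by rewrite invr_gt0.
  by exists u.
pose u k := sval (step k).
have Mu k : M (u k) by rewrite /u; case: (step k) => ? [].
have Su k : rnorm (S (u k) - y) <= k.+1%:R^-1 by rewrite /u; case: (step k) => ? [].
have ub k : rnorm (u k) <= (1 + rnorm y) / c.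
  rewrite ler_pdivlMr// mulrC; apply: le_trans (lbS _) _; rewrite -SE.
  apply: le_trans (rnorm_dist _ y) _; rewrite lerD2r; apply: le_trans (Su k) _.
  by rewrite invf_le1// ler1n.
have [z [phi hphi]] := cA ub.
have Su' k : rnorm (S (u (phi k)) - y) <= k.+1%:R^-1.
  by apply: le_trans (Su _) _; rewrite lef_pV2 ?posrE// ler_nat ltnS; exact: hphi.1.
pose v := l^-1 *: (y + z); pose K := rnorm l^-1 * 2.
have uv k : rnorm (u (phi k) - v) <= K * k.+1%:R^-1.
  have -> : u (phi k) - v = l^-1 *: ((S (u (phi k)) - y) + (A (u (phi k)) - z)).
    by rewrite SE addrACA subrK -opprD scalerBr scalerK.
  rewrite rnormZ -mulrA ler_wpM2l ?rnorm_ge0//.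
  have := hphi.2 k; have := Su' k; rewrite /=.
  have := rnormD (S (u (phi k)) - y) (A (u (phi k)) - z).
  by set t := k.+1%:R^-1; lra.
have K0 : 0 <= K by rewrite mulr_ge0// rnorm_ge0.
exists v.
  apply: clM => e e0; have [|N /(_ N (leqnn _)) hN] := @natSinv_small _ (e / (K + 1)).
    by rewrite divr_gt0// ltr_wpDl.
  exists (u (phi N)) => //; apply: le_trans (uv N) _.
  move: hN; rewrite ltr_pdivlMr ?ltr_wpDl//; set t := N.+1%:R^-1.
  have : 0 <= t by rewrite invr_ge0.
  nra.
apply/eqP; rewrite -subr_eq0 -rnorm_eq0 eq_le rnorm_ge0 andbT.
apply: (@le0_natSinv _ _ (opnorm S * K + 1)) => k.
apply: le_trans (rnorm_dist3 _ (S (u (phi k))) _) _.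
rewrite mulrDl mul1r; apply: lerD; last exact: (Su' k).
rewrite rnormBC -bop_lB; apply: le_trans (opnormP _ _) _.
by rewrite -mulrA ler_wpM2l ?opnorm_ge0//; exact: (uv k).
Qed.

Let Ran k : set X := range (iter k S).

Let Ran_closed k : norm_closed (Ran k).
Proof.
elim: k => [|k IH]; first by move=> y _; exists y.
have -> : Ran k.+1 = S @` Ran k.
  apply/seteqP; split=> [_ [u _ <-]|_ [_ [u _ <-] <-]]; last by exists u.
  by exists (iter k S u) => //; exists u.
exact: S_closed.
Qed.

Let iterS_linear k (a : R[i]) u v : iter k S (a *: u + v) = a *: iter k S u + iter k S v.
Proof. by elim: k => // k IH; rewrite !iterS IH bop_lD bop_lZ. Qed.

Let Ran_subspace k : linear_subspace (Ran k).
Proof.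
split; first by exists 0 => //; elim: k => // k IH; rewrite iterS IH linear0.
by move=> a _ _ [u _ <-] [v _ <-]; exists (a *: u + v) => //; rewrite iterS_linear.
Qed.

Let RanS k u : Ran k u -> Ran k.+1 (S u).
Proof. by move=> [v _ <-]; exists v. Qed.

Let Ran_le p q u : (p <= q)%N -> Ran q u -> Ran p u.
Proof.
move=> /subnKC <- [v _ <-]; exists (iter (q - p) S v) => //.
by rewrite iterD.
Qed.

Let iterS_inj k u v : iter k S u = iter k S v -> u = v.
Proof. by elim: k => // k IH; rewrite !iterS => /S_inj. Qed.

(* If [S] is not onto, its iterated ranges strictly decrease; vectors of the
   [k]-th range almost orthogonal to the next one have [A]-images that stay
   apart, against compactness. *)
Let S_surj w : exists u, S u = w.
Proof.
apply: contrapT => Sw.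
have step k : {u | [/\ Ran k u, rnorm u = 1 &
    forall v, Ran k.+1 v -> 1 / 2 <= rnorm (u - v)]}.
  apply: cid.
  have nR : ~ Ran k.+1 (iter k S w).
    by move=> [u _]; rewrite iterSr => /iterS_inj h; apply: Sw; exists u.
  have [R0 Rl] := Ran_subspace k.+1.
  have [v0 [Rv0 d0 hv]] := riesz_almost_closest (@Ran_closed _) R0 nR.
  set d := rnorm _ in d0 hv; pose t : R[i] := (d^-1)%:C.
  have rt : rnorm t = d^-1 by rewrite rnorm_realC// invr_ge0 ltW.
  exists (t *: (iter k S w - v0)); split.
  - have [Rk0 Rkl] := Ran_subspace k.
    rewrite -[X in Ran _ X]addr0; apply: (Rkl) => //.
    rewrite addrC -scaleN1r; apply: (Rkl); last by exists w.
    exact: Ran_le (leqnSn k) Rv0.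
  - by rewrite rnormZ rt mulVf// gt_eqF.
  - move=> v Rv; have t0 : t != 0 by rewrite -rnorm_gt0 rt invr_gt0.
    rewrite -[v](scalerKV t0) -scalerBr rnormZ rt -addrA -opprD.
    have /hv : Ran k.+1 (v0 + t^-1 *: v) by rewrite addrC; exact: Rl.
    by rewrite ler_pdivlMl//; lra.
pose u k := sval (step k).
have Ru k : Ran k (u k) by rewrite /u; case: (step k) => ? [].
have u1 k : rnorm (u k) <= 1 by rewrite /u; case: (step k) => ? [? ->].
have du k v : Ran k.+1 v -> 1 / 2 <= rnorm (u k - v).
  by rewrite /u; case: (step k) => u0 [? ? h] /=; exact: h.
have [y [phi hphi]] := cA u1.
have ll : 0 < rnorm l / 2 by rewrite divr_gt0 ?rnorm_gt0.
have [p [q [pq]]] := subseq_cvg_close hphi ll.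
apply/negP; rewrite -leNgt /= rnormBC.
(* As [A = l - S], the difference is [l] times [u p] minus a vector of the next range, which
   contains [S (u p)], [S (u q)] and, since [p < q], also [u q]. *)
have -> : A (u p) - A (u q) = l *: (u p - l^-1 *: (S (u p) - S (u q) + l *: u q)).
  rewrite scalerBr scalerKV// !SE opprB addrA subrK opprD opprB addrA.
  by rewrite [l *: u p + _]addrC subrK.
rewrite rnormZ -(mul1r 2^-1) ler_wpM2l ?rnorm_ge0//; apply: du.
have [R0 Rl] := Ran_subspace p.+1.
rewrite -[X in Ran _ X]addr0; apply: (Rl) => //.
have Rq : Ran p.+1 (u q) by exact: Ran_le pq (Ru q).
rewrite addrC; apply: (Rl) => //; rewrite addrC -scaleN1r; apply: (Rl).
  exact: Ran_le (leqnSn _) (RanS Rq).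
exact: RanS.
Qed.

(** The Fredholm alternative in quantitative form: the constant of the lower bound also bounds the
    inverse, uniformly over all pairs [A], [l] that share it. *)
Lemma compact_resolvent : exists B : bop X,
  [/\ forall u, B (l *: u - A u) = u, forall u, l *: B u - A (B u) = u &
      opnorm B <= c^-1].
Proof.
have [F hF] := choice S_surj.
have [||B hB] := @bop_ex F.
- move=> a u v; apply: S_inj.
  by rewrite hF bop_lD bop_lZ !hF.
- exists c^-1 => u; have := lbS (F u); rewrite -SE hF.
  by rewrite ler_pdivlMl.
exists B; split.
- by move=> u; apply: S_inj; rewrite hB hF.
- by move=> u; rewrite hB -SE hF.
apply: opnorm_bound => [|u]; first by rewrite invr_ge0 ltW.
by rewrite hB; have := lbS (F u); rewrite -SE hF ler_pdivlMl.
Qed.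
End riesz_chain.
End operators.

(** * One-sided differential calculus *)

Section norm_limits.
Context (R : realType).

(* Convergence in norm, with real radii instead of the complex radii of the
   topology of a normed space over [R[i]]. *)
Definition rcvg (V : normedZmodType R[i]) (T : Type) (F : set_system T)
    (f : T -> V) (a : V) : Prop :=
  forall e : R, 0 < e -> \forall x \near F, rnorm (f x - a) < e.

Lemma rcvgP (V : normedModType R[i]) (T : Type) (F : set_system T)
    {FF : Filter F} (f : T -> V) (a : V) : f @ F --> a <-> rcvg F f a.
Proof.
split=> [/cvgrPdist_lt h e e0|h].
  have ec : 0 < e%:C :> R[i] by rewrite ltcR.
  apply: filterS (h _ ec) => x /=.
  by rewrite -rnormE ltcR rnormBC.
apply/cvgrPdist_lt => e e0.
have eE : e = (complex.Re e)%:C by rewrite RRe_real// gtr0_real.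
have re0 : 0 < complex.Re e by rewrite -ltcR -eE.
apply: filterS (h _ re0) => x /=.
by rewrite eE -rnormE ltcR rnormBC.
Qed.

Section filters.
Context (T : Type) (F : set_system T) {FF : Filter F}.

Lemma rcvg_cst (V : normedZmodType R[i]) (a : V) : rcvg F (fun=> a) a.
Proof. by move=> e e0; apply: nearW => x; rewrite subrr rnorm0. Qed.

Lemma rcvg_ext (V : normedZmodType R[i]) (f g : T -> V) a :
  rcvg F f a -> (\forall x \near F, f x = g x) -> rcvg F g a.
Proof.
by move=> h fg e e0; apply: filterS2 fg (h e e0) => x ->.
Qed.

Lemma rcvgD (V : normedZmodType R[i]) (f g : T -> V) a b :
  rcvg F f a -> rcvg F g b -> rcvg F (fun x => f x + g x) (a + b).
Proof.
move=> hf hg e e0; have e2 : 0 < e / 2 by rewrite divr_gt0.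
apply: filterS2 (hf _ e2) (hg _ e2) => x /= h1 h2.
rewrite opprD addrACA; apply: le_lt_trans (rnormD _ _) _.
by rewrite (splitr e) ltrD.
Qed.

Lemma rcvgN (V : normedZmodType R[i]) (f : T -> V) a :
  rcvg F f a -> rcvg F (fun x => - f x) (- a).
Proof.
move=> hf e e0; apply: filterS (hf _ e0) => x /=.
by rewrite -opprD rnormN.
Qed.

Lemma rcvg_bounded (V : normedZmodType R[i]) (f : T -> V) a :
  rcvg F f a -> \forall x \near F, rnorm (f x) < rnorm a + 1.
Proof.
move=> hf; apply: filterS (hf 1 ltr01) => x /= h.
by apply: le_lt_trans (rnorm_dist _ a) _; rewrite addrC ltrD2l.
Qed.

Lemma rcvg_bound (V W : normedZmodType R[i]) (f : T -> V) (g : T -> W) a b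
    (M : R) : rcvg F f a ->
  (\forall x \near F, rnorm (g x - b) <= M * rnorm (f x - a)) -> rcvg F g b.
Proof.
move=> hf hg e e0; have M0 : 0 < `|M| + 1 by rewrite ltr_wpDl.
have e1 : 0 < e / (`|M| + 1) by rewrite divr_gt0.
apply: filterS2 hg (hf _ e1) => x /= h1; rewrite ltr_pdivlMr// => h2.
apply: le_lt_trans h1 _; apply: le_lt_trans h2.
rewrite mulrC ler_wpM2l ?rnorm_ge0//.
by have := ler_norm M; lra.
Qed.

Lemma rcvg_unique (V : normedZmodType R[i]) (f : T -> V) a b :
  ProperFilter F -> rcvg F f a -> rcvg F f b -> a = b.
Proof.
move=> PF fa fb; apply/eqP; rewrite -subr_eq0 -rnorm_eq0 eq_le rnorm_ge0 andbT.
apply/ler_addgt0Pr => e e0; rewrite add0r; have e2 : 0 < e / 2 by rewrite divr_gt0.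
have [x [/= h1 h2]] := filter_ex (filterI (fa _ e2) (fb _ e2)).
apply: le_trans (rnorm_dist3 _ (f x) _) _; rewrite rnormBC.
lra.
Qed.

Lemma rcvgV (f : T -> R[i]) a : a != 0 -> rcvg F f a ->
  rcvg F (fun x => (f x)^-1) a^-1.
Proof.
move=> a0 hf; have ra : 0 < rnorm a by rewrite rnorm_gt0.
have ra2 : 0 < rnorm a / 2 by rewrite divr_gt0.
apply: (@rcvg_bound _ _ _ _ _ _ (2 / rnorm a ^+ 2) hf).
apply: filterS (hf _ ra2) => x /= h.
have fx : rnorm a / 2 <= rnorm (f x).
  by have := rnorm_dist a (f x); rewrite rnormBC; lra.
have rfx : 0 < rnorm (f x) by lra.
have fx0 : f x != 0 by rewrite -rnorm_gt0.
have -> : (f x)^-1 - a^-1 = (a - f x) * ((f x)^-1 * a^-1).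
  by rewrite mulrBl mulrCA mulfV// mulr1 mulrA mulfV// mul1r.
rewrite !rnormM rnormBC !rnormV mulrC ler_wpM2r ?rnorm_ge0//.
rewrite -invfM ler_pdivlMr ?exprn_gt0// mulrC ler_pdivrMr ?mulr_gt0//.
by rewrite expr2; nra.
Qed.
End filters.

(** Real scalars suffice for difference quotients along a real parameter, and let an inner product,
    conjugate-linear in its second argument, share one product rule with composition, evaluation and
    scaling. *)
Definition bounded_Rbilinear (U V W : normedModType R[i]) (be : U -> V -> W) :=
  [/\ forall u u' v, be (u - u') v = be u v - be u' v,
      forall u v v', be u (v - v') = be u v - be u v',
      forall (r : R) u v, be (r%:C *: u) v = r%:C *: be u v,
      forall (r : R) u v, be u (r%:C *: v) = r%:C *: be u v &
      exists M : R, forall u v, rnorm (be u v) <= M * (rnorm u * rnorm v)].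

Lemma rcvg_bilinear (U V W : normedModType R[i]) (be : U -> V -> W) T
    (F : set_system T) {FF : Filter F} (f : T -> U) (g : T -> V) a b :
  bounded_Rbilinear be -> rcvg F f a -> rcvg F g b ->
  rcvg F (fun x => be (f x) (g x)) (be a b).
Proof.
move=> [hl hr _ _ [M hM]] fa gb.
have [K K0 hK] : exists2 K : R, 0 <= K &
    forall u v, rnorm (be u v) <= K * (rnorm u * rnorm v).
  exists `|M| => // u v; apply: le_trans (hM u v) _.
  by rewrite ler_wpM2r ?ler_norm// mulr_ge0// rnorm_ge0.
have h0 : rcvg F (fun x => be (f x - a) (g x) + be a (g x - b)) (0 + 0).
  apply: rcvgD.
    apply: (@rcvg_bound _ _ _ _ _ _ _ _ _ (K * (rnorm b + 1)) fa).
    apply: filterS (rcvg_bounded gb) => x gx; rewrite subr0.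
    apply: le_trans (hK _ _) _; rewrite -mulrA ler_wpM2l// mulrC.
    by rewrite ler_wpM2r ?rnorm_ge0// ltW.
  apply: (@rcvg_bound _ _ _ _ _ _ _ _ _ (K * rnorm a) gb).
  by apply: nearW => x; rewrite subr0 -mulrA; exact: (hK a (g x - b)).
apply: (@rcvg_bound _ _ _ _ _ _ _ _ _ 1 h0).
apply: nearW => x; rewrite addr0 subr0 mul1r.
by rewrite hl hr addrA subrK.
Qed.

End norm_limits.

Section one_sided_C1.
Context (R : realType).
Implicit Types (b t s : R).

Definition dnbhs_in b t : set_system R := within [set` `[0, b[] t^'.
Definition nbhs_in b t : set_system R := within [set` `[0, b[] (nbhs t).

#[global] Instance dnbhs_in_filter b t : Filter (dnbhs_in b t).
Proof. exact: within_filter. Qed.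
#[global] Instance nbhs_in_filter b t : Filter (nbhs_in b t).
Proof. exact: within_filter. Qed.

Definition quotient (V : normedModType R[i]) (f : R -> V) t s : V :=
  ((s - t)^-1)%:C *: (f s - f t).

Definition has_deriv (V : normedModType R[i]) b (f f' : R -> V) : Prop :=
  (forall t, t \in `[0, b[ -> rcvg (dnbhs_in b t) (quotient f t) (f' t)) /\
  (forall t, t \in `[0, b[ -> rcvg (nbhs_in b t) f' (f' t)).

Lemma C1P (V : normedModType R[i]) b (f : R -> V) :
  C1_on b f <-> exists f', has_deriv b f f'.
Proof.
split=> -[f' [h1 h2]]; exists f'; split.
- by move=> t tb; apply/rcvgP; exact: h1.
- move=> t tb; apply/rcvgP; move/subspace_continuousP : h2; apply.
  exact: tb.
- by move=> t tb; apply/rcvgP; exact: h1.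
- by apply/subspace_continuousP => t tb; apply/rcvgP; exact: h2.
Qed.

Lemma near_dnbhs_in b t (P : R -> Prop) :
  (\forall s \near nbhs_in b t, P s) -> \forall s \near dnbhs_in b t, P s.
Proof.
rewrite /nbhs_in /dnbhs_in !near_withinE => h.
by apply: filterS h => s hs _; exact: hs.
Qed.

Lemma rcvg_dnbhs_in (V : normedZmodType R[i]) b t (f : R -> V) a :
  rcvg (nbhs_in b t) f a -> rcvg (dnbhs_in b t) f a.
Proof. by move=> h e e0; apply: near_dnbhs_in; exact: h. Qed.

Lemma near_nbhs_in b t (P : R -> Prop) : P t ->
  (\forall s \near dnbhs_in b t, P s) -> \forall s \near nbhs_in b t, P s.
Proof.
move=> Pt; rewrite /nbhs_in /dnbhs_in !near_withinE /= => h.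
apply: filterS h => s hs sb; have [->//|st] := eqVneq s t.
exact: hs.
Qed.

Lemma near_dist t (e : R) : 0 < e -> \forall s \near nbhs t, `|s - t| < e.
Proof.
move=> e0; have := nbhsx_ballx t e e0; rewrite -ball_normE.
by apply: filterS => s /=; rewrite distrC.
Qed.

Lemma near_dnbhs_in_neq b t : \forall s \near dnbhs_in b t, s != t.
Proof.
rewrite /dnbhs_in !near_withinE.
by apply: nearW => s st _.
Qed.

Lemma near_dnbhs_in_itv b t : \forall s \near dnbhs_in b t, s \in `[0, b[.
Proof. by rewrite /dnbhs_in !near_withinE; apply: nearW. Qed.

Lemma near_nbhs_in_itv b t : \forall s \near nbhs_in b t, s \in `[0, b[.
Proof. by rewrite /nbhs_in near_withinE; apply: nearW. Qed.

Lemma near_nbhs_in_ball b t (P : R -> Prop) : (\forall s \near nbhs_in b t, P s) ->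
  exists2 r : R, 0 < r & forall s, s \in `[0, b[ -> `|s - t| < r -> P s.
Proof.
rewrite /nbhs_in !near_withinE => /nbhs_ballP[r /= r0 h]; exists r => // s sb st.
by apply: h => //; rewrite -ball_normE/= distrC.
Qed.

Lemma deriv_continuous (V : normedModType R[i]) b t (f : R -> V) a :
  rcvg (dnbhs_in b t) (quotient f t) a -> rcvg (nbhs_in b t) f (f t).
Proof.
move=> h e e0; apply: near_nbhs_in; first by rewrite subrr rnorm0.
pose K := rnorm a + 1; have K0 : 0 < K by rewrite ltr_wpDl// rnorm_ge0.
have := near_dist t (divr_gt0 e0 K0) => hd.
have hd' : \forall s \near dnbhs_in b t, `|s - t| < e / K.
  apply: near_dnbhs_in; rewrite /nbhs_in near_withinE.
  by apply: filterS hd.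
apply: filterS3 hd' (near_dnbhs_in_neq b t) (rcvg_bounded h) => s.
rewrite ltr_pdivlMr// => h1 st h2.
have st0 : s - t != 0 by rewrite subr_eq0.
have -> : f s - f t = (s - t)%:C *: quotient f t s.
  by rewrite /quotient scalerA -rmorphM/= mulfV// scale1r.
rewrite rnormZ; have -> : rnorm ((s - t)%:C : R[i]) = `|s - t|.
  by rewrite /rnorm normc_def/= expr0n addr0 sqrtr_sqr.
apply: le_lt_trans h1; rewrite ler_wpM2l//.
exact: ltW h2.
Qed.

Lemma has_deriv_continuous (V : normedModType R[i]) b t (f f' : R -> V) :
  has_deriv b f f' -> t \in `[0, b[ -> rcvg (nbhs_in b t) f (f t).
Proof. by move=> [h _] tb; exact: deriv_continuous (h t tb). Qed.

Lemma C1_continuous (V : normedModType R[i]) b t (f : R -> V) :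
  C1_on b f -> t \in `[0, b[ -> rcvg (nbhs_in b t) f (f t).
Proof. by move=> /C1P[f' h]; exact: (has_deriv_continuous h). Qed.

Lemma C1_restrict (V : normedModType R[i]) b c (f : R -> V) :
  c <= b -> C1_on b f -> C1_on c f.
Proof.
move=> cb /C1P[f' [h1 h2]]; apply/C1P; exists f'.
have sub t : t \in `[0, c[ -> t \in `[0, b[.
  by rewrite !in_itv/= => /andP[-> tc]; exact: lt_le_trans cb.
split=> t tc e e0.
  have := h1 t (sub t tc) e e0; rewrite /dnbhs_in !near_withinE.
  by apply: filterS => s hs st sc; exact: (hs st (sub s sc)).
have := h2 t (sub t tc) e e0; rewrite /nbhs_in !near_withinE.
by apply: filterS => s hs sc; exact: (hs (sub s sc)).
Qed.

Lemma C1_cst (V : normedModType R[i]) b (a : V) : C1_on b (fun=> a).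
Proof.
apply/C1P; exists (fun=> 0); split=> t tb; last exact: rcvg_cst.
apply: (rcvg_ext (rcvg_cst (F := dnbhs_in b t) (0 : V))).
by apply: nearW => s; rewrite /quotient subrr scaler0.
Qed.

Lemma C1D (V : normedModType R[i]) b (f g : R -> V) :
  C1_on b f -> C1_on b g -> C1_on b (fun t => f t + g t).
Proof.
move=> /C1P[f' [f1 f2]] /C1P[g' [g1 g2]]; apply/C1P.
exists (fun t => f' t + g' t); split=> t tb.
  apply: (rcvg_ext (rcvgD (f1 t tb) (g1 t tb))).
  by apply: nearW => s; rewrite /quotient -scalerDr opprD addrACA.
exact: rcvgD (f2 t tb) (g2 t tb).
Qed.

Lemma C1N (V : normedModType R[i]) b (f : R -> V) :
  C1_on b f -> C1_on b (fun t => - f t).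
Proof.
move=> /C1P[f' [f1 f2]]; apply/C1P.
exists (fun t => - f' t); split=> t tb.
  apply: (rcvg_ext (rcvgN (f1 t tb))).
  by apply: nearW => s; rewrite /quotient -scalerN opprD.
exact: rcvgN (f2 t tb).
Qed.

Lemma C1_bilinear (U V W : normedModType R[i]) (be : U -> V -> W) b f g :
  bounded_Rbilinear be -> C1_on b f -> C1_on b g ->
  C1_on b (fun t => be (f t) (g t)).
Proof.
move=> hbe /C1P[f' fd] /C1P[g' gd]; apply/C1P.
have [hl hr hZl hZr _] := hbe.
exists (fun t => be (f' t) (g t) + be (f t) (g' t)); split=> t tb; last first.
  apply: rcvgD.
    exact: rcvg_bilinear hbe (fd.2 t tb) (has_deriv_continuous gd tb).
  exact: rcvg_bilinear hbe (has_deriv_continuous fd tb) (gd.2 t tb).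
pose proof (rcvg_bilinear hbe (fd.1 t tb)
  (rcvg_dnbhs_in (has_deriv_continuous gd tb))) as h1.
pose proof (rcvg_bilinear hbe (rcvg_cst (F := dnbhs_in b t) (f t)) (gd.1 t tb)) as h2.
apply: (rcvg_ext (rcvgD h1 h2)).
apply: nearW => s; rewrite /quotient hZl hZr -scalerDr hl hr.
by rewrite addrA subrK.
Qed.

Lemma C1_linear (U V : normedModType R[i]) (La : U -> V) b f :
  (forall u v, La (u - v) = La u - La v) ->
  (forall (r : R) u, La (r%:C *: u) = r%:C *: La u) ->
  (exists M : R, forall u, rnorm (La u) <= M * rnorm u) ->
  C1_on b f -> C1_on b (fun t => La (f t)).
Proof.
move=> lB lZ [M lM] /C1P[f' [f1 f2]]; apply/C1P.
exists (fun t => La (f' t)); split=> t tb.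
  apply: (rcvg_bound (M := M) (f1 t tb)).
  apply: nearW => s; rewrite /quotient -lB -lZ -lB.
  exact: lM.
apply: (rcvg_bound (M := M) (f2 t tb)).
by apply: nearW => s; rewrite -lB; exact: lM.
Qed.

Lemma bilinear_bop_comp (X : normedModType R[i]) :
  bounded_Rbilinear (@bop_comp R X).
Proof.
split.
- by move=> A B C; apply: bop_eq.
- by move=> A B C; apply: bop_eq => u; exact: bop_lB.
- by move=> r A B; apply: bop_eq.
- by move=> r A B; apply: bop_eq => u; exact: bop_lZ.
- by exists 1 => A B; rewrite mul1r; exact: opnorm_comp.
Qed.

Lemma bilinear_bop_app (X : normedModType R[i]) :
  bounded_Rbilinear (fun (A : bop X) (u : X) => A u).
Proof.
split=> //.
- by move=> A u v; exact: bop_lB.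
- by move=> r A u; exact: bop_lZ.
- by exists 1 => A u; rewrite mul1r; exact: opnormP.
Qed.

Lemma bilinear_scale (X : normedModType R[i]) :
  bounded_Rbilinear (fun (a : R[i]^o) (u : X) => a *: u).
Proof.
split.
- by move=> a c u; rewrite scalerBl.
- by move=> a u v; rewrite scalerBr.
- by move=> r a u; rewrite scalerA.
- by move=> r a u; rewrite !scalerA mulrC.
- by exists 1 => a u; rewrite mul1r rnormZ.
Qed.

(** * Inverses of differentiable families of operators *)

Section operator_inverse.
Context (X : normedModType R[i]) (b : R) (S B : R -> bop X) (K : R).
Hypothesis BS : forall t u, t \in `[0, b[ -> B t (S t u) = u.
Hypothesis SB : forall t u, t \in `[0, b[ -> S t (B t u) = u.
Hypothesis BK : forall t, t \in `[0, b[ -> opnorm (B t) <= K.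

Let BB s t : s \in `[0, b[ -> t \in `[0, b[ ->
  B s - B t = - bop_comp (B s) (bop_comp (S s - S t) (B t)).
Proof.
move=> sb tb; apply: bop_eq => u.
change (B s u - B t u = - B s (S s (B t u) - S t (B t u))).
by rewrite bop_lB BS// SB// opprB.
Qed.

Lemma rcvg_bop_inv t : t \in `[0, b[ -> rcvg (nbhs_in b t) S (S t) ->
  rcvg (nbhs_in b t) B (B t).
Proof.
move=> tb Sc; apply: (rcvg_bound (M := K * K) Sc).
apply: filterS (near_nbhs_in_itv b t) => s sb; rewrite BB// rnormN.
apply: le_trans (opnorm_comp _ _) _.
have h1 := opnorm_comp (S s - S t) (B t).
have h2 := BK sb; have h3 := BK tb.
have K0 := le_trans (opnorm_ge0 _) h2.
rewrite mulrAC -mulrA; apply: ler_pM; rewrite ?opnorm_ge0//.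
by apply: le_trans h1 _; apply: ler_wpM2l => //; exact: opnorm_ge0.
Qed.

(** By the resolvent identity, the difference quotient of [B] is [- B s] times that of [S] times
    [B t]. It contains [B s], so the continuity of [B], due to the uniform bound [K], has to come
    before. *)
Lemma C1_bop_inv : C1_on b S -> C1_on b B.
Proof.
move=> /C1P[S' Sd].
have Bc t : t \in `[0, b[ -> rcvg (nbhs_in b t) B (B t).
  by move=> tb; apply: rcvg_bop_inv tb (has_deriv_continuous Sd tb).
apply/C1P; exists (fun t => - bop_comp (B t) (bop_comp (S' t) (B t))).
have hc := @bilinear_bop_comp X.
split=> t tb; last first.
  apply: rcvgN; apply: (rcvg_bilinear hc (Bc t tb)).
  exact: (rcvg_bilinear hc (Sd.2 t tb) (Bc t tb)).
pose proof (rcvgN (rcvg_bilinear hc (rcvg_dnbhs_in (Bc t tb))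
  (rcvg_bilinear hc (Sd.1 t tb) (rcvg_cst (F := dnbhs_in b t) (B t))))) as h.
apply: (rcvg_ext h); apply: filterS (near_dnbhs_in_itv b t) => s sb.
have [_ _ hZl hZr _] := hc.
by rewrite /quotient BB// hZl hZr scalerN.
Qed.
End operator_inverse.

Lemma C1_inv b (nu : R -> R[i]) :
  (forall t, t \in `[0, b[ -> nu t != 0) ->
  C1_on b (nu : R -> R[i]^o) -> C1_on b (fun t => (nu t)^-1 : R[i]^o).
Proof.
move=> nu0 /C1P[nu' nud].
have ic t : t \in `[0, b[ -> rcvg (nbhs_in b t) (fun s => (nu s)^-1 : R[i]^o) (nu t)^-1.
  move=> tb; apply: rcvgV; first exact: nu0.
  exact: (has_deriv_continuous nud tb).
have hm := bilinear_scale (R[i]^o).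
apply/C1P; exists (fun t => - ((nu t)^-1 *: ((nu t)^-1 *: nu' t))).
split=> t tb; last first.
  apply: rcvgN; apply: (rcvg_bilinear hm (ic t tb)).
  exact: (rcvg_bilinear hm (ic t tb) (nud.2 t tb)).
pose proof (rcvgN (rcvg_bilinear hm (rcvg_dnbhs_in (ic t tb))
  (rcvg_bilinear hm (rcvg_cst (F := dnbhs_in b t) ((nu t)^-1 : R[i]^o)) (nud.1 t tb)))) as h.
apply: (rcvg_ext h); apply: filterS (near_dnbhs_in_itv b t) => s sb.
have s0 := nu0 s sb; have t0 := nu0 t tb.
rewrite /quotient; move: ((s - t)^-1)%:C => q.
change (- ((nu s)^-1 * ((nu t)^-1 * (q * (nu s - nu t)))) =
  q * ((nu s)^-1 - (nu t)^-1)).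
by field; rewrite s0 t0.
Qed.
End one_sided_C1.

Lemma subr_swap (V : zmodType) (a b c d : V) : a - b - (c - d) = a - c - (b - d).
Proof. by rewrite !opprB addrACA [RHS]addrACA [- b - c]addrC. Qed.

(** * Perturbation of a simple eigenvalue *)

(** The iterates are bounded, so a subsequence converges by Bolzano-Weierstrass; the steps of the
    iteration decay geometrically, which makes its limit a fixed point. *)
Lemma contraction_fixpoint (R : realType) (h : R[i] -> R[i]) (z0 : R[i]) (rho : R) :
  0 <= rho ->
  (forall z, rnorm (z - z0) <= rho -> rnorm (h z - z0) <= rho) ->
  (forall z w, rnorm (z - z0) <= rho -> rnorm (w - z0) <= rho ->
     rnorm (h z - h w) <= 2^-1 * rnorm (z - w)) ->
  exists2 z, rnorm (z - z0) <= rho & h z = z.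
Proof.
move=> rho0 hb hc; pose z k := iter k h z0.
have zb k : rnorm (z k - z0) <= rho.
  by elim: k => [|k IH]; rewrite /z ?subrr ?rnorm0// iterS; exact: hb.
have zS k : rnorm (z k.+1 - z k) <= rho * 2^-1 ^+ k.
  elim: k => [|k IH]; first by rewrite expr0 mulr1; exact: (zb 1%N).
  have -> : z k.+2 - z k.+1 = h (z k.+1) - h (z k) by [].
  apply: le_trans (hc _ _ (zb _) (zb _)) _.
  by rewrite exprS mulrCA ler_wpM2l// invr_ge0.
have pow k : 2^-1 ^+ k <= k.+1%:R^-1 :> R.
  by rewrite exprVn lef_pV2 ?posrE ?exprn_gt0// -natrX ler_nat ltn_expl.
have zM k : rnorm (z k) <= rho + rnorm z0.
  by apply: le_trans (rnorm_dist _ z0) _; rewrite lerD2r.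
have [y [phi [phi1 phi2]]] := bolzano zM.
have yb : rnorm (y - z0) <= rho.
  rewrite -subr_le0; apply: (@le0_natSinv _ _ 1) => k.
  have := rnorm_dist3 y (z (phi k)) z0; rewrite (rnormBC y (z _)).
  by have := phi2 k; have := zb (phi k); set t := k.+1%:R^-1; lra.
exists y => //; apply/eqP; rewrite -subr_eq0 -rnorm_eq0 eq_le rnorm_ge0 andbT.
(* With [t = 1 / (k + 1)]: [t / 2] for replacing [y] by the iterate under [h], [rho * t] for one
   more step of the iteration, [t] for the return to [y]. *)
apply: (@le0_natSinv _ _ (3 / 2 + rho)) => k.
have h1 := hc _ _ yb (zb (phi k)).
have h2 := zS (phi k).
have h3 : rho * 2^-1 ^+ phi k <= rho * k.+1%:R^-1.
  rewrite ler_wpM2l//; apply: le_trans (pow _) _.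
  by rewrite lef_pV2 ?posrE// ler_nat ltnS.
have h4 := phi2 k; have h5 := rnorm_dist3 (h y) (h (z (phi k))) y.
have h6 : rnorm (h (z (phi k)) - y) <= _ := rnorm_dist3 _ (z (phi k)) _.
have h7 : rnorm (h (z (phi k)) - z (phi k)) = rnorm (z (phi k).+1 - z (phi k)) by [].
rewrite (rnormBC y) in h1; rewrite h7 in h6.
move: h1 h2 h3 h4 h5 h6; set t := k.+1%:R^-1; set p := 2^-1 ^+ _; lra.
Qed.

Section inner_product.
Context (R : realType) (X : normedModType R[i]).

(** Linear in the first argument, conjugate-linear in the second. Completeness is not part of the
    structure: the perturbation theory runs on it with a given adjoint map [adj]. *)
Record is_inner (ip : X -> X -> R[i]) : Prop := IsInner {
  ip_linear : forall a u v w, ip (a *: u + v) w = a * ip u w + ip v w;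
  ip_conj : forall u v, ip v u = (ip u v)^*;
  ip_norm : forall u, ip u u = (rnorm u ^+ 2)%:C }.

Context (ip : X -> X -> R[i]) (Hip : is_inner ip).

Lemma ip0l w : ip 0 w = 0.
Proof.
have := ip_linear Hip 1 0 0 w; rewrite scaler0 addr0 mul1r.
by move=> /(congr1 (fun z => z - ip 0 w)); rewrite subrr addrK.
Qed.

Lemma ipZl a u w : ip (a *: u) w = a * ip u w.
Proof. by have := ip_linear Hip a u 0 w; rewrite !addr0 ip0l addr0. Qed.

Lemma ipDl u v w : ip (u + v) w = ip u w + ip v w.
Proof. by have := ip_linear Hip 1 u v w; rewrite scale1r mul1r. Qed.

Lemma ipNl u w : ip (- u) w = - ip u w.
Proof. by rewrite -scaleN1r ipZl mulN1r. Qed.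

Lemma ipBl u v w : ip (u - v) w = ip u w - ip v w.
Proof. by rewrite ipDl ipNl. Qed.

Lemma ipZr a u w : ip u (a *: w) = a^* * ip u w.
Proof. by rewrite (ip_conj Hip) ipZl rmorphM/= -(ip_conj Hip). Qed.

Lemma ipZrr (r : R) u w : ip u (r%:C *: w) = r%:C * ip u w.
Proof.
rewrite ipZr; congr (_ * _).
by apply/eqP; rewrite eq_complex /= oppr0 !eqxx.
Qed.

Lemma ipDr u v w : ip u (v + w) = ip u v + ip u w.
Proof. by rewrite (ip_conj Hip) ipDl rmorphD/= -!(ip_conj Hip). Qed.

Lemma ipBr u v w : ip u (v - w) = ip u v - ip u w.
Proof. by rewrite (ip_conj Hip) ipBl rmorphB/= -!(ip_conj Hip). Qed.

Lemma ip0r u : ip u 0 = 0.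
Proof. by rewrite (ip_conj Hip) ip0l rmorph0. Qed.

Lemma ip_cauchy_schwarz u v : rnorm (ip u v) <= rnorm u * rnorm v.
Proof.
have [->|v0] := eqVneq v 0; first by rewrite ip0r !rnorm0 mulr0.
have rv : 0 < rnorm v by rewrite rnorm_gt0.
have rv2 : 0 < rnorm v ^+ 2 by rewrite exprn_gt0.
pose t : R[i] := ((rnorm v ^+ 2)^-1)%:C * ip u v.
pose w := u - t *: v.
have wv : ip w v = 0.
  rewrite ipBl ipZl (ip_norm Hip) /t mulrAC -rmorphM/= mulVf ?gt_eqF//.
  by rewrite mul1r subrr.
have nE : ip u v * ip v u = (rnorm (ip u v) ^+ 2)%:C.
  by rewrite (ip_conj Hip u v) rmorphXn/= rnormE sqr_normc.
have : ip w w = (rnorm u ^+ 2 - rnorm (ip u v) ^+ 2 / rnorm v ^+ 2)%:C.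
  rewrite {2}/w ipBr ipZr wv mulr0 subr0 ipBl ipZl (ip_norm Hip).
  by rewrite /t -mulrA nE -rmorphM -rmorphB/= mulrC.
rewrite (ip_norm Hip) => /complexI h.
rewrite -ler_sqr ?nnegrE ?mulr_ge0 ?rnorm_ge0// exprMn -ler_pdivrMr//.
by rewrite -subr_ge0 -h sqr_ge0.
Qed.

Lemma ip_functional w : bounded_functional (ip^~ w).
Proof.
split; first by move=> a u v; exact: ip_linear.
exists (rnorm w) => u; rewrite mulrC; exact: ip_cauchy_schwarz.
Qed.

Lemma ip_injr v w : (forall u, ip u v = ip u w) -> v = w.
Proof.
move=> h; apply/eqP; rewrite -subr_eq0 -rnorm_eq0.
have : ip (v - w) (v - w) = 0 by rewrite ipBr h subrr.
by rewrite (ip_norm Hip) => /complexI/eqP; rewrite expf_eq0.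
Qed.

Lemma bilinear_ip : bounded_Rbilinear (ip : X -> X -> R[i]^o).
Proof.
split.
- by move=> u v w; rewrite ipBl.
- by move=> u v w; rewrite ipBr.
- by move=> r u v; rewrite ipZl.
- by move=> r u v; rewrite ipZrr.
- by exists 1 => u v; rewrite mul1r; exact: ip_cauchy_schwarz.
Qed.

Context (adj : bop X -> bop X).
Hypothesis adjP : forall (A : bop X) f g, ip (A f) g = ip f (adj A g).

Lemma adj_le A g : rnorm (adj A g) <= opnorm A * rnorm g.
Proof.
have [h0|h0] := eqVneq (adj A g) 0.
  by rewrite h0 rnorm0 mulr_ge0 ?opnorm_ge0 ?rnorm_ge0.
have r0 : 0 < rnorm (adj A g) by rewrite rnorm_gt0.
rewrite -(ler_pM2l r0) -expr2.
have -> : rnorm (adj A g) ^+ 2 = rnorm (ip (adj A g) (adj A g)).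
  by rewrite (ip_norm Hip) rnorm_realC// sqr_ge0.
rewrite -adjP; apply: le_trans (ip_cauchy_schwarz _ _) _.
rewrite mulrCA mulrA ler_wpM2r ?rnorm_ge0//.
exact: opnormP.
Qed.

(** The map from [A] to [adj A g] is conjugate-linear, hence real-linear, and bounded. *)
Lemma C1_adj b (A : R -> bop X) g : C1_on b A -> C1_on b (fun t => adj (A t) g).
Proof.
apply: (C1_linear (La := fun A => adj A g)).
- by move=> B C; apply: ip_injr => u; rewrite ipBr -!adjP bopB ipBl.
- by move=> r B; apply: ip_injr => u; rewrite ipZrr -!adjP bopZ ipZl.
- by exists (rnorm g) => B; rewrite mulrC; exact: adj_le.
Qed.

Lemma rcvg_adj T (F : set_system T) {FF : Filter F} (A : T -> bop X) B g :
  rcvg F A B -> rcvg F (fun t => adj (A t) g) (adj B g).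
Proof.
move=> h; apply: (rcvg_bound (M := rnorm g) h).
apply: nearW => t; have -> : adj (A t) g - adj B g = adj (A t - B) g.
  by apply: ip_injr => u; rewrite ipBr -!adjP bopB ipBl.
by rewrite mulrC; exact: adj_le.
Qed.
(** The left eigenvector is described by pairing and not through the adjoint, which keeps the
    conjugate of the eigenvalue out of the computations. *)
Definition eigenbranch (L : R -> bop X) (lam0 : R[i]) (eta : R)
    (e ehat : R -> X) (lam : R -> R[i]) : Prop :=
  [/\ C1_on eta e, C1_on eta ehat, C1_on eta (lam : R -> R[i]^o), lam 0 = lam0 &
   forall d, d \in `[0, eta[ -> [/\ L d (e d) = lam d *: e d,
     forall u, ip (L d u) (ehat d) = lam d * ip u (ehat d) &
     ip (e d) (ehat d) = 1]].

(** * The branch of eigenvalues through a simple one *)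

Section simple_branch.
Context (b : R) (L : R -> bop X) (lam0 : R[i]) (e0 : X).
Hypotheses (b0 : 0 < b) (LC1 : C1_on b L).
Hypothesis Lc : forall d, d \in `[0, b[ -> seq_compact (L d).
Hypotheses (lam0_neq0 : lam0 != 0) (Le0 : L 0 e0 = lam0 *: e0) (e01 : rnorm e0 = 1).
Hypothesis geom : forall u, L 0 u = lam0 *: u -> exists a : R[i], u = a *: e0.
Hypothesis semi : semisimple (L 0) lam0.

(* [l - A d] is the bordered operator; [x = (l - A d)^-1 e0] satisfies
   [(l - L d) x = (1 - psi x) e0], so [l] is an eigenvalue as soon as
   [g d l = psi x = 1], that is, when [l] is a fixed point of [h d].  The
   derivative of [g 0] at [lam0] is [-1], whence the contraction. *)
Let psi u := ip u e0.
Let K : bop X := rank1 (ip_functional e0) e0.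
Let A d : bop X := L d - K.

Let psi_e0 : psi e0 = 1.
Proof. by rewrite /psi (ip_norm Hip) e01 expr1n. Qed.

Let e0_neq0 : e0 != 0.
Proof. by rewrite -rnorm_gt0 e01. Qed.

Let psi_le u : rnorm (psi u) <= rnorm u.
Proof. by have := ip_cauchy_schwarz u e0; rewrite e01 mulr1. Qed.

Let AE d u : A d u = L d u - psi u *: e0. Proof. by []. Qed.

Let A_compact d : d \in `[0, b[ -> seq_compact (A d).
Proof.
move=> db; have -> : A d = L d + rank1 (ip_functional e0) (- e0).
  by apply: bop_eq => u; rewrite bopD AE /= scalerN.
by apply: seq_compactD; [exact: Lc|exact: seq_compact_rank1].
Qed.

Let in0 : 0 \in `[0, b[. Proof. by rewrite in_itv/= lexx b0. Qed.

(** A kernel vector [u] of [lam0 - A 0] satisfies [L 0 u - lam0 *: u = psi u *: e0]. The right side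
    is in the kernel of [L 0 - lam0], so semisimplicity makes it 0; then [psi u = 0] and
    [u = a *: e0], whence [a = psi u = 0]. *)
Let base_bound : exists2 c : R, 0 < c &
  forall u, c * rnorm u <= rnorm (lam0 *: u - A 0 u).
Proof.
have [|||c c0 hc] := @eigen_lower_bound _ _ (A 0) [set lam0] (A_compact in0).
- by move=> /= h; move: lam0_neq0; rewrite -h eqxx.
- move=> l hl /=; apply/eqP; rewrite -subr_eq0 -rnorm_eq0 eq_le rnorm_ge0 andbT.
  apply/ler_addgt0Pr => e e_gt0; rewrite add0r rnormBC.
  by have [_ -> ] := hl e e_gt0.
- move=> _ u -> /eqP; rewrite AE subr_eq addrC -subr_eq => /eqP h.
  have Sv : L 0 u - lam0 *: u = 0.
    by apply: semi; rewrite h bop_lZ Le0 !scalerA mulrC.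
  have [a ua] := geom (subr0_eq Sv).
  move: h; rewrite Sv => /esym/eqP; rewrite scaler_eq0 (negPf e0_neq0) orbF.
  by rewrite ua /psi ipZl -/(psi e0) psi_e0 mulr1 => /eqP ->; rewrite scale0r.
by exists c => // u; exact: hc.
Qed.

Let dist d l := opnorm (L d - L 0) + rnorm (l - lam0).
Let resolvent_family : exists (kap k : R) (B : R -> R[i] -> bop X),
  [/\ 0 < kap, 0 < k, k * (k + 1) * kap <= 2^-1 &
   forall d l, d \in `[0, b[ -> dist d l <= kap ->
   [/\ forall u, B d l (l *: u - A d u) = u,
       forall u, l *: B d l u - A d (B d l u) = u & opnorm (B d l) <= k]].
Proof.
have [c c0 hc] := base_bound.
have rl0 : 0 < rnorm lam0 by rewrite rnorm_gt0.
(* [c / 2] leaves at least half of the lower bound after a perturbation of size [c1];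
   [rnorm lam0 / 2] keeps [l] away from 0, as [compact_resolvent] requires. *)
pose c1 := Num.min (c / 2) (rnorm lam0 / 2).
have c10 : 0 < c1 by rewrite lt_min !divr_gt0.
have c1c : c1 <= c / 2 by rewrite ge_min lexx.
have c1l : c1 <= rnorm lam0 / 2 by rewrite ge_min lexx orbT.
pose k := c1^-1; have k0 : 0 < k by rewrite invr_gt0.
have kk : 0 < k * (k + 1) by rewrite mulr_gt0// addr_gt0.
(* The second term makes the factor of the contraction at most 1/2, see [psi_near]. *)
pose kap := Num.min c1 (2^-1 / (k * (k + 1))).
have kc : kap <= c1 by rewrite ge_min lexx.
have h d l : exists B : bop X, d \in `[0, b[ -> dist d l <= kap ->
    [/\ forall u, B (l *: u - A d u) = u,
       forall u, l *: B u - A d (B u) = u & opnorm B <= k].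
  have [[db dl]|h] := pselect ((d \in `[0, b[) /\ (dist d l <= kap)); last first.
    by exists 0 => db dl; case: h.
  have dl1 := le_trans dl kc.
  have l_neq0 : l != 0.
    rewrite -rnorm_gt0; have := rnorm_dist lam0 l; rewrite (rnormBC lam0 l).
    by have := opnorm_ge0 (L d - L 0); rewrite /dist in dl1; lra.
  have lb u : c1 * rnorm u <= rnorm (l *: u - A d u).
    have h1 := hc u.
    have h2 := rnorm_dist (lam0 *: u - A 0 u) (l *: u - A d u).
    have h3 : rnorm (lam0 *: u - A 0 u - (l *: u - A d u)) <= dist d l * rnorm u.
      have -> : lam0 *: u - A 0 u - (l *: u - A d u) =
          (L d - L 0) u - (l - lam0) *: u.
        rewrite !AE bopB scalerBl subr_swap [X in _ - X]subr_swap subrr subr0.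
        by rewrite -[in LHS](opprB (L d u)) opprK -[in LHS](opprB (l *: u)) addrC.
      apply: le_trans (rnormB _ _) _; rewrite mulrDl rnormZ lerD2r.
      exact: opnormP.
    have := ler_wpM2r (rnorm_ge0 u) dl1; have := ler_wpM2r (rnorm_ge0 u) c1c.
    lra.
  have [B hB] := compact_resolvent (A_compact db) l_neq0 c10 lb.
  by exists B.
exists kap, k, (fun d => projT1 (choice (h d))); split => //.
- by rewrite lt_min c10 divr_gt0.
- by rewrite mulrC -ler_pdivlMr// ge_min lexx orbT.
- by move=> d l; exact: (projT2 (choice (h d)) l).
Qed.

Section resolvent.
Variables (kap k : R) (B : R -> R[i] -> bop X).
Hypotheses (kap0 : 0 < kap) (k0 : 0 < k) (kkap : k * (k + 1) * kap <= 2^-1).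
Hypothesis hB : forall d l, d \in `[0, b[ -> dist d l <= kap ->
   [/\ forall u, B d l (l *: u - A d u) = u,
       forall u, l *: B d l u - A d (B d l u) = u & opnorm (B d l) <= k].

Let good d l := (d \in `[0, b[) /\ (dist d l <= kap).
Let x d l := B d l e0.
Let g d l := psi (x d l).
Let h d l := l + g d l - 1.

Let dist0 : dist 0 lam0 = 0.
Proof. by rewrite /dist !subrr rnorm0 -rnorm_opnorm rnorm0 addr0. Qed.

Let good0 : good 0 lam0.
Proof. by split; [exact: in0|rewrite dist0 ltW]. Qed.

Let B_le d l u : good d l -> rnorm (B d l u) <= k * rnorm u.
Proof.
move=> [db dl]; have [_ _ hk] := hB db dl.
by apply: le_trans (opnormP _ _) _; rewrite ler_wpM2r ?rnorm_ge0.
Qed.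

Let x_eq d l : good d l -> l *: x d l - L d (x d l) = (1 - g d l) *: e0.
Proof.
move=> [db dl]; have [_ h2 _] := hB db dl.
have e : l *: x d l - (L d (x d l) - g d l *: e0) = e0 := h2 e0.
by rewrite scalerBl scale1r -{1}e opprB addrA [RHS]addrAC addrK.
Qed.

(** The resolvent identity in both parameters: [d = d'] gives the contraction, [l = l'] the
    continuity in [d], and the base point the distance to [e0]. *)
Let x_diff d l d' l' : good d l -> good d' l' ->
  x d l - x d' l' = B d l ((L d - L d') (x d' l') - (l - l') *: x d' l').
Proof.
move=> [db dl] [db' dl']; have [h1 h2 _] := hB db dl; have [_ h2' _] := hB db' dl'.
rewrite -[LHS]h1; congr (B d l _).
have := h2 e0; have := h2' e0; rewrite -/(x d l) -/(x d' l') => e' e.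
rewrite scalerBr bop_lB subr_swap e -e' subr_swap opprB addrC -scalerBl.
by rewrite bopB !AE [in LHS]subr_swap subrr subr0 -scaleNr opprB.
Qed.

Let x0 : x 0 lam0 = e0.
Proof.
have [h1 _ _] := hB good0.1 good0.2.
rewrite /x -[RHS](h1 e0); congr (B 0 lam0 _).
by rewrite AE Le0 psi_e0 scale1r opprB addrC subrK.
Qed.

Let x_near d l : good d l -> rnorm (x d l - e0) <= k * dist d l.
Proof.
move=> gd; rewrite -{1}x0 (x_diff gd good0).
apply: le_trans (B_le _ gd) _; rewrite ler_wpM2l ?(ltW k0)// x0.
apply: le_trans (rnormB _ _) _; rewrite rnormZ e01 mulr1 lerD2r.
by have := opnormP (L d - L 0) e0; rewrite e01 mulr1.
Qed.

(** Up to sign, [psi (B d l (x d l'))] is the divided difference of [g d] at [l] and [l']. Its value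
    at the base point is [psi e0 = 1]; two applications of the resolvent move it by at most
    [k * k * kap + k * kap]. *)
Let psi_near d l l' : good d l -> good d l' ->
  rnorm (1 - psi (B d l (x d l'))) <= 2^-1.
Proof.
move=> gl gl'; rewrite -psi_e0 /psi -ipBl; apply: le_trans (psi_le _) _.
rewrite rnormBC.
have -> : B d l (x d l') - e0 = B d l (x d l' - e0) + (x d l - e0).
  by rewrite bop_lB addrA subrK.
apply: le_trans (rnormD _ _) _; apply: le_trans kkap.
have h1 := B_le (x d l' - e0) gl.
have h2 : k * rnorm (x d l' - e0) <= k * (k * kap).
  rewrite ler_wpM2l ?(ltW k0)//; apply: le_trans (x_near gl') _.
  by rewrite ler_wpM2l ?(ltW k0)//; exact: gl'.2.
have h3 := x_near gl; have h4 : k * dist d l <= k * kap.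
  by rewrite ler_wpM2l ?(ltW k0)//; exact: gl.2.
by rewrite mulrDr mulr1 mulrDl -mulrA; lra.
Qed.

Let h_contr d l l' : good d l -> good d l' ->
  rnorm (h d l - h d l') <= 2^-1 * rnorm (l - l').
Proof.
move=> gl gl'; have -> : h d l - h d l' = (1 - psi (B d l (x d l'))) * (l - l').
  have := x_diff gl gl'.
  have -> : (L d - L d) (x d l') - (l - l') *: x d l' = (l' - l) *: x d l'.
    by rewrite bopB subrr sub0r -scaleNr opprB.
  rewrite bop_lZ => /(congr1 psi); rewrite {1}/psi ipBl -!/(psi _) {3}/psi ipZl.
  rewrite -!/(psi _) -!/(g _ _) -/(psi _) => gg.
  have -> : h d l - h d l' = (l - l') + (g d l - g d l') by rewrite /h; ring.
  by rewrite gg; ring.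
by rewrite rnormM ler_wpM2r ?rnorm_ge0//; exact: psi_near.
Qed.

Let x_le d l : good d l -> rnorm (x d l) <= k.
Proof. by move=> gd; have := B_le e0 gd; rewrite e01 mulr1. Qed.

Let h_cont d d' l : good d l -> good d' l ->
  rnorm (h d l - h d' l) <= k * k * opnorm (L d - L d').
Proof.
move=> gd gd'; have -> : h d l - h d' l = psi (x d l - x d' l).
  by rewrite /h /psi ipBl -!/(psi _) /g; ring.
apply: le_trans (psi_le _) _; rewrite (x_diff gd gd') subrr scale0r subr0.
apply: le_trans (B_le _ gd) _; rewrite -mulrA ler_wpM2l ?(ltW k0)//.
apply: le_trans (opnormP _ _) _; rewrite mulrC ler_wpM2r ?opnorm_ge0//.
exact: x_le.
Qed.
(** The ball for [l] has radius [kap / 2], which leaves [kap / 2] for the operators within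
    [dist d l <= kap]. The bound [kap / 4] is on the displacement of the centre by [h d]: added to
    half the radius it gives back [kap / 2], so the ball is mapped into itself. *)
Lemma perturbation_interval : exists2 eta : R, 0 < eta <= b & forall d, d \in `[0, eta[ ->
  k * k * opnorm (L d - L 0) <= kap / 4 /\ opnorm (L d - L 0) <= kap / 2.
Proof.
have kk : 0 < k * k by rewrite mulr_gt0.
pose e := Num.min (kap / 4 / (k * k)) (kap / 2).
have e_gt0 : 0 < e by rewrite lt_min !divr_gt0.
have [r r0 hr] := near_nbhs_in_ball (C1_continuous LC1 in0 e_gt0).
exists (Num.min b r); first by rewrite lt_min b0 r0 ge_min lexx.
move=> d; rewrite in_itv/= lt_min => /and3P[d0 db dr].
have : opnorm (L d - L 0) < e.
  by apply: hr; rewrite ?in_itv/= ?d0// subr0 ger0_norm.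
rewrite lt_min => /andP[h1 h2]; split; last exact: ltW.
by rewrite mulrC -ler_pdivlMr// ltW.
Qed.

Section branch.
Variables (eta : R).
Hypotheses (eta0 : 0 < eta) (etab : eta <= b).
Hypothesis heta : forall d, d \in `[0, eta[ ->
  k * k * opnorm (L d - L 0) <= kap / 4 /\ opnorm (L d - L 0) <= kap / 2.

Let eta_sub d : d \in `[0, eta[ -> d \in `[0, b[.
Proof. by rewrite !in_itv/= => /andP[-> de]; exact: lt_le_trans etab. Qed.

Let good_eta d l : d \in `[0, eta[ -> rnorm (l - lam0) <= kap / 2 -> good d l.
Proof.
move=> de hl; split; first exact: eta_sub.
by have [_ h2] := heta de; rewrite /dist; lra.
Qed.

Let in0eta : 0 \in `[0, eta[. Proof. by rewrite in_itv/= lexx. Qed.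

Let h0 : h 0 lam0 = lam0.
Proof. by rewrite /h /g x0 psi_e0 addrK. Qed.

Let fix_ex d : exists l, d \in `[0, eta[ -> good d l /\ h d l = l.
Proof.
have [de|] := boolP (d \in `[0, eta[); last by exists 0.
have k2 : 0 <= kap / 2 by rewrite divr_ge0// ltW.
have z0 : rnorm (lam0 - lam0) <= kap / 2 by rewrite subrr rnorm0.
have [|z w hz hw|l hl le] := @contraction_fixpoint _ (h d) lam0 _ k2.
- move=> z hz; have gz := good_eta de hz; have g0 := good_eta de z0.
  apply: le_trans (rnorm_dist3 _ (h d lam0) _) _.
  have h1 := h_contr gz g0; have h2 := h_cont g0 good0.
  have [h3 _] := heta de; rewrite h0 in h2; lra.
- by apply: h_contr; exact: good_eta.
by exists l => _; split=> //; exact: good_eta.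
Qed.

Let lam : R -> R[i] := projT1 (choice fix_ex).

Let lam_good d : d \in `[0, eta[ -> good d (lam d).
Proof. by move=> /(projT2 (choice fix_ex) d)[]. Qed.

Let lam_fix d : d \in `[0, eta[ -> h d (lam d) = lam d.
Proof. by move=> /(projT2 (choice fix_ex) d)[]. Qed.

Let lam_0 : lam 0 = lam0.
Proof.
apply/eqP; rewrite -subr_eq0 -rnorm_eq0.
have := h_contr (lam_good in0eta) good0; rewrite (lam_fix in0eta) h0.
have := rnorm_ge0 (lam 0 - lam0) => p1 p2.
by rewrite eq_le p1 andbT; lra.
Qed.

(** [good] alone gives the radius [kap]; the radius [kap / 2] makes [lam t] admissible at every
    parameter [s] of the interval, as the comparison of [lam s] with [lam t] requires. *)
Let in_ball_lam d : d \in `[0, eta[ -> rnorm (lam d - lam0) <= kap / 2.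
Proof.
move=> de; have h1 := h_contr (lam_good de) (good_eta de _).
have z0 : rnorm (lam0 - lam0) <= kap / 2.
  by rewrite subrr rnorm0 divr_ge0// ltW.
have := h1 _ z0; have := h_cont (good_eta de z0) good0.
rewrite h0 (lam_fix de); have := rnorm_dist3 (lam d) (h d lam0) lam0.
have [h3 _] := heta de; lra.
Qed.

Let lam_lip s t : s \in `[0, eta[ -> t \in `[0, eta[ ->
  rnorm (lam s - lam t) <= 2 * (k * k) * opnorm (L s - L t).
Proof.
move=> se te.
have gst : good s (lam t) by apply: good_eta => //; exact: in_ball_lam.
have := h_contr (lam_good se) gst; have := h_cont gst (lam_good te).
rewrite (lam_fix se) (lam_fix te).
have := rnorm_dist3 (lam s) (h s (lam t)) (lam t); lra.
Qed.

Let Bd d := B d (lam d).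
Let xd d := Bd d e0.
Let yd d := adj (Bd d) e0.
Let nu d := ip (xd d) (yd d).
Let Sd d : bop X := lam d *: bop_id X - A d.

Let psi_xd d : d \in `[0, eta[ -> psi (xd d) = 1.
Proof.
move=> de; have := lam_fix de; rewrite /h /g -addrA => /(congr1 (fun z => z - lam d)).
by rewrite addrC addrK subrr => /eqP; rewrite subr_eq0 => /eqP.
Qed.

Let xd_eigen d : d \in `[0, eta[ -> L d (xd d) = lam d *: xd d.
Proof.
move=> de; have := x_eq (lam_good de); rewrite /g psi_xd// subrr scale0r.
by move=> /eqP; rewrite subr_eq0 => /eqP.
Qed.

Let yd_eigen d u : d \in `[0, eta[ -> ip (L d u) (yd d) = lam d * ip u (yd d).
Proof.
move=> de; have [h1 _ _] := hB (lam_good de).1 (lam_good de).2.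
rewrite /yd -!adjP -/(psi _) -/(psi _).
have : psi (Bd d (lam d *: u - A d u)) = psi u by rewrite /Bd h1.
rewrite AE opprB addrA bop_lB bop_lD !bop_lZ /psi ipBl ipDl !ipZl -!/(psi _).
rewrite -/(xd d) psi_xd// mulr1 => /eqP.
by rewrite subr_eq [psi u + _]addrC => /eqP/addIr ->.
Qed.

(** [nu d] equals [psi (Bd d (xd d))], which [psi_near] keeps within 1/2 of 1; the two eigenvectors
    can therefore be normalized against each other. *)
Let nu_neq0 d : d \in `[0, eta[ -> nu d != 0.
Proof.
move=> de; have := psi_near (lam_good de) (lam_good de).
rewrite /nu /yd -adjP -/(psi _); apply: contraTneq => ->.
by rewrite subr0 rnorm1 -ltNge; lra.
Qed.

Let BS t u : t \in `[0, eta[ -> Bd t (Sd t u) = u.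
Proof. by move=> te; have [h1 _ _] := hB (lam_good te).1 (lam_good te).2; exact: h1. Qed.

Let SB t u : t \in `[0, eta[ -> Sd t (Bd t u) = u.
Proof. by move=> te; have [_ h1 _] := hB (lam_good te).1 (lam_good te).2; exact: h1. Qed.

Let Bk t : t \in `[0, eta[ -> opnorm (Bd t) <= k.
Proof. by move=> te; have [_ _ h1] := hB (lam_good te).1 (lam_good te).2. Qed.

Let LC : C1_on eta L := C1_restrict etab LC1.

Let lam_cont t : t \in `[0, eta[ -> rcvg (nbhs_in eta t) lam (lam t).
Proof.
move=> te; apply: (rcvg_bound (M := 2 * (k * k)) (C1_continuous LC te)).
by apply: filterS (near_nbhs_in_itv eta t) => s se; exact: lam_lip.
Qed.

Let S_of_lam (F : set_system R) {FF : Filter F} t :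
  rcvg F lam (lam t) -> rcvg F L (L t) -> rcvg F Sd (Sd t).
Proof.
move=> hl hL; rewrite /Sd /A; apply: rcvgD.
  exact: (rcvg_bilinear (bilinear_scale (bop X)) hl (rcvg_cst (F := F) (bop_id X))).
by apply: rcvgN; apply: rcvgD hL _; exact: rcvg_cst.
Qed.

Let Bd_cont t : t \in `[0, eta[ -> rcvg (nbhs_in eta t) Bd (Bd t).
Proof.
move=> te; apply: (rcvg_bop_inv BS SB Bk te).
by apply: S_of_lam; [exact: lam_cont|exact: C1_continuous LC te].
Qed.

Let xd_cont t : t \in `[0, eta[ -> rcvg (nbhs_in eta t) xd (xd t).
Proof.
move=> te; exact: (rcvg_bilinear (bilinear_bop_app X) (Bd_cont te)
  (rcvg_cst (F := nbhs_in eta t) e0)).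
Qed.

Let yd_cont t : t \in `[0, eta[ -> rcvg (nbhs_in eta t) yd (yd t).
Proof. by move=> te; exact: rcvg_adj (Bd_cont te). Qed.

Let lam_C1 : C1_on eta (lam : R -> R[i]^o).
Proof.
have /C1P[L' Ld] := LC; apply/C1P.
exists (fun t => ip (L' t (xd t)) (yd t) / nu t).
have hi := bilinear_ip; have ha := bilinear_bop_app X.
have hm := bilinear_scale (R[i]^o).
split=> t te; last first.
  apply: (rcvg_bilinear hm).
    apply: (rcvg_bilinear hi _ (yd_cont te)).
    exact: (rcvg_bilinear ha (Ld.2 t te) (xd_cont te)).
  apply: rcvgV; first exact: nu_neq0.
  exact: (rcvg_bilinear hi (xd_cont te) (yd_cont te)).
have xp := rcvg_dnbhs_in (xd_cont te).
pose proof (rcvg_bilinear hi (rcvg_bilinear ha (Ld.1 t te) xp)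
  (rcvg_cst (F := dnbhs_in eta t) (yd t))) as h1.
pose proof (rcvg_bilinear hi xp (rcvg_cst (F := dnbhs_in eta t) (yd t))) as h2.
pose proof (rcvg_bilinear hm h1 (rcvgV (nu_neq0 te) h2)) as h3.
apply: (rcvg_ext h3).
have nz : \forall s \near dnbhs_in eta t, ip (xd s) (yd t) != 0.
  have n0 : 0 < rnorm (nu t) by rewrite rnorm_gt0 nu_neq0.
  apply: filterS (h2 _ n0) => s; apply: contraTneq => ->.
  by rewrite sub0r rnormN ltxx.
apply: filterS2 (near_dnbhs_in_itv eta t) nz => s se sn0.
have key : (lam s - lam t) * ip (xd s) (yd t) = ip ((L s - L t) (xd s)) (yd t).
  by rewrite bopB ipBl yd_eigen// xd_eigen// ipZl mulrBl.
rewrite /quotient bopZ ipZl -key -[LHS]mulrA mulfK//.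
Qed.

Let Bd_C1 : C1_on eta Bd.
Proof.
apply: (C1_bop_inv BS SB Bk); rewrite /Sd /A; apply: C1D.
  exact: (C1_bilinear (bilinear_scale (bop X)) lam_C1 (C1_cst eta (bop_id X))).
by apply: C1N; apply: C1D LC _; exact: C1_cst.
Qed.

Let xd_C1 : C1_on eta xd.
Proof. exact: (C1_bilinear (bilinear_bop_app X) Bd_C1 (C1_cst eta e0)). Qed.

Let yd_C1 : C1_on eta yd.
Proof. exact: C1_adj Bd_C1. Qed.

Let ed_C1 : C1_on eta (fun d => (nu d)^-1 *: xd d).
Proof.
apply: (C1_bilinear (bilinear_scale X)) xd_C1; apply: C1_inv; first exact: nu_neq0.
exact: (C1_bilinear bilinear_ip xd_C1 yd_C1).
Qed.

Lemma branch_of_resolvent : exists (e ehat : R -> X) (lam : R -> R[i]),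
  eigenbranch L lam0 eta e ehat lam.
Proof.
exists (fun d => (nu d)^-1 *: xd d), yd, lam; split=> // d de; split.
- by rewrite bop_lZ xd_eigen// !scalerA mulrC.
- by move=> u; exact: yd_eigen.
- by rewrite ipZl mulVf ?nu_neq0.
Qed.
End branch.
End resolvent.

Lemma simple_eigenvalue_branch :
  exists (eta : R) (e ehat : R -> X) (lam : R -> R[i]), 0 < eta <= b /\
  eigenbranch L lam0 eta e ehat lam.
Proof.
have [kap [k [B [kap0 k0 kkap hB]]]] := resolvent_family.
have [eta /andP[eta0 etab] heta] := perturbation_interval kap0 k0.
have [e [ehat [lam h]]] := branch_of_resolvent kap0 k0 kkap hB eta0 etab heta.
by exists eta, e, ehat, lam; rewrite eta0.
Qed.
End simple_branch.
End inner_product.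

(** * Riesz representation and adjoints *)

Section riesz_representation.
Context (R : realType) (X : normedModType R[i]) (ip : X -> X -> R[i]).
Context (Hip : is_inner ip).

(* Weaker than completeness in form only, and sufficient for the minimizing
   sequences of the representation theorem. *)
Definition fast_complete : Prop := forall u : nat -> X,
  (forall k, rnorm (u k.+1 - u k) <= 4^-1 ^+ k) ->
  exists y : X, forall k, rnorm (u k - y) <= 2 * k.+1%:R^-1.

Lemma rnorm_sqrD (u v : X) :
  rnorm (u + v) ^+ 2 = rnorm u ^+ 2 + 2 * complex.Re (ip u v) + rnorm v ^+ 2.
Proof.
apply: complexI; rewrite -(ip_norm Hip) (ipDl Hip) !(ipDr Hip) !(ip_norm Hip).
rewrite (ip_conj Hip u v); case: (ip u v) => a b.
by apply/eqP; rewrite eq_complex /=; apply/andP; split; apply/eqP; ring.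
Qed.

Lemma parallelogram (u v : X) :
  rnorm (u + v) ^+ 2 + rnorm (u - v) ^+ 2 = 2 * (rnorm u ^+ 2 + rnorm v ^+ 2).
Proof.
rewrite !rnorm_sqrD rnormN -scaleN1r (ipZr Hip).
by case: (ip u v) => a b /=; ring.
Qed.
Hypothesis complete : fast_complete.

(** The vector of least norm on [psi u = 1] is orthogonal to the kernel of [psi], so that a multiple
    of it represents [psi]. Its existence is where completeness enters. *)
Lemma min_norm_on_hyperplane (psi : X -> R[i]) : bounded_functional psi ->
  (exists u, psi u != 0) ->
  exists2 y, psi y = 1 & forall u, psi u = 1 -> rnorm y <= rnorm u.
Proof.
move=> [psil [M psiM]] [u0 pu0].
have psi0 : psi 0 = 0.
  have := psil 1 0 0; rewrite scaler0 addr0 mul1r => /(congr1 (fun z => z - psi 0)).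
  by rewrite subrr addrK.
have psiZ a u : psi (a *: u) = a * psi u by have := psil a u 0; rewrite !addr0 psi0 addr0.
have psiD u v : psi (u + v) = psi u + psi v by have := psil 1 u v; rewrite scale1r mul1r.
have psiB u v : psi (u - v) = psi u - psi v by rewrite psiD -scaleN1r psiZ mulN1r.
pose D := [set rnorm u ^+ 2 | u in [set u | psi u = 1]].
have D0 : D !=set0.
  by exists (rnorm ((psi u0)^-1 *: u0) ^+ 2), ((psi u0)^-1 *: u0) => //=;
    rewrite psiZ mulVf.
have lbD : has_lbound D by exists 0 => _ [v _ <-]; rewrite sqr_ge0.
pose d := inf D; have dle u : psi u = 1 -> d <= rnorm u ^+ 2.
  by move=> pu; apply: ge_inf => //; exists u.
(* By the parallelogram law, an excess of [16^-k / 4] over the infimum of the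
   squared norm forces steps of size at most [4^-k]. *)
pose ep k : R := 16^-1 ^+ k / 4.
have ep0 k : 0 < ep k by rewrite divr_gt0// exprn_gt0.
have step k : {u | psi u = 1 /\ rnorm u ^+ 2 < d + ep k}.
  by apply: cid; have [_ [u pu <-] h] := inf_adherent (ep0 k) (conj D0 lbD); exists u.
pose u k := sval (step k).
have pu k : psi (u k) = 1 by rewrite /u; case: (step k) => ? [].
have ud k : rnorm (u k) ^+ 2 < d + ep k by rewrite /u; case: (step k) => ? [].
have epS k : ep k.+1 <= ep k.
  rewrite /ep ler_pM2r ?invr_gt0// exprS ler_piMl ?exprn_ge0//.
  by rewrite invf_le1// ler1n.
have fast k : rnorm (u k.+1 - u k) <= 4^-1 ^+ k.
  rewrite -ler_sqr ?nnegrE ?rnorm_ge0 ?exprn_ge0//.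
  have := parallelogram (u k.+1) (u k).
  have half : psi (2^-1 *: (u k.+1 + u k)) = 1.
    by rewrite psiZ psiD !pu -mulr2n -mulr_natl mulr1 mulVf// pnatr_eq0.
  have : rnorm (u k.+1 + u k) ^+ 2 = 4 * rnorm (2^-1 *: (u k.+1 + u k)) ^+ 2.
    rewrite rnormZ exprMn.
    have -> : rnorm (2^-1 : R[i]) = 2^-1.
      by rewrite rnormV -(rnorm_realC (R := R) (r := 2))// rmorph_nat.
    by move: (rnorm (_ + _) ^+ 2) => q; field.
  have := dle _ half; have := ud k; have := ud k.+1; have := epS k.
  have : (4^-1 ^+ k) ^+ 2 = 4 * ep k :> R.
    by rewrite -exprM mulnC exprM /ep mulrC divfK//; congr (_ ^+ k); field.
  lra.
have [y hy] := complete fast.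
have py : psi y = 1.
  apply/eqP; rewrite -subr_eq0 -rnorm_eq0 eq_le rnorm_ge0 andbT.
  apply: (@le0_natSinv _ _ (`|M| * 2)) => k.
  have := psiM (u k - y); rewrite psiB pu rnormBC => /le_trans; apply.
  rewrite -mulrA; apply: le_trans (ler_wpM2l (normr_ge0 _) (hy k)).
  by apply: ler_wpM2r; [exact: rnorm_ge0|exact: ler_norm].
exists y => // v pv; rewrite -ler_sqr ?nnegrE ?rnorm_ge0//.
apply: le_trans (dle v pv); rewrite -subr_le0.
(* With [t = 1 / (k + 1)] and [n = rnorm (u k)]: [rnorm y <= n + 2 t], [n ^+ 2 <= d + t / 4] and
   [n <= d + 2], so [rnorm y ^+ 2 - d] is at most [t / 4 + 4 (d + 2) t + 4 t]. *)
apply: (@le0_natSinv _ _ (13 + 4 * d)) => k.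
have d0 : 0 <= d by apply: lb_le_inf => // _ [w _ <-]; rewrite sqr_ge0.
have pow : 16^-1 ^+ k <= k.+1%:R^-1 :> R.
  rewrite exprVn lef_pV2 ?posrE ?exprn_gt0// -natrX ler_nat.
  by apply: leq_trans (ltn_expl k (isT : 1 < 2)%N) _; case: k => // k; rewrite leq_exp2r.
have t1 : k.+1%:R^-1 <= 1 :> R by rewrite invf_le1// ler1n.
have t0 : 0 < k.+1%:R^-1 :> R by rewrite invr_gt0.
have := ud k; have := rnorm_dist y (u k); rewrite rnormBC; have := hy k.
have := rnorm_ge0 y; have := rnorm_ge0 (u k); have := rnorm_ge0 (u k - y).
rewrite /ep; move: pow t1 t0; set t := k.+1%:R^-1; set q := 16^-1 ^+ k.
set a := rnorm (u k - y); set n := rnorm (u k); set z := rnorm y.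
move=> qt t1 t0 a0 n0 z0 at2 zn nd.
have n2 : n <= d + 2 by nra.
have z2 : z <= n + 2 * t by lra.
have : z ^+ 2 <= (n + 2 * t) ^+ 2 by rewrite ler_sqr ?nnegrE//; lra.
have nt : n * t <= (d + 2) * t by rewrite ler_wpM2r// ltW.
have tt : t ^+ 2 <= t by rewrite expr2 ler_piMl// ltW.
rewrite sqrrD; lra.
Qed.

Lemma riesz_representation (psi : X -> R[i]) : bounded_functional psi ->
  exists w, forall u, psi u = ip u w.
Proof.
move=> hpsi; have [ne|] := pselect (exists u, psi u != 0); last first.
  move=> /forallNP h; exists 0 => u; rewrite (ip0r Hip); apply/eqP.
  by have := h u; move/negP; rewrite negbK.
have [y py ymin] := min_norm_on_hyperplane hpsi ne.
have [psil [M psiM]] := hpsi.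
have y0 : y != 0.
  apply/eqP => y0; have := psiM y; rewrite py y0 rnorm0 mulr0 rnorm1; lra.
have ry : 0 < rnorm y ^+ 2 by rewrite exprn_gt0// rnorm_gt0.
have orth v : psi v = 0 -> ip v y = 0.
  move=> pv; have [->|v0] := eqVneq v 0; first by rewrite (ip0l Hip).
  have rv : 0 < rnorm v ^+ 2 by rewrite exprn_gt0// rnorm_gt0.
  (* The best multiple of [v]: subtracting [t *: v] from [y] stays on the hyperplane and lowers the
     squared norm by [rnorm (ip y v) ^+ 2 / rnorm v ^+ 2], which minimality forces to be 0. *)
  pose t : R[i] := ((rnorm v ^+ 2)^-1)%:C * ip y v.
  have : psi (- t *: v + y) = 1 by rewrite psil pv mulr0 add0r.
  move=> /ymin; rewrite -ler_sqr ?nnegrE ?rnorm_ge0// rnorm_sqrD.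
  have -> : complex.Re (ip (- t *: v) y) = - (rnorm (ip y v) ^+ 2 / rnorm v ^+ 2).
    rewrite (ipZl Hip) (ip_conj Hip y v) mulNr /t -mulrA.
    have -> : ip y v * (ip y v)^* = (rnorm (ip y v) ^+ 2)%:C.
      by rewrite rmorphXn/= rnormE sqr_normc.
    by rewrite -rmorphM/= mulrC.
  rewrite rnormZ exprMn rnormN /t rnormM rnorm_realC; last by rewrite invr_ge0 ltW.
  set a := rnorm (ip y v); set n := rnorm v ^+ 2 in rv *.
  have -> : (n^-1 * a) ^+ 2 * n = a ^+ 2 / n.
    have : n != 0 by rewrite gt_eqF.
    by move: (n) (a) => n' a' n0; field.
  move=> h; have : a ^+ 2 / n <= 0 by move: h; set q := a ^+ 2 / n; lra.
  rewrite pmulr_lle0 ?invr_gt0// => a2.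
  have /eqP : a ^+ 2 = 0 by apply/eqP; rewrite eq_le a2 sqr_ge0.
  by rewrite expf_eq0 /= rnorm_eq0 => /eqP h'; rewrite (ip_conj Hip) h' rmorph0.
exists (((rnorm y ^+ 2)^-1)%:C *: y) => u.
have : ip (- psi u *: y + u) y = 0 by apply: orth; rewrite psil py mulr1 addNr.
rewrite (ip_linear Hip) (ip_norm Hip) mulNr addrC => /subr0_eq h.
by rewrite (ipZrr Hip) h mulrCA -rmorphM/= mulVf ?gt_eqF// mulr1.
Qed.

Lemma adjoint_exists (A : bop X) :
  exists B : bop X, forall f g, ip (A f) g = ip f (B g).
Proof.
have h g : exists w, forall f, ip (A f) g = ip f w.
  apply: riesz_representation; split.
    by move=> a u v; rewrite bop_lD bop_lZ (ip_linear Hip).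
  exists (rnorm g * opnorm A) => u; apply: le_trans (ip_cauchy_schwarz Hip _ _) _.
  by rewrite mulrC -mulrA ler_wpM2l ?rnorm_ge0// opnormP.
have [F hF] := choice h.
have FE f g : ip f (F g) = ip (A f) g by rewrite hF.
have [||B hB] := @bop_ex _ _ F.
- move=> a u v; apply: (ip_injr Hip) => f.
  by rewrite FE !(ipDr Hip) !(ipZr Hip) !FE.
- exists (opnorm A) => g.
  have [h0|h0] := eqVneq (F g) 0.
    by rewrite h0 rnorm0 mulr_ge0 ?opnorm_ge0 ?rnorm_ge0.
  have r0 : 0 < rnorm (F g) by rewrite rnorm_gt0.
  rewrite -(ler_pM2l r0) -expr2.
  have -> : rnorm (F g) ^+ 2 = rnorm (ip (F g) (F g)).
    by rewrite (ip_norm Hip) rnorm_realC// sqr_ge0.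
  rewrite FE; apply: le_trans (ip_cauchy_schwarz Hip _ _) _.
  by rewrite mulrCA mulrA ler_wpM2r ?rnorm_ge0// opnormP.
by exists B => f g; rewrite hB FE.
Qed.
End riesz_representation.

(** * The Hilbert space [L2] *)

Section L2_inner_product.
Context d (T : measurableType d) (R : realType).
Variable mu : {measure set T -> \bar R}.
Local Open Scope quotient_scope.
Implicit Types f g h : sqfun mu.

Lemma sqfun_measurable f :
  measurable_fun [set: T] (fun x => complex.Re (f x)) /\
  measurable_fun [set: T] (fun x => complex.Im (f x)).
Proof. by have [] := sqfunP f. Qed.

Lemma measurable_rnorm_sqr f :
  measurable_fun [set: T] ((fun x => (rnorm (f x) ^+ 2)%:E) : T -> \bar R).
Proof.
have [fr fi] := sqfun_measurable f; apply/measurable_EFinP.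
by apply: measurable_funX; exact: measurable_rnorm.
Qed.

Lemma rnorm_pi f : rnorm (\pi_(L2 mu) f) = sqnorm f.
Proof. by rewrite /rnorm [`|_|]L2_norm_pi. Qed.

Lemma sqnorm_sqr f : ((sqnorm f) ^+ 2)%:E = (\int[mu]_x (rnorm (f x) ^+ 2)%:E)%E.
Proof.
have s0 : 0 <= sqnorm f by rewrite -rnorm_pi rnorm_ge0.
rewrite -(powR_mulrn _ s0) -poweR_EFin sqnormE poweR_Lnorm//; apply: eq_integral => x _ /=.
by rewrite ger0_norm ?powR_mulrn ?rnorm_ge0.
Qed.

Definition sqprod f g (x : T) : R[i] := f x * (g x)^*.

Lemma Re_sqprod f g x : complex.Re (sqprod f g x) =
  complex.Re (f x) * complex.Re (g x) + complex.Im (f x) * complex.Im (g x).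
Proof. by rewrite /sqprod; case: (f x) (g x) => a b [a' b'] /=; ring. Qed.

Lemma Im_sqprod f g x : complex.Im (sqprod f g x) =
  complex.Im (f x) * complex.Re (g x) - complex.Re (f x) * complex.Im (g x).
Proof. by rewrite /sqprod; case: (f x) (g x) => a b [a' b'] /=; ring. Qed.

Lemma rnorm_sqprod f g x : rnorm (sqprod f g x) = rnorm (f x) * rnorm (g x).
Proof. by rewrite /sqprod rnormM rnorm_conj. Qed.

Lemma measurable_Re_sqprod f g :
  measurable_fun [set: T] (fun x => complex.Re (sqprod f g x)).
Proof.
have [fr fi] := sqfun_measurable f; have [gr gi] := sqfun_measurable g.
under eq_fun do rewrite Re_sqprod.
by apply: measurable_funD; apply: measurable_funM.
Qed.

Lemma measurable_Im_sqprod f g :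
  measurable_fun [set: T] (fun x => complex.Im (sqprod f g x)).
Proof.
have [fr fi] := sqfun_measurable f; have [gr gi] := sqfun_measurable g.
under eq_fun do rewrite Im_sqprod.
by apply: measurable_funB; apply: measurable_funM.
Qed.

Lemma integrable_rnorm_mul f g :
  mu.-integrable [set: T] (EFin \o (fun x => rnorm (f x) * rnorm (g x))).
Proof.
have := Lfun2_mul_Lfun1 (sqint_Lfun (sqfunP f)) (sqint_Lfun (sqfunP g)).
by move=> /Lfun1_integrable.
Qed.

Lemma integrable_Re_sqprod f g :
  mu.-integrable [set: T] (EFin \o (fun x => complex.Re (sqprod f g x))).
Proof.
apply: le_integrable (integrable_rnorm_mul f g) => //.
  by apply/measurable_EFinP; exact: measurable_Re_sqprod.
move=> x _ /=; rewrite lee_fin -rnorm_sqprod (le_trans (Re_le_rnorm _))//.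
exact: ler_norm.
Qed.

Lemma integrable_Im_sqprod f g :
  mu.-integrable [set: T] (EFin \o (fun x => complex.Im (sqprod f g x))).
Proof.
apply: le_integrable (integrable_rnorm_mul f g) => //.
  by apply/measurable_EFinP; exact: measurable_Im_sqprod.
move=> x _ /=; rewrite lee_fin -rnorm_sqprod (le_trans (Im_le_rnorm _))//.
exact: ler_norm.
Qed.

Lemma cintegral_ae f g f' g' : {ae mu, forall x, f x = f' x} ->
  {ae mu, forall x, g x = g' x} ->
  cintegral mu (sqprod f g) = cintegral mu (sqprod f' g').
Proof.
move=> ff gg; congr (_ +i* _); congr (fine _); apply: ae_eq_integral => //.
- by apply/measurable_EFinP; exact: measurable_Re_sqprod.
- by apply/measurable_EFinP; exact: measurable_Re_sqprod.
- by apply: filterS2 ff gg => x fx gx _; rewrite /sqprod fx gx.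
- by apply/measurable_EFinP; exact: measurable_Im_sqprod.
- by apply/measurable_EFinP; exact: measurable_Im_sqprod.
- by apply: filterS2 ff gg => x fx gx _; rewrite /sqprod fx gx.
Qed.

Lemma L2_inner_pi f g :
  L2_inner (\pi_(L2 mu) f) (\pi_(L2 mu) g) = cintegral mu (sqprod f g).
Proof. by apply: cintegral_ae; exact: L2_fun_pi. Qed.

Lemma cintegral_linear a f g h : cintegral mu (sqprod (a *: f + g) h) =
  a * cintegral mu (sqprod f h) + cintegral mu (sqprod g h).
Proof.
have fE x : (a *: f + g) x = a * f x + g x by [].
have If := integrable_Re_sqprod f h; have Jf := integrable_Im_sqprod f h.
have Ig := integrable_Re_sqprod g h; have Jg := integrable_Im_sqprod g h.
have IZ r (u : T -> R) : mu.-integrable [set: T] (EFin \o u) ->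
    mu.-integrable [set: T] (EFin \o (fun x => r * u x)).
  by move=> iu; exact: (integrableZl measurableT r iu).
have ID (u v : T -> R) : mu.-integrable [set: T] (EFin \o u) ->
    mu.-integrable [set: T] (EFin \o v) ->
    mu.-integrable [set: T] (EFin \o (fun x => u x + v x)).
  by move=> iu iv; exact: (integrableD measurableT iu iv).
rewrite /cintegral; case: a fE => ar ai fE; apply/eqP; rewrite eq_complex /=.
apply/andP; split; apply/eqP.
  transitivity (\int[mu]_x ((ar * complex.Re (sqprod f h x) +
      - ai * complex.Im (sqprod f h x)) + complex.Re (sqprod g h x)))%R.
    apply: eq_Rintegral => x _; rewrite !Re_sqprod Im_sqprod fE.
    by case: (f x) (g x) (h x) => ? ? [? ?] [? ?] /=; ring.
  rewrite RintegralD//; last by apply: ID; apply: IZ.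
  rewrite RintegralD//; [|exact: IZ|exact: IZ].
  by rewrite !RintegralZl//; ring.
transitivity (\int[mu]_x ((ar * complex.Im (sqprod f h x) +
    ai * complex.Re (sqprod f h x)) + complex.Im (sqprod g h x)))%R.
  apply: eq_Rintegral => x _; rewrite !Im_sqprod Re_sqprod fE.
  by case: (f x) (g x) (h x) => ? ? [? ?] [? ?] /=; ring.
rewrite RintegralD//; last by apply: ID; apply: IZ.
rewrite RintegralD//; [|exact: IZ|exact: IZ].
by rewrite !RintegralZl//; ring.
Qed.

Lemma cintegral_conj f g :
  cintegral mu (sqprod g f) = (cintegral mu (sqprod f g))^*.
Proof.
rewrite /cintegral; apply/eqP; rewrite eq_complex /=.
apply/andP; split; apply/eqP.
  by apply: eq_Rintegral => x _; rewrite !Re_sqprod; ring.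
transitivity (\int[mu]_x (- 1 * complex.Im (sqprod f g x)))%R.
  by apply: eq_Rintegral => x _; rewrite !Im_sqprod; ring.
by rewrite RintegralZl ?mulN1r//; exact: integrable_Im_sqprod.
Qed.

Lemma cintegral_norm f : cintegral mu (sqprod f f) = (sqnorm f ^+ 2)%:C.
Proof.
rewrite /cintegral; apply/eqP; rewrite eq_complex /=; apply/andP; split; apply/eqP.
  rewrite -[RHS]/(fine (_%:E)) sqnorm_sqr /Rintegral; congr fine.
  apply: eq_integral => x _; congr (_%:E); rewrite Re_sqprod /rnorm normc_def/=.
  by rewrite sqr_sqrtr ?addr_ge0 ?sqr_ge0// !expr2.
under eq_Rintegral => x _ do rewrite Im_sqprod mulrC subrr.
by rewrite /Rintegral integral0.
Qed.

Lemma L2_is_inner : is_inner (@L2_inner _ _ _ mu).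
Proof.
split.
- move=> a u v w; rewrite -[u]reprK -[v]reprK -[w]reprK.
  move: (repr u) (repr v) (repr w) => f g h.
  have -> : a *: \pi_(L2 mu) f + \pi_(L2 mu) g = \pi_(L2 mu) (a *: f + g).
    by rewrite Defs.pi_add Defs.pi_scale.
  by rewrite !L2_inner_pi cintegral_linear.
- move=> u v; rewrite -[u]reprK -[v]reprK !L2_inner_pi; exact: cintegral_conj.
- by move=> u; rewrite -[u]reprK L2_inner_pi rnorm_pi cintegral_norm.
Qed.
End L2_inner_product.

(** * Completeness of [L2] *)

Section L2_complete.
Context d (T : measurableType d) (R : realType).
Variable mu : {measure set T -> \bar R}.
Local Open Scope quotient_scope.

Lemma pi_sub (f g : sqfun mu) :
  \pi_(L2 mu) (f - g) = \pi_(L2 mu) f - \pi_(L2 mu) g.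
Proof.
rewrite Defs.pi_add -[- g]scaleN1r Defs.pi_scale.
by rewrite -[- \pi_(L2 mu) g]scaleN1r.
Qed.

Lemma rnorm_sqrE (z : R[i]) :
  rnorm z ^+ 2 = complex.Re z ^+ 2 + complex.Im z ^+ 2.
Proof. by rewrite /rnorm normc_def/= sqr_sqrtr ?addr_ge0 ?sqr_ge0. Qed.

Lemma geometric_cvg (a : nat -> R) (C : R) :
  (forall k, `|a k.+1 - a k| <= C * 2^-1 ^+ k) -> cvgn a.
Proof.
move=> h; have C0 : 0 <= C by have := le_trans (normr_ge0 _) (h 0%N); rewrite expr0 mulr1.
have hs : cvgn (series (telescope a)).
  apply: normed_cvg; apply: (@series_le_cvg _ _ (geometric C 2^-1)) => //.
  - by move=> n; exact: normr_ge0.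
  - by move=> n; apply: mulr_ge0 => //; exact: exprn_ge0.
  - by apply: is_cvg_geometric_series; rewrite ger0_norm// invf_lt1// ltr1n.
have -> : a = (fun n => a 0%N + series (telescope a) n).
  by apply/funext => n; rewrite -eq_sum_telescope.
by apply: is_cvgD => //; exact: is_cvg_cst.
Qed.

Lemma sum_geometric4 n : \sum_(0 <= k < n) (4^-1 : R) ^+ k <= 2.
Proof.
have -> : \sum_(0 <= k < n) (4^-1 : R) ^+ k = 4 / 3 - 4 / 3 * 4^-1 ^+ n.
  elim: n => [|n IH]; first by rewrite big_nil expr0; field.
  by rewrite big_nat_recr//= IH exprS; field.
have : 0 <= (4^-1 : R) ^+ n by rewrite exprn_ge0.
lra.
Qed.

(* The sum of the [4^k |D_k|^2] is integrable, hence finite almost everywhere,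
   and a finite value of it makes [|D_k|] decay like [2^-k]. *)
Lemma ae_fast_decay (D : nat -> sqfun mu) :
  (forall k, sqnorm (D k) <= 4^-1 ^+ k) ->
  {ae mu, forall x, exists C : R, forall k, rnorm (D k x) <= C * 2^-1 ^+ k}.
Proof.
move=> hD; pose g k x : \bar R := (4 ^+ k * rnorm (D k x) ^+ 2)%:E.
have g0 k x : (0 <= g k x)%E by rewrite lee_fin mulr_ge0 ?sqr_ge0// exprn_ge0.
have mg k : measurable_fun [set: T] (g k).
  have [mr mi] := sqfun_measurable (D k).
  apply/measurable_EFinP; apply: measurable_funM => //; apply: measurable_funX.
  exact: measurable_rnorm.
pose S x := (\sum_(0 <= k <oo) g k x)%E.
have intS : (\int[mu]_x S x <= 2%:E)%E.
  rewrite integral_nneseries//.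
  apply: lime_le; first by apply: is_cvg_nneseries => n _ _; apply: integral_ge0.
  apply: nearW => n; apply: le_trans (_ : (\sum_(0 <= k < n) ((4^-1 : R) ^+ k))%:E <= _)%E.
    rewrite -sumEFin; apply: lee_sum => k _.
    under eq_integral do rewrite /g EFinM.
    rewrite ge0_integralZl//; last 2 first.
    - exact: measurable_rnorm_sqr.
    - by move=> x _; rewrite lee_fin sqr_ge0.
    rewrite -sqnorm_sqr -EFinM lee_fin.
    have s0 : 0 <= sqnorm (D k) by rewrite -rnorm_pi rnorm_ge0.
    have p0 : 0 < (4 : R) ^+ k by rewrite exprn_gt0.
    rewrite mulrC -ler_pdivlMr//.
    have -> : (4^-1 : R) ^+ k / 4 ^+ k = (4^-1 ^+ k) ^+ 2 by rewrite exprVn expr2.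
    by rewrite ler_sqr ?nnegrE ?exprn_ge0.
  by rewrite lee_fin sum_geometric4.
have mS : measurable_fun [set: T] S.
  by apply: ge0_emeasurable_sum => // k x _ _; exact: g0.
have S0 x : (0 <= S x)%E by apply: nneseries_ge0 => k _ _; exact: g0.
have iS : mu.-integrable [set: T] S.
  apply/integrableP; split=> //; under eq_integral do rewrite gee0_abs//.
  by apply: le_lt_trans intS _; rewrite ltry.
have := integrable_ae measurableT iS; apply: filterS => x /(_ I) fS.
exists (Num.sqrt (fine (S x))) => k.
have gS : (g k x <= S x)%E.
  apply: le_trans (nneseries_lim_ge k.+1 _) => //.
  by rewrite big_nat_recr//= leeDr// sume_ge0.
move: gS; rewrite -(fineK fS) lee_fin => hk.
have p2 : 0 < (2 : R) ^+ k by rewrite exprn_gt0.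
rewrite exprVn ler_pdivlMr//.
rewrite -(ger0_norm (mulr_ge0 (rnorm_ge0 (D k x)) (ltW p2))) -sqrtr_sqr ler_wsqrtr//.
apply: le_trans hk; rewrite exprMn mulrC -exprM mulnC exprM.
by rewrite (_ : 2 ^+ 2 = 4 :> R)// expr2 -natrM.
Qed.
Lemma ReB (z w : R[i]) : complex.Re (z - w) = complex.Re z - complex.Re w.
Proof. by case: z w => ? ? [? ?]. Qed.

Lemma ImB (z w : R[i]) : complex.Im (z - w) = complex.Im z - complex.Im w.
Proof. by case: z w => ? ? [? ?]. Qed.

Lemma limn_esup_EFin (a : nat -> R) (l : R) : a @ \oo --> l ->
  fine (limn_esup (fun k => (a k)%:E)) = l.
Proof.
move=> al; have al' : (fun k => (a k)%:E) @ \oo --> l%:E.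
  by apply/fine_cvgP; split=> //; exact: nearW.
by have [_ ->] := cvg_limn_einf_sup al'.
Qed.

Lemma limn_einf_le (u : nat -> \bar R) (c : \bar R) : (forall n, (u n <= c)%E) ->
  (limn_einf u <= c)%E.
Proof.
move=> uc; rewrite limn_einf_lim; apply: lime_le; first exact: is_cvg_einfs.
apply: nearW => n; apply: le_trans (uc n).
by apply: ereal_inf_lbound; exists n => /=.
Qed.

Lemma sqint_of_integral (h : T -> R[i]) (c : R) :
  measurable_fun [set: T] (fun x => complex.Re (h x)) ->
  measurable_fun [set: T] (fun x => complex.Im (h x)) ->
  (\int[mu]_x (rnorm (h x) ^+ 2)%:E <= c%:E)%E -> h \in sqint mu.
Proof.
move=> mr mi hc; rewrite inE; split=> //; rewrite /finite_norm Lnorm.unlock.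
apply: poweR_lty; apply: le_lt_trans (ltry c); apply: le_trans hc.
rewrite le_eqVlt; apply/orP; left; apply/eqP; apply: eq_integral => x _ /=.
by rewrite ger0_norm ?powR_mulrn ?rnorm_ge0.
Qed.

Lemma L2_fast_complete : fast_complete (L2 mu).
Proof.
move=> u hu; pose F k : sqfun mu := repr (u k).
have uE k : u k = \pi_(L2 mu) (F k) by rewrite reprK.
have dist j k : sqnorm (F j - F k) = rnorm (u j - u k).
  by rewrite -rnorm_pi pi_sub -!uE.
have tail k j : rnorm (u (k + j)%N - u k) <= 2 * 4^-1 ^+ k.
  have q0 : 0 <= (4^-1 : R) ^+ k by rewrite exprn_ge0.
  (* The exact partial sum of the geometric series is what makes the induction on [j] close. *)
  have h : rnorm (u (k + j)%N - u k) <= 4 / 3 * 4^-1 ^+ k * (1 - 4^-1 ^+ j).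
    elim: j => [|j IH]; first by rewrite addn0 subrr rnorm0 expr0 subrr mulr0.
    rewrite addnS; have := rnorm_dist3 (u (k + j).+1) (u (k + j)%N) (u k).
    have := hu (k + j)%N; rewrite exprD exprS; move: IH q0.
    set p := 4^-1 ^+ j; set q := 4^-1 ^+ k; set s := q * p.
    rewrite (_ : 4 / 3 * q * (1 - p) = 4 / 3 * q - 4 / 3 * s); last by rewrite /s; ring.
    rewrite (_ : 4 / 3 * q * (1 - 4^-1 * p) = 4 / 3 * q - 3^-1 * s); last by rewrite /s; field.
    lra.
  apply: le_trans h _; have : 0 <= (4^-1 : R) ^+ j by rewrite exprn_ge0.
  by move: q0; set p := _ ^+ j; set q := _ ^+ k; nra.
(* The upper limit is measurable without any convergence, and [fine] makes it a total function;
   where the sequence converges it is the limit. *)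
pose f x : R[i] := (fine (limn_esup (fun k => (complex.Re (F k x))%:E)))
  +i* (fine (limn_esup (fun k => (complex.Im (F k x))%:E))).
have mf1 : measurable_fun [set: T] (fun x => complex.Re (f x)).
  apply: measurableT_comp => //; apply: measurable_fun_limn_esup => k.
  by apply/measurable_EFinP; have [] := sqfun_measurable (F k).
have mf2 : measurable_fun [set: T] (fun x => complex.Im (f x)).
  apply: measurableT_comp => //; apply: measurable_fun_limn_esup => k.
  by apply/measurable_EFinP; have [] := sqfun_measurable (F k).
have fF : {ae mu, forall x, (complex.Re (F k x)) @[k --> \oo] --> complex.Re (f x) /\
    (complex.Im (F k x)) @[k --> \oo] --> complex.Im (f x)}.
  have hD k : sqnorm (F k.+1 - F k) <= 4^-1 ^+ k by rewrite dist.
  have := ae_fast_decay hD; apply: filterS => x [C hC].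
  have cRe : cvgn (fun k => complex.Re (F k x)).
    apply: (@geometric_cvg _ C) => k; apply: le_trans (hC k).
    apply: le_trans (Re_le_rnorm _).
    rewrite le_eqVlt; apply/orP; left; apply/eqP; congr `|_|.
    by rewrite -?ReB -?ImB.
  have cIm : cvgn (fun k => complex.Im (F k x)).
    apply: (@geometric_cvg _ C) => k; apply: le_trans (hC k).
    apply: le_trans (Im_le_rnorm _).
    rewrite le_eqVlt; apply/orP; left; apply/eqP; congr `|_|.
    by rewrite -?ReB -?ImB.
  split=> /=.
    by move/cvg_ex : cRe => [l hl]; rewrite (limn_esup_EFin hl).
  by move/cvg_ex : cIm => [l hl]; rewrite (limn_esup_EFin hl).
have mdiff k : measurable_fun [set: T] (fun x => complex.Re (f x - F k x)) /\
    measurable_fun [set: T] (fun x => complex.Im (f x - F k x)).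
  have [m1 m2] := sqfun_measurable (F k); split.
    rewrite (_ : (fun _ => _) = (fun x => complex.Re (f x) - complex.Re (F k x))).
      exact: measurable_funB.
    by apply/funext => x; rewrite ReB.
  rewrite (_ : (fun _ => _) = (fun x => complex.Im (f x) - complex.Im (F k x))).
    exact: measurable_funB.
  by apply/funext => x; rewrite ImB.
(* Fatou's lemma along the tail [F (k + j) - F k], bounded uniformly in [j], gives the rate of
   convergence and, for [k = 0], the square integrability of the limit. *)
have bound k : (\int[mu]_x (rnorm (f x - F k x) ^+ 2)%:E <= ((2 * 4^-1 ^+ k) ^+ 2)%:E)%E.
  pose g j x : \bar R := (rnorm ((F (k + j)%N - F k) x) ^+ 2)%:E.
  have mg j : measurable_fun [set: T] (g j) by exact: measurable_rnorm_sqr.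
  have -> : (\int[mu]_x (rnorm (f x - F k x) ^+ 2)%:E =
      \int[mu]_x limn_einf (g ^~ x))%E.
    apply: ae_eq_integral => //.
    - have [m1 m2] := mdiff k; apply/measurable_EFinP; apply: measurable_funX.
      exact: measurable_rnorm.
    - rewrite /limn_einf; apply: measurableT_comp => //.
      apply: measurable_fun_limn_esup => j; exact: measurableT_comp.
    apply: filterS fF => x [cr ci] _; apply/esym.
    suff gl : g ^~ x @ \oo --> (rnorm (f x - F k x) ^+ 2)%:E.
      by have [-> _] := cvg_limn_einf_sup gl.
    apply/fine_cvgP; split; first exact: nearW.
    rewrite (_ : fine \o g ^~ x = (fun j =>
        (complex.Re (F (k + j)%N x) - complex.Re (F k x)) ^+ 2 +
        (complex.Im (F (k + j)%N x) - complex.Im (F k x)) ^+ 2)); last first.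
      by apply/funext => j; rewrite -ReB -ImB -rnorm_sqrE.
    have -> : rnorm (f x - F k x) ^+ 2 =
        (complex.Re (f x) - complex.Re (F k x)) ^+ 2 +
        (complex.Im (f x) - complex.Im (F k x)) ^+ 2.
      by rewrite rnorm_sqrE ReB ImB.
    have sh (a : nat -> R) (l : R) : a @ \oo --> l -> a (k + j)%N @[j --> \oo] --> l.
      by move=> al; under eq_fun do rewrite addnC; move: al; rewrite -(cvg_shiftn k).
    have sq (a : nat -> R) (l c : R) : a @ \oo --> l ->
        (a (k + j)%N - c) ^+ 2 @[j --> \oo] --> (l - c) ^+ 2.
      move=> al; have hb : a (k + j)%N - c @[j --> \oo] --> l - c.
        by apply: cvgB; [exact: sh|exact: cvg_cst].
      exact: (cvgM hb hb).
    exact: (cvgD (sq _ _ _ cr) (sq _ _ _ ci)).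
  apply: le_trans (fatou mu measurableT mg _) _.
    by move=> j x _; rewrite lee_fin sqr_ge0.
  apply: limn_einf_le => j; rewrite /g -sqnorm_sqr lee_fin dist.
  by rewrite ler_sqr ?nnegrE ?rnorm_ge0 ?mulr_ge0 ?exprn_ge0// tail.
have fin : f \in sqint mu.
  have h0 : (fun x => f x - F 0%N x) \in sqint mu.
    by have [m1 m2] := mdiff 0%N; exact: sqint_of_integral m1 m2 (bound 0%N).
  have -> : f = (fun x => f x - F 0%N x) + F 0%N.
    by apply/funext => x; rewrite !fctE subrK.
  by apply: rpredD => //; exact: valP.
pose f' : sqfun mu := SqFun fin.
exists (\pi_(L2 mu) f') => k; rewrite rnormBC uE -pi_sub rnorm_pi.
have s0 : 0 <= sqnorm (f' - F k) by rewrite -rnorm_pi rnorm_ge0.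
apply: (@le_trans _ _ (2 * 4^-1 ^+ k)).
  rewrite -ler_sqr ?nnegrE ?mulr_ge0 ?exprn_ge0//.
  by rewrite -lee_fin sqnorm_sqr; exact: bound.
rewrite ler_pM2l// exprVn lef_pV2 ?posrE ?exprn_gt0// -natrX ler_nat.
by rewrite ltn_expl.
Qed.
End L2_complete.

(** * Persistence of the dominating eigenvalues *)

Section dominating.
Context (R : realType) (X : normedModType R[i]) (ip : X -> X -> R[i]).
Context (Hip : is_inner ip).

Lemma norm_closedW (C : set X) : norm_closed C -> closed C.
Proof.
move=> hC y cy; apply: hC => e e0.
have ec : 0 < e%:C :> R[i] by rewrite ltcR.
have [u [Cu]] := cy _ (nbhsx_ballx y _ ec); rewrite -ball_normE/= => yu.
by exists u => //; rewrite rnormBC ltW// -ltcR rnormE.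
Qed.

Lemma norm_closed_ker (Y : normedModType R[i]) (f : X -> Y) :
  (forall u v, f (u - v) = f u - f v) ->
  (exists M : R, forall u, rnorm (f u) <= M * rnorm u) ->
  norm_closed [set u | f u = 0].
Proof.
move=> fB [M fM] y hy /=; apply/eqP; rewrite -rnorm_eq0 eq_le rnorm_ge0 andbT.
apply/ler_addgt0Pr => e e0; rewrite add0r; have M0 : 0 < `|M| + 1 by rewrite ltr_wpDl.
have [u /= fu uy] := hy _ (divr_gt0 e0 M0).
have : rnorm (f (u - y)) <= M * rnorm (u - y) by exact: fM.
rewrite fB fu sub0r rnormN => /le_trans; apply.
move: uy; rewrite ler_pdivlMr// mulrC; apply: le_trans.
by rewrite ler_wpM2r ?rnorm_ge0//; have := ler_norm M; lra.
Qed.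

Lemma ip_sum n (c : 'I_n -> R[i]) (e : 'I_n -> X) w :
  ip (\sum_i c i *: e i) w = \sum_i c i * ip (e i) w.
Proof.
rewrite (big_morph (ip^~ w) (fun u v => ipDl Hip u v w) (ip0l Hip w)).
by apply: eq_bigr => i _; rewrite ipZl.
Qed.

(** * Spectral splitting by a biorthogonal family of eigenvectors *)

Section spectral_splitting.
Context (m : nat) (A : bop X) (e ehat : 'I_m -> X) (lam : 'I_m -> R[i]).
Hypothesis biorth : forall i j, ip (e i) (ehat j) = (i == j)%:R.
Hypothesis eigen : forall i, A (e i) = lam i *: e i.
Hypothesis left_eigen : forall i u, ip (A u) (ehat i) = lam i * ip u (ehat i).

(* Its nonzero eigenvalues are those of the restriction of [A] to the common
   kernel [W] of the left eigenvectors. *)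
Definition deflation : bop X :=
  A + \sum_i rank1 (ip_functional Hip (ehat i)) (- (lam i *: e i)).

Let Q := deflation.
Let E : set X := [set \sum_(i < m) c i *: e i | c in [set: 'I_m -> R[i]]].
Let W : set X := [set u | forall j, ip u (ehat j) = 0].

Let coefE c j : ip (\sum_i c i *: e i) (ehat j) = c j.
Proof.
rewrite ip_sum (bigD1 j)//= biorth eqxx mulr1 big1 ?addr0// => i ij.
by rewrite biorth (negPf ij) mulr0.
Qed.

Lemma deflationE u : Q u = A u - \sum_i (lam i * ip u (ehat i)) *: e i.
Proof.
rewrite /Q /deflation bopD bop_sum -sumrN; congr (_ + _); apply: eq_bigr => i _.
by rewrite /= scalerN scalerA mulrC.
Qed.

Lemma ip_deflation u j : ip (Q u) (ehat j) = 0.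
Proof. by rewrite deflationE ipBl// left_eigen coefE subrr. Qed.

(** [Q] takes its values in the common kernel of the left eigenvectors, so an eigenvector for a
    nonzero eigenvalue lies there, and there [Q] and [A] agree. *)
Lemma deflation_eigen l u : l != 0 -> Q u = l *: u ->
  (forall j, ip u (ehat j) = 0) /\ A u = l *: u.
Proof.
move=> l0 Qu; have h j : ip u (ehat j) = 0.
  have := ip_deflation u j; rewrite Qu ipZl// => /eqP.
  by rewrite mulf_eq0 (negPf l0) /= => /eqP.
split=> //; rewrite -Qu deflationE big1 ?subr0// => i _.
by rewrite h mulr0 scale0r.
Qed.

Let QW u : W u -> Q u = A u.
Proof.
move=> Wu; rewrite deflationE big1 ?subr0// => i _.
by rewrite Wu mulr0 scale0r.
Qed.

Hypothesis Ac : seq_compact A.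

Lemma deflation_compact : seq_compact Q.
Proof.
apply: seq_compactD => //; apply: seq_compact_sum => i.
exact: seq_compact_rank1.
Qed.

Context (r c : R).
Hypotheses (r0 : 0 < r) (c0 : 0 < c).
Hypothesis Q_bound : forall l u, r <= rnorm l -> c * rnorm u <= rnorm (l *: u - Q u).
Hypothesis lam_inj : injective lam.
Hypothesis lam_gt : forall i, r < rnorm (lam i).

(** The resolvent [B] of [Q] preserves [W]: pairing [l *: B u - Q (B u) = u] with [ehat j] leaves
    only [l * ip (B u) (ehat j)] on the left. On [W], where [Q] is [A], it therefore inverts
    [l - A]. *)
Let spectrum_W l : spectrum_on A W l -> rnorm l <= r.
Proof.
move=> sl; rewrite leNgt; apply/negP => rl; apply: sl.
have l0 : l != 0 by rewrite -rnorm_gt0; exact: lt_trans rl.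
have [B [h1 h2 _]] := compact_resolvent deflation_compact l0 c0
  (fun u => Q_bound u (ltW rl)).
have BW u : W u -> W (B u).
  move=> Wu j; have := Wu j; rewrite -{1}(h2 u) ipBl// ip_deflation subr0 ipZl//.
  by move=> /eqP; rewrite mulf_eq0 (negPf l0) => /eqP.
exists B; split.
- split.
  + by move=> _ [u Wu <-]; exact: BW.
  + by move=> a u v _ _; rewrite bop_lD bop_lZ.
  + by exists (opnorm B) => u _; exact: opnormP.
- by move=> u Wu; rewrite -(QW Wu) h1.
- by move=> u Wu; rewrite -(QW (BW _ Wu)) h2.
Qed.

Lemma dominating_of_deflation_bound : (0 < m)%N ->
  has_dominating_simple_eigenvalues m A.
Proof.
move=> m0; split=> //; exists E, W.
have WB a u v : W u -> W v -> W (a *: u + v).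
  by move=> Wu Wv j; rewrite (ip_linear Hip) Wu Wv mulr0 addr0.
have projE u : E u <-> u - \sum_i ip u (ehat i) *: e i = 0.
  split=> [[x _ <-]|/subr0_eq ->]; last by exists (fun i => ip u (ehat i)).
  by rewrite [X in _ - X](_ : _ = \sum_i x i *: e i) ?subrr//;
    apply: eq_bigr => i _; rewrite coefE.
(* The complementary projection: [E] is its kernel, so the closedness of [E] follows from
   continuity. *)
pose P : bop X := bop_id X - \sum_i rank1 (ip_functional Hip (ehat i)) (e i).
have PE u : P u = u - \sum_i ip u (ehat i) *: e i.
  by rewrite /P bopB bop_sum.
split.
- split; split.
  + apply: norm_closedW.
    have -> : E = [set u | P u = 0].
      apply/seteqP; split=> u h; first by change (P u = 0); rewrite PE; apply/projE.
      by apply/projE; rewrite -PE.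
    apply: norm_closed_ker; first by move=> u v; exact: bop_lB.
    by exists (opnorm P) => u; exact: opnormP.
  + by exists (fun=> 0) => //; rewrite big1// => i _; rewrite scale0r.
  + move=> a _ _ [x _ <-] [y _ <-]; exists (fun i => a * x i + y i) => //.
    rewrite scaler_sumr -big_split/=; apply: eq_bigr => i _.
    by rewrite scalerDl scalerA.
  + apply: norm_closedW => u hu j.
    have hk := @norm_closed_ker (R[i]^o) (fun u => ip u (ehat j)).
    apply: hk; [by move=> x y; rewrite ipBl| |].
      by have [_ h] := ip_functional Hip (ehat j).
    by move=> e1 e10; have [v Wv vu] := hu _ e10; exists v => //; exact: Wv.
  + by move=> j; rewrite ip0l.
  + exact: WB.
- split.
  + move=> u; exists (\sum_i ip u (ehat i) *: e i).
    exists (u - \sum_i ip u (ehat i) *: e i); split.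
    * by exists (fun i => ip u (ehat i)).
    * by move=> j; rewrite ipBl// coefE subrr.
    * by rewrite addrC subrK.
  + apply/seteqP; split=> [_ [[x _ <-]] Wx|_ ->] /=.
      by rewrite big1// => i _; have := Wx i; rewrite coefE => ->; rewrite scale0r.
    split; last by move=> j; rewrite ip0l.
    by exists (fun=> 0) => //; rewrite big1// => i _; rewrite scale0r.
- split.
  + move=> _ [_ [x _ <-] <-]; exists (fun i => x i * lam i) => //.
    rewrite (big_morph A (bop_lD A) (linear0 _)); apply: eq_bigr => i _.
    by rewrite bop_lZ eigen scalerA.
  + by move=> _ [u Wu <-] j; rewrite left_eigen Wu mulr0.
- exists e; split=> // x x0 i.
  by rewrite -(coefE x i) x0 ip0l.
exists lam; split=> //.
- move=> i; exists (e i); split=> //.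
  + by exists (fun j => (j == i)%:R) => //; rewrite (bigD1 i)//= eqxx scale1r big1
      ?addr0// => j ji; rewrite (negPf ji) scale0r.
  + apply/eqP => ei0; have := biorth i i; rewrite ei0 ip0l// eqxx => /esym/eqP.
    by rewrite oner_eq0.
  + move=> _ [x _ <-] Ax; exists (x i).
    rewrite (bigD1 i)//= big1 ?addr0// => j ji.
    have := left_eigen j (\sum_i x i *: e i); rewrite Ax ipZl// coefE => /eqP.
    rewrite -subr_eq0 -mulrBl mulf_eq0 subr_eq0 => /orP[/eqP/lam_inj ij|/eqP ->].
      by rewrite ij eqxx in ji.
    by rewrite scale0r.
- move=> i; apply: le_lt_trans (lam_gt i).
  rewrite /spectral_radius_on.
  (* An empty spectrum gives the default radius [sup set0 = 0], still below [r]. *)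
  have [->|ne] := eqVneq [set rnorm l | l in spectrum_on A W] set0.
    by rewrite sup0 ltW.
  apply: ge_sup; first exact/set0P.
  by move=> _ [l sl <-]; exact: spectrum_W.
Qed.
End spectral_splitting.
End dominating.

(** * Simultaneous perturbation of several simple eigenvalues *)

Section perturbation.
Context (R : realType) (X : normedModType R[i]) (ip : X -> X -> R[i]).
Context (Hip : is_inner ip) (adj : bop X -> bop X).
Hypothesis adjP : forall (A : bop X) f g, ip (A f) g = ip f (adj A g).

Lemma eigenbranch_exists b (L : R -> bop X) lam0 : 0 < b -> C1_on b L ->
  (forall d, d \in `[0, b[ -> seq_compact (L d)) -> lam0 != 0 ->
  geometrically_simple (L 0) lam0 -> semisimple (L 0) lam0 ->
  exists eta e ehat lam, 0 < eta <= b /\ eigenbranch ip L lam0 eta e ehat lam.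
Proof.
move=> b0 LC1 Lc l0 [v [_ v0 Lv gv]] semi.
have rv : 0 < rnorm v by rewrite rnorm_gt0.
have tv : ((rnorm v)^-1)%:C != 0 :> R[i].
  by apply/eqP => /complexI/eqP; rewrite invr_eq0 gt_eqF.
apply: (simple_eigenvalue_branch Hip adjP (e0 := ((rnorm v)^-1)%:C *: v)) => //.
- by rewrite bop_lZ Lv !scalerA mulrC.
- by rewrite rnormZ rnorm_realC ?invr_ge0 ?rnorm_ge0// mulVf// gt_eqF.
- move=> u Lu; have [a ->] := gv u I Lu.
  by exists (a / ((rnorm v)^-1)%:C); rewrite scalerA divfK.
Qed.

Lemma eigenbranch_restrict L lam0 eta c e ehat lam : c <= eta ->
  eigenbranch ip L lam0 eta e ehat lam -> eigenbranch ip L lam0 c e ehat lam.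
Proof.
move=> ce [h1 h2 h3 h4 h5]; split=> //; try exact: C1_restrict ce _.
move=> d dc; apply: h5; move: dc; rewrite !in_itv/= => /andP[-> dc].
exact: lt_le_trans ce.
Qed.

Lemma bilinear_rank1 :
  bounded_Rbilinear (fun w e : X => rank1 (ip_functional Hip w) e).
Proof.
split.
- move=> w w' e; apply: bop_eq => u; rewrite bopB /=.
  by rewrite ipBr// scalerBl.
- by move=> w e e'; apply: bop_eq => u; rewrite bopB /= scalerBr.
- by move=> r w e; apply: bop_eq => u; rewrite bopZ /= ipZrr// scalerA.
- by move=> r w e; apply: bop_eq => u; rewrite bopZ /= !scalerA mulrC.
exists 1 => w e; rewrite mul1r rnorm_opnorm; apply: opnorm_bound.
  by rewrite mulr_ge0 ?rnorm_ge0.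
move=> u; rewrite /= rnormZ mulrAC ler_wpM2r ?rnorm_ge0// mulrC.
exact: ip_cauchy_schwarz.
Qed.

Lemma rcvg_sum (V : normedZmodType R[i]) T (F : set_system T) {FF : Filter F} n
    (f : 'I_n -> T -> V) (a : 'I_n -> V) : (forall i, rcvg F (f i) (a i)) ->
  rcvg F (fun x => \sum_i f i x) (\sum_i a i).
Proof.
move=> h; elim: (index_enum _) => [|i s IH].
  by rewrite big_nil; apply: (rcvg_ext (rcvg_cst (F := F) 0)); apply: nearW => x;
    rewrite big_nil.
rewrite big_cons; apply: (rcvg_ext (rcvgD (h i) IH)); apply: nearW => x.
by rewrite big_cons.
Qed.

(** Radial projection onto the circle of radius [rho], the means of carrying a lower bound known for
    [rho <= rnorm l] to slightly smaller moduli. *)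
Lemma rescale_to_modulus (l : R[i]) (rho : R) : l != 0 -> rnorm l <= rho ->
  exists2 l' : R[i], rnorm l' = rho & rnorm (l' - l) = rho - rnorm l.
Proof.
move=> l0 lrho; have rl : 0 < rnorm l by rewrite rnorm_gt0.
have q0 : 0 <= rho / rnorm l by rewrite divr_ge0 ?rnorm_ge0// (le_trans _ lrho) ?rnorm_ge0.
have q1 : 0 <= rho / rnorm l - 1 by rewrite subr_ge0 ler_pdivlMr// mul1r.
exists ((rho / rnorm l)%:C * l).
  by rewrite rnormM rnorm_realC// divfK ?gt_eqF.
have -> : (rho / rnorm l)%:C * l - l = (rho / rnorm l - 1)%:C * l.
  by rewrite rmorphB/= mulrBl mul1r.
by rewrite rnormM rnorm_realC// mulrBl divfK ?gt_eqF// mul1r.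
Qed.

(** Since [lam0] exhausts the eigenvalues of modulus at least [rho], the deflated operator has none
    there, and its lower bound separates the [m] branches from the rest of the spectrum for small
    parameters. *)
Theorem dominating_eigenvalues_persist b (L : R -> bop X) m (lam0 : 'I_m -> R[i])
    (rho : R) : 0 < b -> C1_on b L ->
  (forall d, d \in `[0, b[ -> seq_compact (L d)) -> (0 < m)%N -> 0 < rho ->
  injective lam0 -> (forall i, rho <= rnorm (lam0 i)) ->
  (forall i, geometrically_simple (L 0) (lam0 i)) ->
  (forall i, semisimple (L 0) (lam0 i)) ->
  (forall l, is_eigenvalue (L 0) l -> rho <= rnorm l -> exists i, l = lam0 i) ->
  exists (d1 : R) (e ehat : 'I_m -> R -> X) (lam : 'I_m -> R -> R[i]),
    [/\ 0 < d1 <= b, forall i, eigenbranch ip L (lam0 i) d1 (e i) (ehat i) (lam i),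
     forall d, d \in `[0, d1[ -> forall i j, ip (e i d) (ehat j d) = (i == j)%:R &
     forall d, d \in `[0, d1[ -> has_dominating_simple_eigenvalues m (L d)].
Proof.
move=> b0 LC1 Lc m0 rho0 inj0 lrho geo semi top.
have l0 i : lam0 i != 0 by rewrite -rnorm_gt0; exact: lt_le_trans (lrho i).
have step i : exists p : R * (R -> X) * (R -> X) * (R -> R[i]),
    0 < p.1.1.1 <= b /\ eigenbranch ip L (lam0 i) p.1.1.1 p.1.1.2 p.1.2 p.2.
  have [eta [e [ehat [lam h]]]] := eigenbranch_exists b0 LC1 Lc (l0 i) (geo i) (semi i).
  by exists (eta, e, ehat, lam).
have [p hp] := choice step.
pose e i := (p i).1.1.2; pose ehat i := (p i).1.2; pose lam i := (p i).2.
pose c := \big[Num.min/b]_i (p i).1.1.1.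
have c0 : 0 < c by apply: Order.POrderTheory.lt_bigmin => // i _; have [/andP[]] := hp i.
have cb : c <= b by exact: Order.TotalTheory.bigmin_le_id.
have br i : eigenbranch ip L (lam0 i) c (e i) (ehat i) (lam i).
  have [_] := hp i; apply: eigenbranch_restrict.
  exact: Order.TotalTheory.bigmin_le.
have in0 : 0 \in `[0, c[ by rewrite in_itv/= lexx.
have LC : C1_on c L := C1_restrict cb LC1.
have Lc' d : d \in `[0, c[ -> seq_compact (L d).
  move=> dc; apply: Lc; move: dc; rewrite !in_itv/= => /andP[-> h].
  exact: lt_le_trans cb.
have eig d i : d \in `[0, c[ -> L d (e i d) = lam i d *: e i d.
  by move=> dc; have [_ _ _ _ /(_ d dc)[]] := br i.
have leig d i u : d \in `[0, c[ -> ip (L d u) (ehat i d) = lam i d * ip u (ehat i d).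
  by move=> dc; have [_ _ _ _ /(_ d dc)[]] := br i.
have lam_at0 i : lam i 0 = lam0 i by have [] := br i.
have cvl i : rcvg (nbhs_in c 0) (lam i) (lam0 i).
  have [_ _ h _ _] := br i; rewrite -lam_at0; exact: (C1_continuous h in0).
(* Off the diagonal, left and right eigenvectors of distinct eigenvalues pair to 0; on it, this is
   the normalization of the branches. *)
have biorth d : d \in `[0, c[ -> injective (lam^~ d) ->
    forall i j, ip (e i d) (ehat j d) = (i == j)%:R.
  move=> dc li i j; have [->|ij] := eqVneq i j.
    by have [_ _ _ _ /(_ d dc)[]] := br j.
  have := leig d j (e i d) dc; rewrite eig// ipZl// => /eqP.
  rewrite -subr_eq0 -mulrBl mulf_eq0 subr_eq0 => /orP[/eqP/li h|/eqP//].
  by rewrite h eqxx in ij.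
have inj0' : injective (lam^~ 0) by move=> i j; rewrite !lam_at0; exact: inj0.
pose Q d := deflation Hip (L d) (e^~ d) (ehat^~ d) (lam^~ d).
have Qc d : d \in `[0, c[ -> seq_compact (Q d).
  by move=> dc; apply: deflation_compact => //; exact: Lc'.
have [|||k k0 hk] := @eigen_lower_bound _ _ (Q 0) [set l | rho <= rnorm l] (Qc 0 in0).
- by rewrite /= rnorm0 leNgt rho0.
- move=> l hl /=; apply/ler_addgt0Pr => x x0; have [l' /= h1 h2] := hl x x0.
  by have := rnorm_dist l' l; lra.
- move=> l u /= hl Qu.
  have ln0 : l != 0 by rewrite -rnorm_gt0; exact: lt_le_trans hl.
  have [Wu Lu] := deflation_eigen (biorth 0 in0 inj0')
    (fun i u => leig 0 i u in0) ln0 Qu.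
  (* A nonzero [u] would be an eigenvector of [L 0] for some [lam0 i], hence proportional to
     [e i 0]; but [u] pairs to 0 with [ehat i 0], and [e i 0] pairs to 1. *)
  have [//|u0] := eqVneq u 0; have [|i li] := top l _ hl; first by exists u.
  have [v [_ v0 Lv hv]] := geo i; have [a ua] := hv u I (etrans Lu (congr1 (fun z => z *: u) li)).
  have [a' ea] := hv (e i 0) I (etrans (eig 0 i in0) (congr1 (fun z => z *: e i 0) (lam_at0 i))).
  have : a' * ip v (ehat i 0) = 1 by rewrite -ipZl// -ea biorth// eqxx.
  have := Wu i; rewrite ua ipZl// => /eqP; rewrite mulf_eq0 => /orP[/eqP ->|/eqP ->].
    by rewrite scale0r.
  by rewrite mulr0 => /esym/eqP; rewrite oner_eq0.
(* Half of [c2] pays for lowering the radius from [rho] to [r = rho - c2 / 2], a quarter for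
   replacing [Q 0] by [Q s]; [c2 <= rho] keeps [r] positive. *)
pose c2 := Num.min k rho; have c20 : 0 < c2 by rewrite lt_min k0 rho0.
have c2k : c2 <= k by rewrite ge_min lexx.
have c2rho : c2 <= rho by rewrite ge_min lexx orbT.
pose r := rho - c2 / 2; have r0 : 0 < r by rewrite /r; lra.
have hr l u : r <= rnorm l -> c2 / 2 * rnorm u <= rnorm (l *: u - Q 0 u).
  move=> rl; have ru := rnorm_ge0 u.
  have [hl|/ltW hl] := leP rho (rnorm l); first by have := hk l u hl; nra.
  have ln0 : l != 0 by rewrite -rnorm_gt0; exact: lt_le_trans rl.
  have [l' hl' dl'] := rescale_to_modulus ln0 hl.
  have h1 : k * rnorm u <= rnorm (l' *: u - Q 0 u) by apply: hk; rewrite /= hl'.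
  have h2 := rnorm_dist3 (l' *: u) (l *: u) (Q 0 u).
  have h3 : rnorm (l' *: u - l *: u) = (rho - rnorm l) * rnorm u.
    by rewrite -scalerBl rnormZ dl'.
  by move: h2; rewrite h3; rewrite /r in rl; nra.
have near_inj : \forall s \near nbhs_in c 0, forall ij : 'I_m * 'I_m,
    ij.1 != ij.2 -> lam ij.1 s != lam ij.2 s.
  apply: filter_forall => -[i j] /=; have [->|ij] := eqVneq i j; first exact: nearW.
  pose proof (rcvgD (cvl i) (rcvgN (cvl j))) as hd.
  have ne : 0 < rnorm (lam0 i - lam0 j).
    rewrite rnorm_gt0 subr_eq0; apply: contra ij => /eqP /inj0 ->.
    exact: eqxx.
  apply: filterS (hd _ ne) => s hs _; apply: contraTneq hs => ->.
  by rewrite subrr sub0r rnormN ltxx.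
have near_gt : \forall s \near nbhs_in c 0, forall i, r < rnorm (lam i s).
  apply: filter_forall => i; have c22 : 0 < c2 / 2 by rewrite divr_gt0.
  apply: filterS (cvl i _ c22) => s; have := rnorm_dist (lam0 i) (lam i s).
  by rewrite rnormBC /r; have := lrho i; lra.
have near_Q : \forall s \near nbhs_in c 0, rnorm (Q s - Q 0) < c2 / 4.
  have hQ : rcvg (nbhs_in c 0) Q (Q 0).
    apply: rcvgD (C1_continuous LC in0) _; apply: rcvg_sum => i.
    have [h1 h2 h3 _ _] := br i.
    apply: (rcvg_bilinear bilinear_rank1 (C1_continuous h2 in0)).
    apply: rcvgN; apply: (rcvg_bilinear (bilinear_scale X) (C1_continuous h3 in0)).
    exact: (C1_continuous h1 in0).
  by apply: hQ; rewrite divr_gt0.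
have [d d0 hd] := near_nbhs_in_ball (filterI near_inj (filterI near_gt near_Q)).
exists (Num.min c d), e, ehat, lam.
have sub s : s \in `[0, Num.min c d[ -> (s \in `[0, c[) /\ (`|s - 0| < d).
  rewrite !in_itv/= lt_min => /and3P[s0 -> sd]; rewrite s0 subr0 ger0_norm//.
have inj s : s \in `[0, Num.min c d[ -> injective (lam^~ s).
  move=> /sub[sc sd] i j /= hij; apply/eqP; apply: contraT => ij.
  by have [/(_ (i, j) ij)/=] := hd s sc sd; rewrite hij eqxx.
split.
- by rewrite lt_min c0 d0 (le_trans _ cb)// ge_min lexx.
- by move=> i; apply: eigenbranch_restrict (br i); rewrite ge_min lexx.
- by move=> s sd; apply: biorth; [exact: (sub s sd).1|exact: inj].
move=> s sd; have [sc sd'] := sub s sd; have [_ [hgt hQ]] := hd s sc sd'.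
have c4 : 0 < c2 / 4 by rewrite divr_gt0.
apply: (@dominating_of_deflation_bound _ _ _ Hip m (L s) (e^~ s) (ehat^~ s) (lam^~ s)
  _ _ _ _ r (c2 / 4)) => //.
- by apply: biorth => //; exact: inj.
- by move=> i; exact: eig.
- by move=> i u; exact: leig.
- exact: Lc'.
- move=> l u rl; have h1 := hr l u rl.
  have h2 := rnorm_dist3 (l *: u) (Q s u) (Q 0 u).
  have h3 : rnorm (Q s u - Q 0 u) <= c2 / 4 * rnorm u.
    apply: le_trans (opnormP (Q s - Q 0) u) _.
    by rewrite ler_wpM2r ?rnorm_ge0// ltW.
  rewrite -/(Q s); lra.
- exact: inj.
Qed.
(** [A] is deflated at [z], or kept if [z] is no eigenvalue, which gives a lower bound at [z]. An
    eigenvector for [l != z] pairs to 0 with the left eigenvector at [z], so it survives the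
    deflation, and on it the bound reads [c <= rnorm (z - l)]. *)
Lemma simple_eigenvalue_isolated (A : bop X) (z : R[i]) : seq_compact A ->
  z != 0 -> (is_eigenvalue A z -> geometrically_simple A z /\ semisimple A z) ->
  exists2 c : R, 0 < c &
    forall l, is_eigenvalue A l -> l != z -> c <= rnorm (z - l).
Proof.
move=> Ac z0 hz.
have closed1 l : (forall e : R, 0 < e -> exists2 l', [set z] l' & rnorm (l' - l) <= e) ->
    [set z] l.
  move=> hl /=; apply/esym/eqP; rewrite -subr_eq0 -rnorm_eq0 eq_le rnorm_ge0 andbT.
  by apply/ler_addgt0Pr => e e0; rewrite add0r; have [_ ->] := hl e e0.
have nz : ~ [set z] 0 by move=> /= h; move: z0; rewrite -h eqxx.
suff [Q [Qc Qz Ql]] : exists Q : bop X, [/\ seq_compact Q,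
    forall u, Q u = z *: u -> u = 0 &
    forall l u, l != z -> A u = l *: u -> Q u = l *: u].
  have [|c c0 hc] := eigen_lower_bound Qc nz closed1; first by move=> l u ->; exact: Qz.
  exists c => // l [u u0 Au] lz; have := hc z u erefl; rewrite (Ql l u lz Au).
  by rewrite -scalerBl rnormZ ler_pM2r// rnorm_gt0.
have [ez|nez] := pselect (is_eigenvalue A z); last first.
  exists A; split=> // u Au; apply/eqP; apply: contra_notT nez => u0.
  by exists u.
have [gz sz] := hz ez.
(* The constant family supplies the left eigenvector of the single operator [A]. *)
have [eta [e [ehat [lam [/andP[eta0 _] [_ _ _ lam0 h]]]]]] :=
  eigenbranch_exists ltr01 (C1_cst 1 A) (fun _ _ => Ac) z0 gz sz.
have in0 : 0 \in `[0, eta[ by rewrite in_itv/= lexx.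
have [eig leig eh] := h 0 in0; rewrite lam0 in eig leig.
have bi (i j : 'I_1) : ip (e 0) (ehat 0) = (i == j)%:R.
  by rewrite eh !ord1 eqxx.
exists (deflation Hip A (fun=> e 0) (fun _ : 'I_1 => ehat 0) (fun=> z)); split.
- exact: deflation_compact.
- move=> u Qu; have [Wu Au] := deflation_eigen bi (fun _ => leig) z0 Qu.
  have [v [_ v0 Lv hv]] := gz; have [a ua] := hv u I Au.
  have [a' ea] := hv (e 0) I eig.
  have : a' * ip v (ehat 0) = 1 by rewrite -ipZl// -ea eh.
  have := Wu ord0; rewrite ua ipZl// => /eqP; rewrite mulf_eq0 => /orP[/eqP ->|/eqP ->].
    by rewrite scale0r.
  by rewrite mulr0 => /esym/eqP; rewrite oner_eq0.
- move=> l u lz Au; rewrite deflationE big_ord1.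
  have : ip u (ehat 0) = 0.
    have := leig u; rewrite Au ipZl// => /eqP.
    by rewrite -subr_eq0 -mulrBl mulf_eq0 subr_eq0 (negPf lz) => /eqP.
  by move=> ->; rewrite mulr0 scale0r subr0.
Qed.

(** All subdominant eigenvalues share one nonzero modulus. Infinitely many would accumulate at some
    [z] of that modulus; were [z] an eigenvalue, it would be subdominant, hence simple, so in any
    case no other eigenvalue is near it. *)
Lemma finite_subdominant (A : bop X) : seq_compact A ->
  (forall l, subdominant A l -> geometrically_simple A l) ->
  (forall l, subdominant A l -> l != 0 /\ semisimple A l) ->
  finite_set (subdominant A).
Proof.
move=> Ac geo semi; apply: contrapT => /infiniteP hinf; have [f] := elimT (@pcard_leP nat (R[i]^o) _ _) hinf.
have fS k : subdominant A (f k) by exact: funS.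
have f_inj k k' : f k = f k' -> k = k' by apply: inj; rewrite in_setT.
pose rho := rnorm (f 0%N).
have frho k : rnorm (f k) = rho.
  have [e1 l1 m1] := fS k; have [e2 l2 m2] := fS 0%N.
  by apply/eqP; rewrite eq_le m1// m2.
have fM k : rnorm (f k) <= rho by rewrite frho.
have [z [phi [phi1 phi2]]] := bolzano fM.
have zrho : rnorm z = rho.
  apply/eqP; rewrite eq_le -subr_le0 -[X in _ && X]subr_le0.
  apply/andP; split; apply: (@le0_natSinv _ _ 1) => k; rewrite mul1r;
    apply: le_trans (phi2 k); rewrite -(frho (phi k)).
    by rewrite lerBlDr rnormBC; exact: rnorm_dist.
  by rewrite lerBlDr; exact: rnorm_dist.
have [f0 _] := semi _ (fS 0%N).
have z0 : z != 0 by rewrite -rnorm_gt0 zrho rnorm_gt0.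
have [|c c0 hc] := @simple_eigenvalue_isolated A z Ac z0.
  move=> ez; have sz : subdominant A z.
    have [e2 l2 m2] := fS 0%N; split=> //; first by rewrite zrho.
    by move=> l' el' ll'; rewrite zrho; exact: m2.
  by split; [exact: geo|have [] := semi z sz].
have [N hN] := natSinv_small c0.
have eqz k : (N <= k)%N -> f (phi k) = z.
  move=> Nk; apply/eqP; apply: contraT => ne.
  have [ek _ _] := fS (phi k); have := hc _ ek ne; rewrite rnormBC leNgt.
  by rewrite (le_lt_trans (phi2 k) (hN k Nk)).
have : phi N = phi (phi N).+1.
  apply: f_inj; rewrite !eqz//; exact: leq_trans (phi1 N) (leqnSn _).
by move=> h; have := phi1 (phi N).+1; rewrite -h ltnn.
Qed.

(** Pairing with the fixed vector [ehat 0] removes the derivative of [e] from the computation. The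
    limit of the quotients is [ip (Ldot (e 0)) (ehat 0)]; the conjugate comes from exchanging the
    arguments. *)
Lemma eigenbranch_derivative L lam0 eta e ehat lam (Ldot : bop X) (ldot : R[i]) :
  0 < eta -> C1_on eta L -> eigenbranch ip L lam0 eta e ehat lam ->
  (d^-1)%:C *: (L d - L 0) @[d --> 0^'+] --> Ldot ->
  ((lam d - lam 0) / d%:C : R[i]^o) @[d --> 0^'+] --> (ldot : R[i]^o) ->
  ldot = (ip (ehat 0) (Ldot (e 0)))^*.
Proof.
move=> eta0 LC [eC ehC lC lam_0 hd] /rcvgP hL /rcvgP hl.
have in0 : 0 \in `[0, eta[ by rewrite in_itv/= lexx.
have [eig0 leig0 eh0] := hd 0 in0.
have toright (P : R -> Prop) : (\forall s \near nbhs_in eta 0, P s) ->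
    \forall s \near 0^'+, P s.
  move=> /near_nbhs_in_ball[r r0 hr].
  have m0 : 0 < Num.min eta r by rewrite lt_min eta0 r0.
  apply: filterS2 (nbhs_right_gt 0) (nbhs_right_lt m0) => s s0.
  rewrite lt_min => /andP[se sr]; apply: hr.
    by rewrite in_itv/= (ltW s0).
  by rewrite subr0 gtr0_norm.
have ce : rcvg (0:R)^'+ e (e 0).
  by move=> x x0; apply: toright; exact: (C1_continuous eC in0).
have hi := bilinear_ip Hip; have ha := bilinear_bop_app X.
have hm := bilinear_scale (R[i]^o).
pose proof (rcvg_bilinear hi (rcvg_bilinear ha hL ce)
  (rcvg_cst (F := (0:R)^'+) (ehat 0))) as h1.
pose proof (rcvg_bilinear hi ce (rcvg_cst (F := (0:R)^'+) (ehat 0))) as h2.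
pose proof (rcvg_bilinear hm hl h2) as h3.
rewrite -(ip_conj Hip); apply: (rcvg_unique _ _ h1).
rewrite eh0 in h3; rewrite -[ldot]mulr1.
apply: (rcvg_ext h3); apply: filterS2 (toright _ (near_nbhs_in_itv _ _)) (nbhs_right_gt 0) => s se s0.
have [eig _ _] := hd s se.
rewrite bopZ bopB (ipZl Hip) (ipBl Hip) eig (ipZl Hip) leig0 -mulrBl.
change ((lam s - lam 0) / s%:C * ip (e s) (ehat 0) =
  (s^-1)%:C * ((lam s - lam 0) * ip (e s) (ehat 0))).
by rewrite fmorphV/= mulrA [_^-1 * _]mulrC.
Qed.
End perturbation.

(** * Mixing operators on the unit interval *)

(** The Fredholm alternative: at a nonzero [l] without eigenvector, the lower bound for the single
    scalar [l] yields a bounded inverse. *)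
Lemma spectrum_eigenvalue (R : realType) (X : normedModType R[i]) (A : bop X)
    (l : R[i]) : seq_compact A -> l != 0 -> spectrum A l -> is_eigenvalue A l.
Proof.
move=> Ac l0 sl; apply: contrapT => nel.
have [|||c c0 hc] := @eigen_lower_bound _ _ A [set l] Ac.
- by move=> /= h; move: l0; rewrite -h eqxx.
- move=> l' hl' /=; apply/esym/eqP; rewrite -subr_eq0 -rnorm_eq0 eq_le rnorm_ge0 andbT.
  by apply/ler_addgt0Pr => e e0; rewrite add0r; have [_ ->] := hl' e e0.
- move=> _ u -> Au; apply/eqP; apply: contra_notT nel => u0; by exists u.
have [B [h1 h2 _]] := compact_resolvent Ac l0 c0 (fun u => hc l u erefl).
apply: sl; exists B; split=> //; split.
- by [].
- by move=> a u v _ _; rewrite bop_lD bop_lZ.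
- by exists (opnorm B) => u _; exact: opnormP.
Qed.

Section unit_interval.
Context (R : realType).
Local Notation mu := (lebesgue01 R).
Local Open Scope quotient_scope.

Lemma lebesgue01_setT : mu [set: measurableTypeR R] = 1%E.
Proof.
rewrite /lebesgue01 /= /mrestr setTI lebesgue_measure_itv /= lte_fin ltr01.
by rewrite sube0.
Qed.

Lemma cst1_sqint : (fun=> 1 : R[i]) \in sqint mu.
Proof.
apply: (@sqint_of_integral _ _ _ _ _ 1); [exact: measurable_cst|exact: measurable_cst|].
under eq_integral do rewrite rnorm1 expr1n.
by rewrite integral_cst// lebesgue01_setT mule1.
Qed.

Definition cst1 : sqfun mu := SqFun cst1_sqint.

(** As a pairing with the constant 1, the integral inherits linearity from the inner product. *)
Lemma L2_integralE (f : L2 mu) : L2_integral f = L2_inner f (\pi_(L2 mu) cst1).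
Proof.
rewrite -{2}[f]reprK L2_inner_pi /L2_integral; congr cintegral.
apply/funext => x; rewrite /sqprod /= /L2_fun.
by case: (repr f x) => a b /=; apply/eqP; rewrite eq_complex /=;
  apply/andP; split; apply/eqP; ring.
Qed.

Lemma L2_integral_linear (a : R[i]) (f g : L2 mu) :
  L2_integral (a *: f + g) = a * L2_integral f + L2_integral g.
Proof. by rewrite !L2_integralE (ip_linear (L2_is_inner mu)). Qed.

Lemma L2_integral_cst1 : L2_integral (\pi_(L2 mu) cst1) = 1.
Proof.
rewrite L2_integralE L2_inner_pi cintegral_norm; congr (_%:C).
apply: EFin_inj; rewrite sqnorm_sqr.
under eq_integral do rewrite rnorm1 expr1n.
by rewrite integral_cst// lebesgue01_setT mule1.
Qed.
End unit_interval.

Lemma adjointP d (T : measurableType d) (R : realType)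
    (mu : {measure set T -> \bar R}) (A : bop (L2 mu)) (f g : L2 mu) :
  L2_inner (A f) g = L2_inner f (adjoint A g).
Proof.
have [B hB] := adjoint_exists (L2_is_inner mu) (@L2_fast_complete _ _ _ mu) A.
rewrite /adjoint; case: xgetP => [C _ hC|h]; first exact: hC.
by have := h B.
Qed.

(** * The eigenvalues of a mixing operator *)

Section mixing.
Context (R : realType) (L : bop (L2 (lebesgue01 R))).
Hypothesis Lc : seq_compact L.
Hypothesis Lint : forall g, L2_integral (L g) = L2_integral g.
Hypothesis mixing : forall g, mean_zero g -> rnorm (iter n L g) @[n --> \oo] --> (0 : R).

Let integralB (f g : L2 (lebesgue01 R)) : L2_integral (f - g) = L2_integral f - L2_integral g.
Proof.
by rewrite addrC -scaleN1r L2_integral_linear mulN1r addrC.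
Qed.

Let integralZ (a : R[i]) (f : L2 (lebesgue01 R)) : L2_integral (a *: f) = a * L2_integral f.
Proof.
have i0 : L2_integral (0 : L2 (lebesgue01 R)) = 0.
  by rewrite -(subrr (0 : L2 (lebesgue01 R))) integralB subrr.
by have := L2_integral_linear a f 0; rewrite !addr0 i0 addr0.
Qed.

(** [iter n L v = l ^+ n *: v] would not tend to 0 for [1 <= rnorm l], against mixing. *)
Lemma mean_zero_eigenvalue l v : mean_zero v -> v != 0 -> L v = l *: v -> rnorm l < 1.
Proof.
move=> v0 vn Lv; rewrite ltNge; apply/negP => l1.
have itn n : iter n L v = l ^+ n *: v.
  elim: n => [|n IH]; first by rewrite expr0 scale1r.
  by rewrite iterS IH bop_lZ Lv scalerA exprSr.
have rv : 0 < rnorm v by rewrite rnorm_gt0.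
have /cvgrPdist_lt/(_ _ rv) [N _ /(_ N (leqnn N))] := mixing v0.
rewrite /= itn sub0r normrN ger0_norm ?rnorm_ge0// rnormZ ltNge => /negP; apply.
rewrite ler_peMl ?rnorm_ge0//.
by elim: (N) => [|k IH]; rewrite ?expr0 ?rnorm1// exprS rnormM mulr_ege1.
Qed.

(** [L] preserves the integral, so [l - 1] times the integral of [v] is 0. *)
Lemma eigenvector_mean_zero l v : l != 1 -> L v = l *: v -> mean_zero v.
Proof.
move=> l1 Lv; have := Lint v; rewrite Lv integralZ => /eqP.
by rewrite -subr_eq0 -{2}[L2_integral v]mul1r -mulrBl mulf_eq0 subr_eq0 (negPf l1)
  => /eqP.
Qed.

Lemma eigenvalue_lt1 l : is_eigenvalue L l -> l != 1 -> rnorm l < 1.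
Proof.
move=> [v v0 Lv] l1; apply: (mean_zero_eigenvalue _ v0 Lv).
exact: (eigenvector_mean_zero l1 Lv).
Qed.

Lemma mean_zero_fixed v : mean_zero v -> L v = v -> v = 0.
Proof.
move=> v0 Lv; apply/eqP; apply: contraT => vn.
have : L v = 1 *: v by rewrite scale1r.
by move=> /(mean_zero_eigenvalue v0 vn); rewrite rnorm1 ltxx.
Qed.

(** [1 - L] maps into the functions of mean zero, so the constant 1 is not in its range. *)
Lemma spectrum_1 : spectrum L 1.
Proof.
move=> [B [_ _ hB]]; have := hB (\pi_(L2 (lebesgue01 R))%qT (cst1 R)) I.
move=> /(congr1 (@L2_integral _ _ _ _)); rewrite scale1r integralB Lint subrr.
by rewrite L2_integral_cst1 => /esym/eqP; rewrite oner_eq0.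
Qed.

Lemma spectral_radius_1 : spectral_radius L = 1.
Proof.
have ub l : spectrum L l -> rnorm l <= 1.
  move=> sl; have [->|l1] := eqVneq l 1; first by rewrite rnorm1.
  have [->|l0] := eqVneq l 0; first by rewrite rnorm0.
  by apply/ltW/eigenvalue_lt1 => //; exact: spectrum_eigenvalue.
rewrite /spectral_radius /spectral_radius_on; apply/eqP; rewrite eq_le.
apply/andP; split.
  apply: ge_sup; first by exists (rnorm (1 : R[i])), 1 => //; exact: spectrum_1.
  by move=> _ [l sl <-]; exact: ub.
apply: ub_le_sup; first by exists 1 => _ [l sl <-]; exact: ub.
by exists 1; [exact: spectrum_1|exact: rnorm1].
Qed.

(** A fixed vector of mean zero vanishes. Hence its mean determines a fixed vector, and [L u - u],
    always of mean zero, vanishes as soon as it is fixed. *)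
Lemma simple_1 : geometrically_simple L 1 /\ semisimple L 1.
Proof.
have [v vn] : is_eigenvalue L 1.
  by apply: spectrum_eigenvalue => //; exact: spectrum_1.
rewrite scale1r => Lv; split.
  exists v; split=> //; first by rewrite scale1r.
  have iv : L2_integral v != 0.
    by apply: contra vn => /eqP iv; apply/eqP; exact: (mean_zero_fixed iv Lv).
  move=> w _; rewrite scale1r => Lw; exists (L2_integral w / L2_integral v).
  apply/subr0_eq/mean_zero_fixed; last by rewrite bop_lB bop_lZ Lv Lw.
  by rewrite /mean_zero /= integralB integralZ divfK// subrr.
move=> u /=; rewrite !scale1r => h; apply: mean_zero_fixed h.
by rewrite /mean_zero /= integralB Lint subrr.
Qed.
End mixing.
(** [L2_inner] is linear in its first argument, so [L d e = lam e] and [<e, ehat> = 1] force the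
    eigenvalue of the adjoint at [ehat] to be the conjugate of [lam], and the derivative to be the
    conjugate of [<ehat, Ldot e>]. Semisimplicity excludes a Jordan block, whose eigenvalue can
    split like the square root of the parameter and leave the class C1; at a nonzero eigenvalue the
    Riesz theory of compact operators applies. The eigenvalue 1 is not listed in [lam0], hence the
    count [n.+1]. *)
Theorem proposition2p6 (R : realType) (dbar : R)
    (L : R -> bop (L2 (lebesgue01 R))) :
  0 < dbar ->
  (forall d, d \in `[0, dbar[ -> compact_operator (L d)) ->
  (forall d, d \in `[0, dbar[ ->
     forall g, L2_integral (L d g) = L2_integral g) ->
  C1_on dbar L ->
  (forall g, mean_zero g ->
     rnorm (iter n (L 0) g) @[n --> \oo] --> (0 : R)) ->
  [/\ spectrum (L 0) 1,
      spectral_radius (L 0) = 1 &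
      (forall l, subdominant (L 0) l -> geometrically_simple (L 0) l) ->
      (forall l, subdominant (L 0) l -> l != 0 /\ semisimple (L 0) l) ->
      finite_set (subdominant (L 0)) /\
      forall (n : nat) (lam0 : 'I_n -> R[i]),
        set_bij [set: 'I_n] (subdominant (L 0)) lam0 ->
        exists d1 : R,
          [/\ 0 < d1 <= dbar,
              forall d, d \in `[0, d1[ ->
                has_dominating_simple_eigenvalues n.+1 (L d) &
              exists (e ehat : 'I_n -> R -> L2 (lebesgue01 R))
                     (lam : 'I_n -> R -> R[i]),
                [/\ forall i, [/\ C1_on d1 (e i), C1_on d1 (ehat i),
                      C1_on d1 (lam i : R -> R[i]^o) & lam i 0 = lam0 i],
                    forall d, d \in `[0, d1[ -> forall i,
                      L d (e i d) = lam i d *: e i d /\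
                      adjoint (L d) (ehat i d) = (lam i d)^* *: ehat i d,
                    forall d, d \in `[0, d1[ -> forall i j,
                      L2_inner (e i d) (ehat j d) = (i == j)%:R &
                    forall Ldot : bop (L2 (lebesgue01 R)),
                      (forall f, mean_zero (Ldot f)) ->
                      (d^-1)%:C *: (L d - L 0) @[d --> 0^'+] --> Ldot ->
                      forall i (ldot : R[i]),
                        ((lam i d - lam i 0) / d%:C : R[i]^o)
                          @[d --> 0^'+] --> (ldot : R[i]^o) ->
                        ldot = (L2_inner (ehat i 0) (Ldot (e i 0)))^*]]].
Proof.
move=> dbar0 Lc Lint LC1 mixing.
have in0 : 0 \in `[0, dbar[ by rewrite in_itv/= lexx.
have Ls d : d \in `[0, dbar[ -> seq_compact (L d).
  by move=> dd; apply: compact_operator_seq; exact: Lc.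
have L0s := Ls 0 in0; have L0int := Lint 0 in0.
split; [exact: spectrum_1|exact: spectral_radius_1|move=> geo semi].
have Hip := L2_is_inner (lebesgue01 R); have adjP := @adjointP _ _ _ (lebesgue01 R).
split; first exact: (finite_subdominant Hip adjP).
move=> n lam0 [lamS lamI lamJ].
have [geo1 semi1] := simple_1 L0s L0int mixing.
have lam_sub j : subdominant (L 0) (lam0 j) by exact: lamS.
have [rho [rho0 rho1 rhoE rho_top]] : exists rho : R, [/\ 0 < rho, rho <= 1,
    forall j, rnorm (lam0 j) = rho &
    forall l, is_eigenvalue (L 0) l -> rnorm l < 1 -> rho <= rnorm l ->
      subdominant (L 0) l].
  case: n lam0 lamS lamI lamJ lam_sub => [|n] lam0 lamS lamI lamJ lam_sub.
    (* With no subdominant eigenvalue, 1 alone dominates and [rho = 1]; the last condition is then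
       vacuous. *)
    exists 1; split=> //; first by case.
    by move=> l _ l1; rewrite leNgt l1.
  have [e0 l0 m0] := lam_sub ord0; have [lam00 _] := semi _ (lam_sub ord0).
  exists (rnorm (lam0 ord0)); split.
  - by rewrite rnorm_gt0.
  - exact: ltW.
  - move=> j; have [ej lj mj] := lam_sub j; apply/eqP.
    by rewrite eq_le m0// mj.
  - move=> l el l1 hl; split=> // l' el' l1'.
    by apply: le_trans hl; exact: m0.
(* The eigenvalue 1 is put at index 0 and [lam0] follows through [lift ord0]; all of them have
   modulus at least [rho]. *)
pose lamf (i : 'I_n.+1) : R[i] := oapp lam0 1 (unlift ord0 i).
have lamf0 : lamf ord0 = 1 by rewrite /lamf unlift_none.
have lamfS j : lamf (lift ord0 j) = lam0 j by rewrite /lamf liftK.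
have lam_n1 j : lam0 j != 1.
  have [_ lj _] := lam_sub j; apply: contraTneq lj => ->.
  by rewrite rnorm1 ltxx.
have [|||||d1 [e [ehat [lam [d1b br bi dom]]]]] :=
  @dominating_eigenvalues_persist _ _ _ Hip _ adjP dbar L n.+1 lamf rho
    dbar0 LC1 Ls isT rho0.
- move=> i j; case: (unliftP ord0 i) => [i' ->|->]; case: (unliftP ord0 j) => [j' ->|->];
    rewrite ?lamf0 ?lamfS //.
  + by move=> h; congr lift; apply: lamI => //; rewrite in_setT.
  + by move=> /eqP h; move: (lam_n1 i'); rewrite h.
  + by move=> /esym/eqP h; move: (lam_n1 j'); rewrite h.
- by move=> i; case: (unliftP ord0 i) => [i' ->|->]; rewrite ?lamf0 ?lamfS ?rhoE ?rnorm1.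
- by move=> i; case: (unliftP ord0 i) => [i' ->|->]; rewrite ?lamf0 ?lamfS //; exact: geo.
- move=> i; case: (unliftP ord0 i) => [i' ->|->]; rewrite ?lamf0 ?lamfS //.
  by have [] := semi _ (lam_sub i').
- move=> l el hl; have [->|l1] := eqVneq l 1; first by exists ord0.
  have sl : subdominant (L 0) l.
    by apply: rho_top => //; exact: (eigenvalue_lt1 L0int mixing el l1).
  by have [j _ <-] := lamJ l sl; exists (lift ord0 j).
exists d1; split=> //.
exists (fun i => e (lift ord0 i)), (fun i => ehat (lift ord0 i)),
  (fun i => lam (lift ord0 i)); split.
- by move=> i; have [h1 h2 h3 h4 _] := br (lift ord0 i); split=> //; rewrite h4.
- move=> d dd i; have [_ _ _ _ /(_ d dd)[h1 h2 _]] := br (lift ord0 i); split=> //.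
  apply: (ip_injr Hip) => u; rewrite -adjP h2 (ipZr Hip).
  by congr (_ * _); case: (lam _ d) => a b; apply/eqP; rewrite eq_complex /= opprK !eqxx.
- by move=> d dd i j; rewrite bi// (inj_eq lift_inj).
- move=> Ldot _ hL i ldot hl; have /andP[d10 d1d] := d1b.
  exact: (eigenbranch_derivative Hip d10 (C1_restrict d1d LC1) (br _) hL hl).
Qed.
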